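(* Let $G=(V,E)$ be an undirected graph with $n$ vertices and $m$ edges, and let $f\ge1$. There is a randomized $f$-fault-tolerant connectivity labeling scheme for $G$ that assigns labels of $O(\log n)$ bits to each vertex and $O(f+\log n)$ bits to each edge. The decoding time of the scheme is $\min\{O((f+\log n)f^2),\,O((f+\log n)^{\omega})\}$, and the labels can be computed in time $\widetilde{O}((m+n)f)$.
   Context: An $f$-fault-tolerant connectivity labeling scheme assigns a bit-string label to every vertex and every edge of $G$, together with a decoding algorithm that, given only the labels of two vertices $s,t$ and of the edges of a set $F\subseteq E$ with $|F|\le f$, outputs whether $s$ and $t$ are connected in $G\setminus F$. ''Randomized'' means the labels are produced by a randomized algorithm and for each fixed query $\langle s,t,F\rangle$ the answer is correct with high probability (at least $1-1/n^c$ for a desired constant $c$). $\omega$ denotes the exponent of matrix multiplication, and $\widetilde{O}$ hides polylogarithmic factors in $n$. *)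

(* Defs.v *)
From mathcomp Require Import all_boot all_order all_algebra.
From mathcomp Require Import boolp classical_sets reals exp.
Set Implicit Arguments.
Unset Strict Implicit.
Unset Printing Implicit Defensive.
Import Order.TTheory GRing.Theory Num.Theory.

(** * Randomized word RAM

    Running times are measured on a word RAM with [w]-bit words.  A program is
    one finite piece of code, independent of the input and of [w].  It has
    finitely many registers and finitely many arrays; the arrays are indexed by
    words and have disjoint address spaces.  Every instruction and every test
    costs 1.  The language is a deep embedding, so that no computation takes
    place outside of the cost model. *)

Inductive binop :=
  | Add | Sub | Mul | Div | Mod | Lt | Eq | And | Or | Xor | Shl | Shr.

Inductive cmd :=
  | Skip
  | Const (x k : nat)              (* x := k *)
  | Op (o : binop) (x y z : nat)   (* x := y o z *)
  | Read (x a y : nat)             (* x := a[y] *)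
  | Write (a y z : nat)            (* a[y] := z *)
  | Flip (x : nat)                 (* x := a fresh uniform random bit *)
  | Seq (p q : cmd)
  | If (x : nat) (p q : cmd)       (* a register is true when nonzero *)
  | While (x : nat) (p : cmd).

Record state := State {
  reg : nat -> nat;
  mem : nat -> nat -> nat;   (* [mem st a i] is cell [i] of array [a] *)
  coins : seq bool           (* the random bits not used so far *)
}.

Definition set_reg (st : state) (x v : nat) : state :=
  State (fun y => if y == x then v else reg st y) (mem st) (coins st).

Definition set_mem (st : state) (a i v : nat) : state :=
  State (reg st)
        (fun b j => if (b == a) && (j == i) then v else mem st b j)
        (coins st).

Definition set_coins (st : state) (r : seq bool) : state :=
  State (reg st) (mem st) r.

Definition binop_sem (w : nat) (o : binop) (u v : nat) : nat :=
  match o with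
  | Add => u + v
  | Sub => u + (2 ^ w - v)
  | Mul => u * v
  | Div => u %/ v
  | Mod => u %% v
  | Lt => u < v
  | Eq => u == v
  | And => Nat.land u v
  | Or => Nat.lor u v
  | Xor => Nat.lxor u v
  | Shl => u * 2 ^ v
  | Shr => u %/ 2 ^ v
  end %% 2 ^ w.

(** [exec w p st t st']: started in [st], the program [p] halts in [st'] after
    [t] steps.  [Flip] is stuck when no coin is left: an execution from
    [coins = [::]] is deterministic, and if a program halts on all the coin
    sequences of some length then its random choices are exactly uniform. *)
Inductive exec (w : nat) : cmd -> state -> nat -> state -> Prop :=
  | exec_skip st : exec w Skip st 1 st
  | exec_const x k st : exec w (Const x k) st 1 (set_reg st x (k %% 2 ^ w))
  | exec_op o x y z st :
      exec w (Op o x y z) st 1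
           (set_reg st x (binop_sem w o (reg st y) (reg st z)))
  | exec_read x a y st :
      exec w (Read x a y) st 1 (set_reg st x (mem st a (reg st y)))
  | exec_write a y z st :
      exec w (Write a y z) st 1 (set_mem st a (reg st y) (reg st z))
  | exec_flip x b r st of coins st = b :: r :
      exec w (Flip x) st 1 (set_coins (set_reg st x (b %% 2 ^ w)) r)
  | exec_seq p q st t1 st1 t2 st2 of
      exec w p st t1 st1 & exec w q st1 t2 st2 :
      exec w (Seq p q) st (t1 + t2) st2
  | exec_if_true x p q st t st' of reg st x != 0 & exec w p st t st' :
      exec w (If x p q) st t.+1 st'
  | exec_if_false x p q st t st' of reg st x = 0 & exec w q st t st' :
      exec w (If x p q) st t.+1 st'
  | exec_while_true x p st t1 st1 t2 st2 of
      reg st x != 0 & exec w p st t1 st1 & exec w (While x p) st1 t2 st2 :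
      exec w (While x p) st (t1 + t2).+1 st2
  | exec_while_false x p st of reg st x = 0 : exec w (While x p) st 1 st.

(** [exec] is functional, hence so is the existential below. *)
Definition runs (w : nat) (p : cmd) (st : state)
    (Q : nat -> state -> Prop) : Prop :=
  exists t st', exec w p st t st' /\ Q t st'.

(** The input [inp] is a list of sequences of words: sequence number [a] is in
    array [a] and its length is in register [a].  Everything else is
    uninitialized, i.e. contains arbitrary words. *)
Definition loaded (w : nat) (inp : seq (seq nat)) (st : state) : Prop :=
  [/\ forall x, reg st x < 2 ^ w,
      forall a i, mem st a i < 2 ^ w,
      forall a, a < size inp -> reg st a = size (nth [::] inp a)
    & forall a i, i < size (nth [::] inp a) ->
        mem st a i = nth 0 (nth [::] inp a) i].

Definition read_array (st : state) (a len : nat) : seq nat :=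
  mkseq (mem st a) len.

(** A list of bit strings is represented by two sequences, the lengths of the
    strings and their concatenation (one bit per word). *)
Definition strings_input (ls : seq bitseq) : seq (seq nat) :=
  [:: shape ls; map nat_of_bool (flatten ls)].

Definition read_strings (st : state) (a k : nat) : seq bitseq :=
  let sh := read_array st a k in
  reshape sh [seq x != 0 | x <- read_array st a.+1 (sumn sh)].

(** The number of bits of [n]: it lies between [log2 n] and [2 * log2 n] for
    [n >= 2], and it is 1, not 0, for [n = 1]. *)
Definition lg (n : nat) : nat := (trunc_log 2 n).+1.

(** * The exponent of matrix multiplication, over the field with 2 elements *)

Definition mx_seq (N : nat) (A : 'M['F_2]_N) : seq nat :=
  [seq (A i j : nat) | i <- enum 'I_N, j <- enum 'I_N].

Definition mm_in_time (R : realType) (tau : R) : Prop :=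
  exists (P : cmd) (K : nat),
  forall (N w : nat) (A B : 'M['F_2]_N) (st : state),
    0 < N -> K * lg N <= w ->
    loaded w [:: [:: N]; mx_seq A; mx_seq B] st ->
    runs w P (set_coins st [::]) (fun t st' =>
      (t%:R <= K%:R * powR N%:R tau :> R)%R /\
      read_array st' 0 (N * N) = mx_seq (A *m B)%R).

(** This infimum is not known to be attained.  A bound [O(N ^ omega)] has the
    usual meaning: [O(N ^ tau)] for every [tau > omega], and for
    [tau = omega] too if it is attained and greater than 2.  When [omega = 2]
    is attained, the known reductions of linear algebra to multiplication lose
    a logarithmic factor. *)
Definition omega (R : realType) : R := inf [set tau : R | mm_in_time tau].

(** * Graphs and labels

    A simple undirected graph on the vertices ['I_n] is a set [E] of unordered
    pairs.  Programs read it as a list of its edges, in any order and with any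
    orientation. *)

Definition simple_graph (n : nat) (E : {set {set 'I_n}}) : Prop :=
  {in E, forall e : {set 'I_n}, #|e| = 2}.

Definition edges_of (n : nat) (es : seq ('I_n * 'I_n)) : seq {set 'I_n} :=
  [seq [set e.1; e.2] | e <- es].

Definition connected_in (n : nat) (E : {set {set 'I_n}}) (s t : 'I_n) : bool :=
  connect [rel u v | [set u; v] \in E] s t.

Definition graph_input (n : nat) (es : seq ('I_n * 'I_n)) (f : nat) :
    seq (seq nat) :=
  [:: [:: n; f]; [seq val e.1 | e <- es]; [seq val e.2 | e <- es]].

(** The labeling algorithm leaves the vertex labels in arrays 0 and 1, and the
    edge labels, in the order of the input list, in arrays 2 and 3. *)
Definition vlabel (n : nat) (st : state) (v : 'I_n) : bitseq :=
  nth [::] (read_strings st 0 n) v.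

Definition elabel (n : nat) (es : seq ('I_n * 'I_n)) (st : state)
    (e : {set 'I_n}) : bitseq :=
  nth [::] (read_strings st 2 (size es)) (index e (edges_of es)).

(** What the decoding algorithm receives for the query [<s, t, F>], where [fs]
    lists [F]: labels, and nothing else. *)
Definition query_input (n : nat) (es : seq ('I_n * 'I_n)) (st : state)
    (s t : 'I_n) (fs : seq {set 'I_n}) : seq (seq nat) :=
  strings_input [:: vlabel st s, vlabel st t & map (elabel es st) fs].

(** The answer of the decoding algorithm is in register 0. *)
Definition answer (st : state) : bool := reg st 0 != 0.

(** The probability of [X] under [L] independent uniform bits. *)
Definition coin_prob (R : realType) (L : nat) (X : seq bool -> Prop) : R :=
  (#|[set r : L.-tuple bool | `[< X r >]]|%:R / (2 ^ L)%:R)%R.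

Definition fault_query (n f : nat) (E F : {set {set 'I_n}})
    (fs : seq {set 'I_n}) : Prop :=
  [/\ F \subset E, #|F| <= f & perm_eq fs (enum F)].

(* Main.v *)
(** Choose a spanning forest and the order of the vertices along a tour in which the side of
    each tree edge [e] is an interval, so that membership of a vertex is decided by comparing
    its position with the two end points stored in the label of [e].  Modulo 2 these sides
    form a basis of the cuts.  Draw [b = f + C log n] random vectors on the nontree edges and
    label an edge with the [b] inner products of these vectors with its fundamental cut (or
    with its own indicator vector, for a nontree edge).

    If [s] and [t] are separated by the faults [F], then the cut between them is a sum of
    fundamental cuts of edges of [F] with no nontree edge outside [F], which gives a linear
    combination of the labels of [F] that vanishes and crosses the tree path from [s] to [t]
    an odd number of times.  Conversely a vanishing combination comes from such a cut unless
    one of the at most [2 ^ f] combinations with a nonzero sum is orthogonal to all the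
    random vectors, which happens with probability at most [2 ^ (f - b)].

    So decoding asks whether a given vector lies in the span of [f] vectors of length
    [b + 1] over the field with two elements.  The rows are inserted one by one, and blocks of
    equal size are merged like the digits of a binary counter; eliminating a block of [s] rows
    from another one takes [W / s] products of [s]-by-[s] matrices, so that the total is a
    geometric sum dominated by its last term, because the exponent exceeds 2. *)

Require Import Defs.
From mathcomp Require Import all_boot all_order all_algebra.
From mathcomp Require Import boolp classical_sets reals exp.
From mathcomp Require Import zify ring lra.
Import Order.TTheory GRing.Theory Num.Theory.
Import Defs.
Set Implicit Arguments.
Unset Strict Implicit.
Unset Printing Implicit Defensive.

(** * Structured programs and their weakest preconditions *)

(** A single decoder meets both time bounds: its cost is of order [(f + log n) * f ^ (t - 1)], where
    [t] is an admissible exponent with [2 < t <= 3] and [t <= tau]. Schoolbook multiplication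
    guarantees that such a [t] exists. The fast multiplication program is known only by its
    specification, so it is relocated to registers and arrays that the decoder does not touch and
    called as a black box. Dropping dependent rows would destroy the block structure, so elimination
    ignores ranks. A block counts as reduced when reading any of its rows at the pivots and
    recombining the block rows gives that row back; zero rows satisfy this as well. A finished block
    is eliminated at once from as many following rows as it has, so merging needs only products of
    equal size. The tour is not found by traversal. Components are circular lists; accepting an edge
    exchanges two successors, and these delimit the sides of the edge from then on, because a later
    exchange inserts a whole cycle inside one side. Trees and cuts are handled through Boolean
    functions on the vertices rather than through paths. *)

Inductive expr :=
  | V of nat | N of nat | B of binop & expr & expr | A of nat & expr.

Inductive prog :=
  | PAsg of nat & expr
  | PSto of nat & expr & expr
  | PFlip of nat
  | PSeq of prog & prog
  | PIf of expr & prog & prog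
  | PWhile of expr & prog
  | PCall.

(** The clock [hk] stands for the step count; soundness only asks it to dominate the true number of
    machine steps. *)
Record hst := Hst {
  hr : nat -> nat;
  hm : nat -> nat -> nat;
  hc : seq bool;
  hk : nat
}.

Definition tick k s := Hst (hr s) (hm s) (hc s) (hk s + k).
Definition upr s x v :=
  Hst (fun y => if Nat.eqb y x then v else hr s y) (hm s) (hc s) (hk s).
(** The array is tested before the index, and by a test that computes on numerals, so that an
    untouched concrete array simplifies to the old one as a whole function. *)
Definition upm s a i v :=
  Hst (hr s)
      (fun b => if Nat.eqb b a then fun j => if j == i then v else hm s a j
                else hm s b) (hc s) (hk s).
Definition upc s r := Hst (hr s) (hm s) r (hk s).

Definition bop (o : binop) (u v : nat) : nat :=
  match o with
  | Add => u + v
  | Sub => u - v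
  | Mul => u * v
  | Div => u %/ v
  | Mod => u %% v
  | Lt => u < v
  | Eq => u == v
  | And => Nat.land u v
  | Or => Nat.lor u v
  | Xor => Nat.lxor u v
  | Shl => u * 2 ^ v
  | Shr => u %/ 2 ^ v
  end.

Fixpoint ev (s : hst) (e : expr) : nat :=
  match e with
  | V x => hr s x
  | N k => k
  | B o e1 e2 => bop o (ev s e1) (ev s e2)
  | A a e => hm s a (ev s e)
  end.

Fixpoint cost (e : expr) : nat :=
  match e with
  | V _ => 1
  | N _ => 1
  | B _ e1 e2 => (cost e1 + cost e2).+1
  | A _ e => (cost e).+1
  end.

Definition lim (w : nat) := 2 ^ w.

(** The conditions under which the machine operation modulo [2 ^ w] agrees with the exact one on
    natural numbers. Bitwise operations and left shifts are kept out of expressions; the compiler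
    uses [Or] only to copy registers. *)
Definition bsafe (w : nat) (o : binop) (u v : nat) : Prop :=
  match o with
  | Add => u + v < lim w
  | Sub => v <= u
  | Mul => u * v < lim w
  | Shl | And | Or | Xor => False
  | _ => True
  end.

Fixpoint safe (w : nat) (s : hst) (e : expr) : Prop :=
  match e with
  | V x => True
  | N k => k < lim w
  | B o e1 e2 => [/\ safe w s e1, safe w s e2 & bsafe w o (ev s e1) (ev s e2)]
  | A a e => safe w s e
  end.

(* Registers from [60] on hold temporaries; a called routine owns the registers
   from [100] on and the arrays from [20] on. *)
Fixpoint oke (e : expr) : bool :=
  match e with
  | V x => x < 60
  | N k => true
  | B o e1 e2 => oke e1 && oke e2
  | A a e => oke e
  end.

Fixpoint okp (p : prog) : bool :=
  match p with
  | PAsg x e => (x < 60) && oke e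
  | PSto a e1 e2 => oke e1 && oke e2
  | PFlip x => x < 60
  | PSeq p q => okp p && okp q
  | PIf e p q => [&& oke e, okp p & okp q]
  | PWhile e p => oke e && okp p
  | PCall => true
  end.

(** The language has no move instruction, hence the [Or] of a register with itself. Temporaries form
    a stack that starts at [t]. *)
Fixpoint ce (t : nat) (e : expr) : cmd :=
  match e with
  | V x => Op Or t x x
  | N k => Const t k
  | B o e1 e2 => Seq (ce t e1) (Seq (ce t.+1 e2) (Op o t t t.+1))
  | A a e => Seq (ce t e) (Read t a t)
  end.

Fixpoint cp (call : cmd) (p : prog) : cmd :=
  match p with
  | PAsg x e => Seq (ce 60 e) (Op Or x 60 60)
  | PSto a e1 e2 => Seq (ce 60 e1) (Seq (ce 61 e2) (Write a 60 61))
  | PFlip x => Flip x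
  | PSeq p q => Seq (cp call p) (cp call q)
  | PIf e p q => Seq (ce 60 e) (If 60 (cp call p) (cp call q))
  | PWhile e p => Seq (ce 60 e) (While 60 (Seq (cp call p) (ce 60 e)))
  | PCall => call
  end.

Section Wp.
Variables (w : nat) (cs : hst -> (hst -> Prop) -> Prop).

(** This is total correctness: a loop comes with its exact number of iterations and an invariant
    indexed by the iteration, which gives termination and carries the bounds on the clock. A call is
    an arbitrary predicate transformer [cs]. *)
Fixpoint wp (p : prog) (s : hst) (Q : hst -> Prop) : Prop :=
  match p with
  | PAsg x e => safe w s e /\ Q (tick (cost e).+1 (upr s x (ev s e)))
  | PSto a e1 e2 =>
      [/\ safe w s e1, safe w s e2 &
       Q (tick (cost e1 + cost e2).+1 (upm s a (ev s e1) (ev s e2)))]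
  | PFlip x =>
      hc s <> [::] /\
      Q (tick 1 (upr (upc s (behead (hc s))) x (head false (hc s))))
  | PSeq p q => wp p s (fun s' => wp q s' Q)
  | PIf e p q =>
      safe w s e /\
      (if ev s e != 0 then wp p (tick (cost e).+1 s) Q
       else wp q (tick (cost e).+1 s) Q)
  | PWhile e p =>
      exists N (I : nat -> hst -> Prop),
      [/\ I 0 s,
          forall i s', i < N -> I i s' ->
            [/\ safe w s' e, ev s' e != 0 &
             wp p (tick (cost e).+1 s') (I i.+1)]
        & forall s', I N s' ->
            [/\ safe w s' e, ev s' e = 0 & Q (tick (cost e).+1 s')]]
  | PCall => cs s Q
  end.

Hypothesis cs_mono : forall s (Q Q' : hst -> Prop),
  (forall s', Q s' -> Q' s') -> cs s Q -> cs s Q'.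

Lemma wp_mono p s (Q Q' : hst -> Prop) :
  (forall s', Q s' -> Q' s') -> wp p s Q -> wp p s Q'.
Proof.
elim: p s Q Q' => [x e|a e1 e2|x|p IHp q IHq|e p IHp q IHq|e p IHp|] s Q Q' QQ' /=.
- by case=> H /QQ'.
- by case=> H1 H2 /QQ'.
- by case=> H /QQ'.
- by apply: IHp => s'; apply: IHq.
- by case=> sf H; split=> //; case: ifP H => _ H; [apply: IHp H | apply: IHq H].
- case=> K [I [I0 IS IN]]; exists K, I; split=> // s' /IN[H1 H2 /QQ' H3].
  by split.
- exact: cs_mono.
Qed.

End Wp.
Arguments wp : simpl never.

Definition wf (w : nat) (st : state) : Prop :=
  (forall x, reg st x < lim w) /\ (forall a i, mem st a i < lim w).

Lemma lim_gt0 w : 0 < lim w. Proof. by rewrite expn_gt0. Qed.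

Lemma set_reg_wf w st x v : v < lim w -> wf w st -> wf w (set_reg st x v).
Proof. by move=> vl [H1 H2]; split=> // y /=; case: eqP. Qed.

Lemma exec_wf w p st t st' : exec w p st t st' -> wf w st -> wf w st'.
Proof.
elim=> {p st t st'} //.
- by move=> x k st W; apply: set_reg_wf => //; rewrite ltn_mod lim_gt0.
- by move=> o x y z st W; apply: set_reg_wf => //; rewrite /binop_sem ltn_mod lim_gt0.
- by move=> x a y st W; apply: set_reg_wf => //; case: W.
- by move=> a y z st [H1 H2]; split=> // b j /=; case: ifP.
- move=> x b r st _ W; have: wf w (set_reg st x (b %% 2 ^ w)).
    by apply: set_reg_wf => //; rewrite ltn_mod lim_gt0.
  by case=> H1 H2; split.
- by move=> p q st t1 st1 t2 st2 _ IH1 _ IH2 /IH1/IH2.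
- by move=> x p st t1 st1 t2 st2 _ _ IH1 _ IH2 /IH1/IH2.
Qed.

Definition sim (w : nat) (st : state) (s : hst) : Prop :=
  [/\ wf w st, forall x, x < 60 -> reg st x = hr s x,
      forall a i, mem st a i = hm s a i & coins st = hc s].

Lemma lim2 w : 0 < w -> 1 < lim w.
Proof. by move=> w0; rewrite /lim -{1}(expn0 2) ltn_exp2l. Qed.

Lemma exec_seq1 w p q st t st1 st2 :
  exec w p st t st1 -> exec w q st1 1 st2 -> exec w (Seq p q) st t.+1 st2.
Proof. by move=> E1 E2; rewrite -[t.+1]addn1; apply: exec_seq E1 E2. Qed.

Lemma exec_seq2 w p q r st t1 t2 st1 st2 st3 :
  exec w p st t1 st1 -> exec w q st1 t2 st2 -> exec w r st2 1 st3 ->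
  exec w (Seq p (Seq q r)) st (t1 + t2).+1 st3.
Proof. by move=> E1 E2 E3; rewrite -addnS; apply: exec_seq E1 (exec_seq1 E2 E3). Qed.

Section Sound.
Variables (w : nat).
Hypothesis w0 : 0 < w.

Lemma bop_ok o u v : u < lim w -> v < lim w -> bsafe w o u v ->
  bop o u v < lim w /\ binop_sem w o u v = bop o u v.
Proof.
have l1 := lim2 w0.
move=> ul vl sf; suff H : bop o u v < lim w.
  split=> //; rewrite /binop_sem -/(lim w).
  case: o sf H => //= sf H; try by rewrite modn_small.
  have -> : u + (lim w - v) = lim w + (u - v) by lia.
  by rewrite modnDl modn_small.
case: o sf => //=.
- by move=> _; apply: leq_ltn_trans (leq_subr _ _) ul.
- by move=> _; apply: leq_ltn_trans (leq_div _ _) ul.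
- by move=> _; apply: leq_ltn_trans (leq_mod _ _) ul.
- by move=> _; case: (u < v); lia.
- by move=> _; case: (u == v); lia.
- by move=> _; apply: leq_ltn_trans (leq_div _ _) ul.
Qed.

Lemma or_id u : u < lim w -> binop_sem w Or u u = u.
Proof. by move=> ul; rewrite /binop_sem PeanoNat.Nat.lor_diag modn_small. Qed.

(** Preservation of the registers below [t] is what keeps the first operand in [t] alive while the
    second one is computed from [t.+1] on. *)
Lemma ce_ok e t st s : 60 <= t -> oke e -> sim w st s -> safe w s e ->
  exists st', [/\ exec w (ce t e) st (cost e) st', sim w st' s,
    reg st' t = ev s e & forall x, x < t -> reg st' x = reg st x].
Proof.
elim: e t st => [x|k|o e1 IH1 e2 IH2|a e IH] t st t60 /=.
- move=> x60 S _; case: (S) => W R M C.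
  exists (set_reg st t (reg st x)); split=> //.
  + by rewrite -(or_id (proj1 W x)); apply: exec_op.
  + split=> //; first by apply: set_reg_wf => //; case: W.
    by move=> y y60 /=; case: eqP => [?|_]; [lia|exact: R].
  + by rewrite /= eqxx R.
  + by move=> y yt /=; case: eqP => // ?; lia.
- move=> _ S kl; case: (S) => W R M C; exists (set_reg st t (k %% 2 ^ w)); split=> //.
  + exact: exec_const.
  + split=> //; first by apply: set_reg_wf => //; rewrite ltn_mod lim_gt0.
    by move=> y y60 /=; case: eqP => [?|_]; [lia|exact: R].
  + by rewrite /= eqxx modn_small.
  + by move=> y yt /=; case: eqP => // ?; lia.
- case/andP=> o1 o2 S [s1 s2 sf].
  have [st1 [E1 S1 R1 F1]] := IH1 t st t60 o1 S s1.
  have [st2 [E2 S2 R2 F2]] := IH2 t.+1 st1 (leqW t60) o2 S1 s2.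
  have [W2 RR2 M2 C2] := S2.
  have R12 : reg st2 t = ev s e1 by rewrite F2.
  have := @bop_ok o (ev s e1) (ev s e2).
  rewrite -{1}R12 -{1}R2 => /(_ (proj1 W2 _) (proj1 W2 _) sf) [B1 B2].
  exists (set_reg st2 t (binop_sem w o (reg st2 t) (reg st2 t.+1))); split.
  + apply: exec_seq2 E1 E2 _; exact: exec_op.
  + split=> //; first by apply: set_reg_wf => //; rewrite R12 R2 B2.
    by move=> y y60 /=; case: eqP => [?|_]; [lia|exact: RR2].
  + by rewrite /= eqxx R12 R2 B2.
  + move=> y yt /=; case: eqP => [?|_]; first by lia.
    by rewrite F2 ?F1 //; lia.
- move=> o1 S s1; have [st1 [E1 S1 R1 F1]] := IH t st t60 o1 S s1.
  have [W RR M C] := S1.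
  exists (set_reg st1 t (mem st1 a (reg st1 t))); split.
  + apply: exec_seq1 E1 _; exact: exec_read.
  + split=> //; first by apply: set_reg_wf => //; case: W.
    by move=> y y60 /=; case: eqP => [?|_]; [lia|exact: RR].
  + by rewrite /= eqxx M R1.
  + by move=> y yt /=; case: eqP => [?|_]; [lia|rewrite F1].
Qed.

Lemma sim_tick st s k : sim w st s -> sim w st (tick k s).
Proof. by []. Qed.

Variables (call : cmd) (cs : hst -> (hst -> Prop) -> Prop).
Hypothesis call_ok : forall s st Q, sim w st s -> cs s Q ->
  exists t st' s', [/\ exec w call st t st', sim w st' s', Q s' & t + hk s <= hk s'].

(** A forward simulation by induction on the program: each construct ticks the clock by at least the
    number of instructions that its compiled code executes. *)
Lemma wp_sound p s st Q : okp p -> sim w st s -> wp w cs p s Q ->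
  exists t st' s',
    [/\ exec w (cp call p) st t st', sim w st' s', Q s' & t + hk s <= hk s'].
Proof.
elim: p s st Q => [x e|a e1 e2|x|p IHp q IHq|e p IHp q IHq|e p IHp|] s st Q /=.
- case/andP=> x60 oe S [sf HQ].
  have [st1 [E1 S1 R1 F1]] := ce_ok (leqnn 60) oe S sf.
  have [W RR M C] := S1.
  exists ((cost e).+1), (set_reg st1 x (reg st1 60)), (tick (cost e).+1 (upr s x (ev s e))).
  split=> //=; last by lia.
  + rewrite -(or_id (proj1 W 60)); apply: exec_seq1 E1 _; exact: exec_op.
  + split=> //; first by apply: set_reg_wf => //; case: W.
    move=> y y60 /=; rewrite R1.
    by case: eqP => [->|/PeanoNat.Nat.eqb_neq->]; rewrite ?PeanoNat.Nat.eqb_refl ?RR.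
- case/andP=> o1 o2 S [s1 s2 HQ].
  have [st1 [E1 S1 R1 F1]] := ce_ok (leqnn 60) o1 S s1.
  have [st2 [E2 S2 R2 F2]] := ce_ok (t := 61) isT o2 S1 s2.
  have [W RR M C] := S2.
  exists ((cost e1 + cost e2).+1), (set_mem st2 a (reg st2 60) (reg st2 61)),
    (tick (cost e1 + cost e2).+1 (upm s a (ev s e1) (ev s e2))).
  split=> //=; last by lia.
  + apply: exec_seq2 E1 E2 _; exact: exec_write.
  + have R12 : reg st2 60 = ev s e1 by rewrite F2.
    split=> //; last first.
      move=> b i /=; rewrite R12 R2.
      by case: eqP => [->|/PeanoNat.Nat.eqb_neq->]; rewrite ?PeanoNat.Nat.eqb_refl !M.
    by case: W => W1 W2; split=> // b i /=; case: ifP.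
- move=> x60 S [cn HQ]; have [W RR M C] := S.
  case E: (hc s) cn => [//|b r] _.
  exists 1, (set_coins (set_reg st x (b %% 2 ^ w)) r), (tick 1 (upr (upc s r) x b)).
  split=> //=; last by lia.
  + by apply: exec_flip; rewrite C E.
  + have bl : b < lim w by case: b {E} => /=; have := lim2 w0; lia.
    split=> //; last first.
      move=> y y60 /=; rewrite modn_small //.
      by case: eqP => [->|/PeanoNat.Nat.eqb_neq->]; rewrite ?PeanoNat.Nat.eqb_refl ?RR.
    by apply: (set_reg_wf _ _ W); rewrite modn_small.
  + by move: HQ; rewrite E.
- case/andP=> op oq S /(IHp _ _ _ op S)[t1 [st1 [s1 [E1 S1 HQ K1]]]].
  have [t2 [st2 [s2 [E2 S2 HQ2 K2]]]] := IHq _ _ _ oq S1 HQ.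
  exists (t1 + t2), st2, s2; split=> //; [exact: exec_seq E1 E2 | lia].
- case/and3P=> oe op oq S [sf HQ].
  have [st1 [E1 S1 R1 F1]] := ce_ok (leqnn 60) oe S sf.
  case: ifP HQ => b HQ.
    have [t2 [st2 [s2 [E2 S2 HQ2 K2]]]] := IHp _ _ _ op (sim_tick (cost e).+1 S1) HQ.
    exists (cost e + t2.+1), st2, s2; split=> //; last by move: K2 => /=; lia.
    apply: exec_seq E1 _; apply: exec_if_true E2; by rewrite R1 b.
  have [t2 [st2 [s2 [E2 S2 HQ2 K2]]]] := IHq _ _ _ oq (sim_tick (cost e).+1 S1) HQ.
  exists (cost e + t2.+1), st2, s2; split=> //; last by move: K2 => /=; lia.
  apply: exec_seq E1 _; apply: exec_if_false E2; rewrite R1; lia.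
- case/andP=> oe op S [K [I [I0 IS IN]]].
  (* [j] is the number of iterations left. The loop is entered after the test has been evaluated
     into register 60, where [While] looks for it. *)
  suff: forall j i s st, i + j = K -> I i s -> sim w st s -> safe w s e /\
    forall st1, sim w st1 s -> reg st1 60 = ev s e -> exists t st' s',
    [/\ exec w (While 60 (Seq (cp call p) (ce 60 e))) st1 t st', sim w st' s', Q s' &
        t + (cost e + hk s) <= hk s'].
    move=> /(_ K 0 s st (add0n _) I0 S) [sf H].
    have [st1 [E1 S1 R1 F1]] := ce_ok (leqnn 60) oe S sf.
    have [t [st' [s' [E' S' HQ K']]]] := H _ S1 R1.
    exists (cost e + t), st', s'; split=> //; [exact: exec_seq E1 E' | lia].
  elim=> [|j IHj] i s1 st1 ij Ii Si.
    rewrite addn0 in ij; rewrite {}ij in Ii.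
    have [sf e0 HQ] := IN _ Ii; split=> // st2 S2 R2.
    exists 1, st2, (tick (cost e).+1 s1); split=> //=; last by lia.
    by apply: exec_while_false; rewrite R2.
  have iK : i < K by lia.
  have [sf e1 Hw] := IS _ _ iK Ii; split=> // st2 S2 R2.
  have [t3 [st3 [s3 [E3 S3 I3 K3]]]] := IHp _ _ _ op (sim_tick (cost e).+1 S2) Hw.
  have [sf3 H3] := IHj _ _ _ (etrans (addSnnS _ _) ij) I3 S3.
  have [st4 [E4 S4 R4 F4]] := ce_ok (leqnn 60) oe S3 sf3.
  have [t5 [st5 [s5 [E5 S5 HQ K5]]]] := H3 _ S4 R4.
  exists ((t3 + cost e) + t5).+1, st5, s5; split=> //; last first.
    by move: K3 K5 => /=; lia.
  apply: exec_while_true E5; first by rewrite R2.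
  exact: exec_seq E3 E4.
- move=> _ S; exact: call_ok.
Qed.

End Sound.

(** * Relocation of an arbitrary program *)

Fixpoint shift (p : cmd) : cmd :=
  match p with
  | Skip => Skip
  | Const x k => Const (x + 100) k
  | Op o x y z => Op o (x + 100) (y + 100) (z + 100)
  | Read x a y => Read (x + 100) (a + 20) (y + 100)
  | Write a y z => Write (a + 20) (y + 100) (z + 100)
  | Flip x => Flip (x + 100)
  | Seq p q => Seq (shift p) (shift q)
  | If x p q => If (x + 100) (shift p) (shift q)
  | While x p => While (x + 100) (shift p)
  end.

Definition shifted (st st1 : state) : Prop :=
  [/\ forall x, reg st1 (x + 100) = reg st x,
      forall a i, mem st1 (a + 20) i = mem st a i & coins st1 = coins st].

Definition same_low (st st1 : state) : Prop :=
  (forall x, x < 100 -> reg st1 x = reg st x) /\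
  (forall a i, a < 20 -> mem st1 a i = mem st a i).

Lemma shifted_set_reg st st1 x v : shifted st st1 ->
  shifted (set_reg st x v) (set_reg st1 (x + 100) v).
Proof. by case=> R M C; split=> // y /=; rewrite eqn_add2r R. Qed.

Lemma same_low_set_reg st x v : same_low st (set_reg st (x + 100) v).
Proof. by split=> // y y60 /=; case: eqP => // ?; lia. Qed.

Lemma same_low_trans a b c : same_low a b -> same_low b c -> same_low a c.
Proof.
case=> [H1 H2] [H3 H4]; split.
  by move=> x xl; rewrite H3 // H1.
by move=> x i xl; rewrite H4 // H2.
Qed.

(** Translation of register and array numbers is injective, so every step is mirrored one to one.
    [same_low] protects the data of the caller. *)
Lemma exec_shift w p st t st' : exec w p st t st' ->
  forall st1, shifted st st1 ->
  exists st1', [/\ exec w (shift p) st1 t st1', shifted st' st1' & same_low st1 st1'].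
Proof.
elim=> {p st t st'}.
- by move=> st st1 S; exists st1; split=> //; apply: exec_skip.
- move=> x k st st1 S; eexists; split; [exact: exec_const| exact: shifted_set_reg|].
  exact: same_low_set_reg.
- move=> o x y z st st1 S; eexists; split; [exact: exec_op| |exact: same_low_set_reg].
  by case: (S) => R _ _; rewrite !R; apply: shifted_set_reg.
- move=> x a y st st1 S; eexists; split; [exact: exec_read| |exact: same_low_set_reg].
  by case: (S) => R M _; rewrite !R M; apply: shifted_set_reg.
- move=> a y z st st1 [R M C]; eexists; split; [exact: exec_write| |].
    by split=> // b i /=; rewrite !R M eqn_add2r.
  by split=> // b i b20 /=; case: eqP => // ?; lia.
- move=> x b r st E st1 S.
  exists (set_coins (set_reg st1 (x + 100) (b %% 2 ^ w)) r); split.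
  + by apply: exec_flip; case: S => _ _ ->.
  + by case: (shifted_set_reg x (b %% 2 ^ w) S) => R M _; split.
  + by have [H1 H2] := same_low_set_reg st1 x (b %% 2 ^ w); split.
- move=> p q st t1 st1 t2 st2 _ IH1 _ IH2 s /IH1[s1 [E1 S1 L1]].
  have [s2 [E2 S2 L2]] := IH2 _ S1.
  by exists s2; split=> //; [exact: exec_seq E1 E2 | exact: same_low_trans L1 L2].
- move=> x p q st t st' x0 _ IH s S; have [s1 [E1 S1 L1]] := IH _ S.
  by exists s1; split=> //; apply: exec_if_true => //; case: S => ->.
- move=> x p q st t st' x0 _ IH s S; have [s1 [E1 S1 L1]] := IH _ S.
  by exists s1; split=> //; apply: exec_if_false => //; case: S => ->.
- move=> x p st t1 st1 t2 st2 x0 _ IH1 _ IH2 s S; have [s1 [E1 S1 L1]] := IH1 _ S.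
  have [s2 [E2 S2 L2]] := IH2 _ S1.
  exists s2; split=> //; last exact: same_low_trans L1 L2.
  by apply: exec_while_true E1 E2; case: S => ->.
- by move=> x p st x0 s S; exists s; split=> //; apply: exec_while_false; case: S => ->.
Qed.

(* A call may change all the arrays from [20] on: this is what [20 \in Y] means. *)
Definition frame (X Y : seq nat) (s s' : hst) : Prop :=
  [/\ forall y, y \notin X -> hr s' y = hr s y,
      forall a, a \notin Y -> (a < 20) || (20 \notin Y) -> hm s' a = hm s a &
      hc s' = hc s].

Lemma frR X Y s s' : frame X Y s s' -> forall y, y \notin X -> hr s' y = hr s y.
Proof. by case. Qed.

Lemma frM X Y s s' : frame X Y s s' -> forall a, a \notin Y ->
  (a < 20) || (20 \notin Y) -> hm s' a = hm s a.
Proof. by case. Qed.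

Lemma frC X Y s s' : frame X Y s s' -> hc s' = hc s.
Proof. by case. Qed.

Lemma frame_refl X Y s : frame X Y s s. Proof. by []. Qed.

Lemma frame_tick X Y s s' k : frame X Y s s' -> frame X Y s (tick k s').
Proof. by []. Qed.

Lemma frame_upr X Y s s' x v : x \in X -> frame X Y s s' -> frame X Y s (upr s' x v).
Proof.
move=> xX [R M C]; split=> // y yX /=; rewrite -R //.
by case: PeanoNat.Nat.eqb_spec => // e; rewrite e xX in yX.
Qed.

Lemma frame_upm X Y s s' x i v : x \in Y -> frame X Y s s' -> frame X Y s (upm s' x i v).
Proof.
move=> xX [R M C]; split=> // y yX y20 /=; rewrite -M //.
by case: PeanoNat.Nat.eqb_spec => // e; rewrite e xX in yX.
Qed.

Lemma frame_step X' Y' X Y s1 s2 s3 : frame X Y s1 s2 -> frame X' Y' s2 s3 ->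
  all [in X] X' -> all [in Y] Y' -> frame X Y s1 s3.
Proof.
move=> [R1 M1 C1] [R2 M2 C2] /allP sX /allP sY; split; last by rewrite C2.
  by move=> y yX; rewrite R2 ?R1 //; apply: contra yX; apply: sX.
move=> a aY a20; rewrite M2 ?M1 //; first by apply: contra aY; apply: sY.
by case/orP: a20 => [->//|h]; apply/orP; right; apply: contra h; apply: sY.
Qed.

Ltac fr :=
  lazymatch goal with
  | |- frame _ _ _ (tick _ _) => apply: frame_tick; fr
  | |- frame _ _ _ (upr _ _ _) => apply: frame_upr; [by rewrite ?inE ?eqxx ?orbT | fr]
  | |- frame _ _ _ (upm _ _ _ _) => apply: frame_upm; [by rewrite ?inE ?eqxx ?orbT | fr]
  | H : frame ?X ?Y ?s ?t |- frame ?X ?Y ?s ?t => exact: H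
  | |- frame _ _ ?s ?s => exact: frame_refl
  | H : frame _ _ _ ?t |- frame _ _ _ ?t => apply: (frame_step _ H); [fr | by rewrite /= ?inE ?eqxx ?orbT | by rewrite /= ?inE ?eqxx ?orbT]
  | _ => idtac
  end.
Ltac sp := repeat match goal with
  | |- True => exact Logic.I
  | |- _ /\ _ => split
  | |- and3 _ _ _ => split
  | |- and4 _ _ _ _ => split
  | |- and5 _ _ _ _ _ => split
  end.

(* Linear arithmetic with quotients and products as atoms. *)
Ltac notnum a := lazymatch a with S _ => fail | O => fail | _ => idtac end.
Ltac alia :=
  repeat match goal with
  | H : context [divn ?a ?b] |- _ => let x := fresh in set x := divn a b in *; clearbody x
  | |- context [divn ?a ?b] => let x := fresh in set x := divn a b in *; clearbody x
  | H : context [modn ?a ?b] |- _ => let x := fresh in set x := modn a b in *; clearbody x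
  | |- context [modn ?a ?b] => let x := fresh in set x := modn a b in *; clearbody x
  end;
  repeat match goal with
  | H : context [muln ?a ?b] |- _ => notnum a; notnum b;
      let x := fresh in set x := muln a b in *; clearbody x
  | |- context [muln ?a ?b] => notnum a; notnum b;
      let x := fresh in set x := muln a b in *; clearbody x
  end; lia.

Notation "p ;; q" := (PSeq p q) (at level 61, right associativity).
Notation "a +! b" := (B Add a b) (at level 50, left associativity).
Notation "a -! b" := (B Sub a b) (at level 50, left associativity).
Notation "a *! b" := (B Mul a b) (at level 40, left associativity).
Notation "a /! b" := (B Div a b) (at level 40, left associativity).
Notation "a %! b" := (B Mod a b) (at level 40, left associativity).
Notation "a <! b" := (B Lt a b) (at level 51, no associativity).
Notation "a ==! b" := (B Eq a b) (at level 51, no associativity).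
Notation "x ::= e" := (PAsg x e) (at level 60, no associativity).

Lemma hr_upr s x v y : hr (upr s x v) y = if y == x then v else hr s y.
Proof.
by rewrite /=; case: eqP => [->|/PeanoNat.Nat.eqb_neq->]; rewrite ?PeanoNat.Nat.eqb_refl.
Qed.

Lemma hr_tick s k : hr (tick k s) = hr s. Proof. by []. Qed.

(** * Rules for counted loops *)

Section Rules.
Variables (w : nat) (cs : hst -> (hst -> Prop) -> Prop).
Hypothesis cs_mono : forall s (Q Q' : hst -> Prop),
  (forall s', Q s' -> Q' s') -> cs s Q -> cs s Q'.
Notation wp := (wp w cs).

Lemma wp_seq p q s (Q : hst -> Prop) : wp p s (fun s' => wp q s' Q) -> wp (PSeq p q) s Q.
Proof. by []. Qed.

Lemma wp_asg x e s (Q : hst -> Prop) : safe w s e ->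
  Q (tick (cost e).+1 (upr s x (ev s e))) -> wp (PAsg x e) s Q.
Proof. by []. Qed.

Lemma wp_sto a e1 e2 s (Q : hst -> Prop) : safe w s e1 -> safe w s e2 ->
  Q (tick (cost e1 + cost e2).+1 (upm s a (ev s e1) (ev s e2))) ->
  wp (PSto a e1 e2) s Q.
Proof. by []. Qed.

Lemma wp_if e p q s (Q : hst -> Prop) : safe w s e ->
  (ev s e != 0 -> wp p (tick (cost e).+1 s) Q) ->
  (ev s e = 0 -> wp q (tick (cost e).+1 s) Q) -> wp (PIf e p q) s Q.
Proof. by move=> sf H1 H2; split=> //; case: eqP => /= [/H2|/eqP/H1]. Qed.

Definition PFor x y p :=
  PSeq (PAsg x (N 0)) (PWhile (B Lt (V x) (V y)) (PSeq p (PAsg x (B Add (V x) (N 1))))).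

Lemma wp_for x y p s (Q : hst -> Prop) K (I : nat -> hst -> Prop) :
  Nat.eqb y x = false -> K < lim w -> hr s y = K ->
  I 0 (tick 2 (upr s x 0)) ->
  (forall i s', i < K -> hr s' x = i -> hr s' y = K -> I i s' ->
    wp p (tick 4 s') (fun s2 =>
      [/\ hr s2 x = i, hr s2 y = K & I i.+1 (tick 4 (upr s2 x i.+1))])) ->
  (forall s', hr s' x = K -> hr s' y = K -> I K s' -> Q (tick 4 s')) ->
  wp (PFor x y p) s Q.
Proof.
move=> yx Kl sy I0 IS IN; apply: wp_seq; apply: wp_asg => /=; first exact: lim_gt0.
exists K, (fun i s' => [/\ hr s' x = i, hr s' y = K & I i s']); split.
- by split=> //=; rewrite ?PeanoNat.Nat.eqb_refl // yx.
- move=> i s' iK [xi yK Ii]; split=> //=; first by rewrite xi yK iK.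
  apply: (wp_mono cs_mono _ (IS i s' iK xi yK Ii)) => s2 [x2 y2 I2] /=.
  split=> //; first by split=> //; lia.
  by rewrite x2 addn1; split=> //=; rewrite ?PeanoNat.Nat.eqb_refl // yx.
- move=> s' [xi yK Ii]; split=> //=; first by rewrite xi yK ltnn.
  exact: IN.
Qed.

(** Frame and cost are factored out of the invariant, which must therefore ignore the clock. Each
    iteration pays [c] for the body and [8] for the test and the increment; [6] pays for the
    initialization and the last test. *)
Lemma wp_forF x y p s (Q : hst -> Prop) K c X Y (I : nat -> hst -> Prop) :
  x \in X -> y \notin X -> K < lim w -> hr s y = K ->
  (forall i k s', I i s' -> I i (tick k s')) ->
  I 0 (upr s x 0) ->
  (forall i s', i < K -> frame X Y s s' -> hr s' x = i -> I i s' ->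
    wp p s' (fun s2 =>
      [/\ frame X Y s s2, hr s2 x = i, hk s2 <= hk s' + c & I i.+1 (upr s2 x i.+1)])) ->
  (forall s', frame X Y s s' -> hr s' x = K -> hk s' <= hk s + 6 + K * (c + 8) ->
     I K s' -> Q s') ->
  wp (PFor x y p) s Q.
Proof.
move=> xX yX Kl sy It I0 IS IN.
have yx : Nat.eqb y x = false.
  by case: PeanoNat.Nat.eqb_spec => // e; rewrite e xX in yX.
apply: (@wp_for x y p s Q K (fun i s' =>
  [/\ frame X Y s s', hk s' <= hk s + 2 + i * (c + 8) & I i s'])) => //.
- split; [|by rewrite /=; lia|exact/It].
  by apply/frame_tick/frame_upr.
- move=> i s' iK xi yK [F T Ii].
  have := IS i (tick 4 s') iK F xi (It _ _ _ Ii).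
  apply: wp_mono => // s2 [F2 x2 T2 I2]; split=> //; first by rewrite (frR F2).
  split; [by apply/frame_tick/frame_upr| |exact/It].
  by move: T T2 => /=; lia.
- move=> s' xi yK [F T Ii]; apply: IN => //=; [lia|exact: It].
Qed.

End Rules.

Lemma ltn_flat n m x y : x < n -> y < m -> x * m + y < n * m.
Proof. by move=> xn ym; apply: (@leq_trans (x.+1 * m)); [rewrite mulSn addnC ltn_add2r | rewrite leq_mul2r xn orbT]. Qed.

Lemma flat_div m x y : y < m -> (x * m + y) %/ m = x.
Proof. by move=> ym; rewrite divnMDl ?divn_small ?addn0 //; lia. Qed.

Lemma flat_mod m x y : y < m -> (x * m + y) %% m = y.
Proof. by move=> ym; rewrite modnMDl modn_small. Qed.

Lemma flat_inj m x y x' y' : y < m -> y' < m ->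
  (x * m + y == x' * m + y') = (x == x') && (y == y').
Proof.
move=> ym ym'; apply/eqP/andP => [e|[/eqP-> /eqP->]//].
have ex : x = x' by rewrite -(flat_div x ym) e flat_div.
by rewrite ex eqxx; split=> //; rewrite -(flat_mod x ym) e flat_mod.
Qed.

Definition nocall : hst -> (hst -> Prop) -> Prop := fun _ _ => False.
Lemma nocall_mono s (Q Q' : hst -> Prop) :
  (forall s', Q s' -> Q' s') -> nocall s Q -> nocall s Q'.
Proof. by []. Qed.

Definition hst_of (st : state) : hst := Hst (reg st) (Defs.mem st) (coins st) 0.

Lemma nocall_sound w p st (Q : hst -> Prop) : 0 < w -> okp p -> wf w st ->
  wp w nocall p (hst_of st) Q ->
  runs w (cp Skip p) st (fun t st' => exists s', [/\ sim w st' s', Q s' & t <= hk s']).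
Proof.
move=> w0 op W H.
have S : sim w st (hst_of st) by [].
have ok : forall s st (Q0 : hst -> Prop), sim w st s -> nocall s Q0 ->
  exists t st' s', [/\ exec w Skip st t st', sim w st' s', Q0 s' & t + hk s <= hk s'] by [].
have [t [st' [s' [E S' HQ T]]]] := wp_sound w0 ok op S H.
by exists t, st'; split=> //; exists s'; split=> //; move: T; rewrite /= addn0.
Qed.

(** * Matrix multiplication *)

Definition naive_mm : prog :=
  10 ::= A 0 (N 0) ;;
  11 ::= V 10 *! V 10 ;;
  PFor 12 11 (
    13 ::= N 0 ;;
    PFor 14 10 (
      13 ::= V 13 +! A 1 (V 12 /! V 10 *! V 10 +! V 14)
                       *! A 2 (V 14 *! V 10 +! V 12 %! V 10)) ;;
    PSto 0 (V 12) (V 13 %! N 2)).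

Definition dotn (a b : nat -> nat) n q k :=
  \sum_(y < k) a (q %/ n * n + y) * b (y * n + q %% n).

Lemma naive_mm_wp w n s (Q : hst -> Prop) :
  0 < n -> n * n < lim w -> 2 < lim w -> hm s 0 0 = n ->
  (forall q, q < n * n -> hm s 1 q < 2 /\ hm s 2 q < 2) ->
  (forall s', hk s' <= hk s + 100 * (n * n * n) ->
    (forall q, q < n * n -> hm s' 0 q = dotn (hm s 1) (hm s 2) n q n %% 2) -> Q s') ->
  wp w nocall naive_mm s Q.
Proof.
move=> n0 nl l1 s0 bits HQ.
have nl' : n < lim w by nia.
have cm := @nocall_mono; rewrite /naive_mm.
apply: wp_seq; apply: wp_asg => /=; first exact: lim_gt0.
apply: wp_seq; apply: wp_asg => /=; first by sp; rewrite s0.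
apply: (@wp_forF w nocall cm 12 11 _ _ _ (n * n) (30 * n + 30) [:: 12; 13; 14] [:: 0] (fun i s' =>
  forall q, q < i -> hm s' 0 q = dotn (hm s 1) (hm s 2) n q n %% 2)) => //=.
- by rewrite s0.
- move=> i s1 iK F1 xi I1.
  have M1 := frM F1; have e10 : hr s1 10 = n by rewrite (frR F1) //= s0.
  have e1 : hm s1 1 = hm s 1 by rewrite M1.
  have e2 : hm s1 2 = hm s 2 by rewrite M1.
  apply: wp_seq; apply: wp_asg => /=; first exact: lim_gt0.
  apply: wp_seq.
  apply: (@wp_forF w nocall cm 14 10 _ _ _ n 20 [:: 13; 14] [::] (fun k s' =>
    hr s' 13 = dotn (hm s 1) (hm s 2) n i k)) => //=.
  + by rewrite /dotn big_ord0.
  + move=> k s2 kn F2 xk I2.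
    have f10 : hr s2 10 = n by rewrite (frR F2).
    have f12 : hr s2 12 = i by rewrite (frR F2).
    have g1 : hm s2 1 = hm s 1 by rewrite (frM F2).
    have g2 : hm s2 2 = hm s 2 by rewrite (frM F2).
    have i1 : i %/ n < n by rewrite ltn_divLR.
    have i2 : i %% n < n by rewrite ltn_mod.
    have L1 := ltn_flat i1 kn; have L2 := ltn_flat kn i2.
    have [B1 _] := bits _ L1; have [_ B2] := bits _ L2.
    (* The inner product is reduced modulo 2 only after the inner loop, so the unreduced sum must be
       shown to fit in a word. *)
    have D : dotn (hm s 1) (hm s 2) n i k <= k.
      rewrite /dotn -[leqRHS](card_ord k) -sum1_card; apply: leq_sum => y _.
      have yn : y < n by apply: ltn_trans kn.
      have [C1 _] := bits _ (ltn_flat i1 yn); have [_ C2] := bits _ (ltn_flat yn i2).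
      by rewrite -[1]muln1 leq_mul.
    have ab : hm s 1 (i %/ n * n + k) * hm s 2 (k * n + i %% n) <= 1.
      by rewrite -[1]muln1 leq_mul.
    apply: wp_asg => /=; last split=> /=.
    * by sp; rewrite /= ?xk ?f10 ?f12 ?g1 ?g2 ?I2; alia.
    * by fr.
    * by [].
    * by lia.
    * by rewrite xk f10 f12 g1 g2 I2 /dotn big_ord_recr.
  + move=> s2 F2 xk T2 I2; apply: wp_sto => /=; [by sp|by sp|split=> /=].
    * by fr.
    * by rewrite (frR F2).
    * by move: T2 => /=; lia.
    * move=> q; rewrite ltnS leq_eqVlt (frR F2) //= xi I2.
      case: eqP => [->//|_] /= qi.
      by rewrite (frM F2) //= I1.
- move=> s1 F1 x1 T1 I1; apply: HQ => //.
  by move: T1 => /=; nia.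
Qed.

Lemma nth_allpairs_flat (S T U : Type) (f : S -> T -> U) (s : seq S) (t : seq T)
    x0 a0 b0 x y :
  x < size s -> y < size t ->
  nth x0 [seq f a b | a <- s, b <- t] (x * size t + y) = f (nth a0 s x) (nth b0 t y).
Proof.
elim: s x => [//|a s IH] [|x] /= xs yt; rewrite nth_cat size_map.
  by rewrite add0n yt (nth_map b0).
rewrite mulSn -addnA ltnNge leq_addr /= addKn; exact: IH.
Qed.

Lemma size_mx_seq n (M : 'M['F_2]_n) : size (mx_seq M) = n * n.
Proof. by rewrite size_allpairs size_enum_ord. Qed.

Lemma nth_mx_seq n (M : 'M['F_2]_n) (x y : 'I_n) :
  nth 0 (mx_seq M) (x * n + y) = M x y.
Proof.
have := @nth_allpairs_flat _ _ _ (fun i j => M i j : nat) (enum 'I_n) (enum 'I_n) 0 x x x y.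
by rewrite size_enum_ord !nth_ord_enum; apply.
Qed.

Lemma F2val (k : nat) : ((k%:R)%R : 'F_2) = k %% 2 :> nat.
Proof. exact: (@val_Fp_nat 2). Qed.

Lemma F2lt (a : 'F_2) : a < 2. Proof. by case: a. Qed.

Lemma F2K (a : 'F_2) : ((a : nat)%:R)%R = a.
Proof. by apply: val_inj; rewrite /= F2val modn_small // F2lt. Qed.

Lemma bitK (k : nat) : k < 2 -> ((k%:R)%R : 'F_2) = k :> nat.
Proof. by move=> k2; rewrite F2val modn_small. Qed.

Lemma F2mod (k : nat) : ((k %% 2)%:R = k%:R :> 'F_2)%R.
Proof. by apply: val_inj; rewrite /= !F2val modn_mod. Qed.

Lemma mx_seq_lt n (M : 'M['F_2]_n) q : nth 0 (mx_seq M) q < 2.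
Proof.
case: (ltnP q (size (mx_seq M))) => [|h]; last by rewrite nth_default.
move/(mem_nth 0)/allpairsP => [[i j] [_ _ ->]]; exact: F2lt.
Qed.

Lemma mx_seqP n (M : 'M['F_2]_n) (g : nat -> nat) :
  (forall x y : 'I_n, g (x * n + y) = M x y) -> mkseq g (n * n) = mx_seq M.
Proof.
move=> H; apply: (@eq_from_nth _ 0); rewrite size_mkseq ?size_mx_seq // => q qn.
rewrite nth_mkseq //; have n0 : 0 < n by case: n qn {M H}.
have h1 : q %/ n < n by rewrite ltn_divLR.
have h2 : q %% n < n by rewrite ltn_mod.
by rewrite (divn_eq q n) (H (Ordinal h1) (Ordinal h2)) -nth_mx_seq.
Qed.

Lemma lg_lim n : n < 2 ^ lg n.
Proof. exact: trunc_log_ltn. Qed.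

(** This makes the set of exponents nonempty, as reasoning about its infimum requires, and it is the
    fallback when [tau] exceeds 3. *)
Lemma mm_naive (R : realType) : mm_in_time (3 : R).
Proof.
exists (cp Skip naive_mm), 100 => n w MA MB st n0 Kw [L1 L2 L3 L4].
have w0 : 0 < w by move: Kw; rewrite /lg; lia.
have r1 := L3 1 isT; have r2 := L3 2 isT; rewrite /= size_mx_seq in r1 r2.
have W : wf w (set_coins st [::]) by [].
have m1 q : q < n * n -> Defs.mem st 1 q = nth 0 (mx_seq MA) q.
  by move=> h; rewrite L4 //= size_mx_seq.
have m2 q : q < n * n -> Defs.mem st 2 q = nth 0 (mx_seq MB) q.
  by move=> h; rewrite L4 //= size_mx_seq.
have H : wp w nocall naive_mm (hst_of (set_coins st [::])) (fun s' =>
   hk s' <= 100 * (n * n * n) /\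
   forall q, q < n * n -> hm s' 0 q = dotn (Defs.mem st 1) (Defs.mem st 2) n q n %% 2).
  apply: (@naive_mm_wp _ n) => //.
  - by rewrite -r1; apply: L1.
  - have h : 2 <= w by move: Kw; rewrite /lg; lia.
    by apply: (@leq_trans (2 ^ 2)) => //; rewrite leq_exp2l.
  - by rewrite /= L4.
  - by move=> q h /=; rewrite m1 // m2 // !mx_seq_lt.
have [t [st' [E [s' [S [T HM] tk]]]]] := nocall_sound w0 (isT : okp naive_mm) W H.
exists t, st'; split=> //; split.
  have -> : (powR n%:R 3 = (n * n * n)%N%:R :> R)%R.
    by rewrite !natrM powR_mulrn // exprS expr2 mulrA.
  by rewrite -natrM ler_nat; lia.
apply: mx_seqP => x y.
have [_ _ M _] := S; rewrite M HM ?ltn_flat // /dotn flat_div // flat_mod // mxE.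
rewrite -F2val natr_sum; congr (nat_of_ord _); apply: eq_bigr => k _.
rewrite natrM m1 ?ltn_flat // m2 ?ltn_flat //.
by rewrite !nth_mx_seq !F2K.
Qed.

(** * Lower bound for the exponent of matrix multiplication *)

Lemma exec_writes w p st t st' a m : exec w p st t st' ->
  count (fun i => Defs.mem st a i != Defs.mem st' a i) (iota 0 m) <= t.
Proof.
elim=> {p st t st'} /=; try by move=> *; rewrite (eq_count (a2 := pred0)) ?count_pred0 // => i /=; rewrite eqxx.
- move=> b y z st; apply: (@leq_trans (count (pred1 (reg st y)) (iota 0 m))).
    apply: sub_count => i /=; case: (i =P reg st y) => [//|_].
    by rewrite andbF eqxx.
  by rewrite count_uniq_mem ?iota_uniq // leq_b1.
- move=> p q st t1 st1 t2 st2 _ H1 _ H2; apply: leq_trans (leq_add H1 H2).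
  rewrite -count_predUI; apply: leq_trans (leq_addr _ _); apply: sub_count => i /=.
  by case: (Defs.mem st a i =P Defs.mem st1 a i) => //= ->.
- by move=> *; apply: leqW.
- by move=> *; apply: leqW.
- move=> x p st t1 st1 t2 st2 _ _ H1 _ H2; apply: leqW; apply: leq_trans (leq_add H1 H2).
  rewrite -count_predUI; apply: leq_trans (leq_addr _ _); apply: sub_count => i /=.
  by case: (Defs.mem st a i =P Defs.mem st1 a i) => //= ->.
Qed.

Lemma mm_mono (R : realType) (a b : R) : (a <= b)%R -> mm_in_time a -> mm_in_time b.
Proof.
move=> ab [P [K H]]; exists P, K => n w MA MB st n0 Kw L.
have [t [st' [E [T HM]]]] := H n w MA MB st n0 Kw L.
exists t, st'; split=> //; split=> //; apply: (le_trans T).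
by apply: ler_wpM2l => //; apply: ler_powR => //; rewrite ler1n.
Qed.

(** Zero matrices are multiplied in a memory whose output array contains ones. The product is zero,
    so all output cells except cell 0, which holds the input [N], must change, and a step changes at
    most one cell. *)
Lemma mm_lower_time (R : realType) (a : R) K P :
  (forall (N w : nat) (A B : 'M['F_2]_N) (st : state),
    0 < N -> K * lg N <= w ->
    loaded w [:: [:: N]; mx_seq A; mx_seq B] st ->
    runs w P (set_coins st [::]) (fun t st' =>
      (t%:R <= K%:R * powR N%:R a :> R)%R /\
      read_array st' 0 (N * N) = mx_seq (A *m B)%R)) ->
  forall N, 0 < N -> ((N * N)%:R <= K%:R * powR N%:R a + 1 :> R)%R.
Proof.
move=> H N N0; pose w := K * lg N + 2 * lg N.
pose st := State (fun x => if x == 0 then 1 else if x <= 2 then N * N else 0)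
  (fun a i => if a == 0 then if i == 0 then N else 1 else 0) [::].
have Nl : N * N < 2 ^ w.
  rewrite /w mulSn mul1n addnA -addnA !expnD.
  apply: leq_trans (leq_pmull _ _); last by rewrite expn_gt0.
  by apply: ltn_mul; apply: lg_lim.
have N1 : N < 2 ^ w by nia.
have L : loaded w [:: [:: N]; mx_seq (0 : 'M['F_2]_N)%R; mx_seq (0 : 'M['F_2]_N)%R] st.
  have nz q : nth 0 (mx_seq (0 : 'M['F_2]_N)%R) q = 0.
    case: (ltnP q (size (mx_seq (0 : 'M['F_2]_N)%R))) => [|h]; last by rewrite nth_default.
    by move/(mem_nth 0)/allpairsP => [[i j] [_ _ ->]]; rewrite mxE.
  split.
  - by move=> x /=; case: eqP => _; [lia|case: ifP => _; lia].
  - by move=> b i /=; do 2?[case: eqP => _]; lia.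
  - by case=> [|[|[|//]]] _ //=; rewrite size_mx_seq.
  - by case=> [|[|[|b]]] //= [|i] //= _; rewrite ?nz ?nth_nil.
have [t [st' [E [T HM]]]] := H N w _ _ st N0 (leq_addr _ _) L.
have := exec_writes 0 (N * N) E => /= C.
have : (N * N).-1 <= t.
  apply: leq_trans C.
  case e : (N * N) => [//|k] /=.
  rewrite -[k in k <= _](size_iota 1) -(count_predT (iota 1 k)).
  apply: leq_trans (leq_addl _ _); rewrite leq_eqVlt; apply/orP; left; apply/eqP.
  apply: eq_in_count => i; rewrite mem_iota => /andP[i1 ik] /=.
  have := congr1 (fun s => nth 0 s i) HM; rewrite /read_array nth_mkseq; last by rewrite e; lia.
  move=> ->; rewrite mulmx0.
  have nz q : nth 0 (mx_seq (0 : 'M['F_2]_N)%R) q = 0.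
    case: (ltnP q (size (mx_seq (0 : 'M['F_2]_N)%R))) => [|h]; last by rewrite nth_default.
    by move/(mem_nth 0)/allpairsP => [[i' j] [_ _ ->]]; rewrite mxE.
  by rewrite nz; case: i i1 ik.
move=> h; apply: (@le_trans _ _ (t%:R + 1)%R); last by rewrite lerD2r.
by rewrite natr1 ler_nat; lia.
Qed.

(** The mere size of the output rules out smaller exponents. This bounds the infimum [omega] from
    below by 2, so that any [tau] above it exceeds 2. *)
Lemma mm_ge2 (R : realType) (a : R) : mm_in_time a -> (2 <= a)%R.
Proof.
case=> P [K H]; have B := mm_lower_time H.
rewrite leNgt; apply/negP => a2.
(* A nonnegative exponent ensures [n ^ a' >= 1], which absorbs the additive 1 of the lower bound. *)
pose a' : R := Num.max a 0%R.
have a'2 : (a' < 2)%R by rewrite /a' gt_max a2; lra.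
pose d : R := (2 - a')%R; have d0 : (0 < d)%R by rewrite /d; lra.
(* [x] solves [x ^ d = K + 2], so any integer above it contradicts the lower bound. *)
pose x : R := powR (K%:R + 2) (d^-1).
pose n := (Num.truncn x).+1.
have xn : (x < n%:R)%R by apply: truncnS_gt.
have x0 : (0 <= x)%R by apply: powR_ge0.
have n1 : (1 <= n%:R :> R)%R by rewrite ler1n.
have n0 : (n%:R != 0 :> R)%R by rewrite pnatr_eq0.
have K0 : (0 <= K%:R :> R)%R by [].
have K2 : (0 <= K%:R + 2 :> R)%R by rewrite addr_ge0.
have nd : (K%:R + 2 <= powR n%:R d)%R.
  have -> : (K%:R + 2 = powR x d)%R.
    by rewrite /x -powRrM mulVf ?gt_eqF // powRr1.
  by apply: ge0_ler_powR; rewrite ?nnegrE //; apply: ltW.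
have na1 : (1 <= powR n%:R a')%R.
  have : (powR n%:R 0 <= powR n%:R a')%R.
    by apply: ler_powR => //; rewrite /a' le_max lexx orbT.
  by rewrite powRr0.
have na : (powR n%:R a <= powR n%:R a')%R.
  by apply: ler_powR => //; rewrite /a' le_max lexx.
have e2 : ((n * n)%N%:R = powR n%:R d * powR n%:R a' :> R)%R.
  rewrite -powRD; last by rewrite n0 implybT.
  by rewrite /d subrK powR_mulrn // natrM expr2.
have := B n isT; rewrite e2 => h.
have h2 : (K%:R * powR n%:R a <= K%:R * powR n%:R a')%R by apply: ler_wpM2l.
have h3 : ((K%:R + 2) * powR n%:R a' <= powR n%:R d * powR n%:R a')%R.
  by apply: ler_wpM2r => //; apply: powR_ge0.
by rewrite mulrDl in h3; lra.
Qed.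

(** Strictly above [omega] some admissible exponent lies below [tau], and admissibility is monotone.
    Strictness of [2 < t] makes the sum over block sizes geometric; [t <= 3] will give the bound
    with [f ^ 2]. *)
Lemma mm_good_exponent (R : realType) (tau : R) :
  (omega R < tau)%R \/ [/\ tau = omega R, mm_in_time tau & (2 < tau)%R] ->
  exists t : R, [/\ (2 < t)%R, (t <= 3)%R, (t <= tau)%R & mm_in_time t].
Proof.
move=> h; have [t2 Ht] : (2 < tau)%R /\ mm_in_time tau.
  case: h => [h|[_ H1 H2]//].
  have S0 : ([set t : R | mm_in_time t] !=set0)%classic by exists 3%R; apply: mm_naive.
  have [t /= Ht tt] := inf_lt S0 h.
  split; last exact: mm_mono (ltW tt) Ht.
  by apply: le_lt_trans h; apply: lb_le_inf => // u /= /mm_ge2.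
have [t3|t3] := lerP tau 3%R; first by exists tau.
by exists 3%R; split; [lra|lra|lra|exact: mm_naive].
Qed.

(** * Calling the multiplication program as a black box *)

Definition mmcs (w K0 : nat) (tm : nat -> nat) (s : hst) (Q : hst -> Prop) : Prop :=
  exists n, [/\ 0 < n, K0 * lg n <= w, hr s 59 = n, n * n < lim w &
    [/\ hc s = [::], hm s 20 0 = n,
        forall q, q < n * n -> hm s 21 q < 2 /\ hm s 22 q < 2 &
        forall s', hr s' = hr s -> (forall a, a < 20 -> hm s' a = hm s a) ->
          hc s' = hc s -> hk s' = hk s + (tm n + 3) ->
          (forall x z, x < n -> z < n -> hm s' 20 (x * n + z) < 2 /\
            ((hm s' 20 (x * n + z))%:R =
             \sum_(y < n) (hm s 21 (x * n + y))%:R * (hm s 22 (y * n + z))%:R :> 'F_2)%R) ->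
          Q s']].

Lemma mmcs_mono w K0 tm s (Q Q' : hst -> Prop) :
  (forall s', Q s' -> Q' s') -> mmcs w K0 tm s Q -> mmcs w K0 tm s Q'.
Proof.
move=> QQ [n [n0 Kn s59 nl [C M0 bits H]]]; exists n; split=> //; split=> //.
by move=> s' *; apply: QQ; apply: H.
Qed.

(** Registers 100 to 102 are registers 0 to 2 of the relocated program, which expects the lengths of
    its three inputs there. These three instructions explain the [+ 3] in [mmcs]. *)
Definition mm_call (P : cmd) : cmd :=
  Seq (Const 100 1) (Seq (Op Mul 101 59 59) (Seq (Op Mul 102 59 59) (shift P))).

Definition mm_spec w K0 (tm : nat -> nat) P :=
  forall (n : nat) (MA MB : 'M['F_2]_n) (st : state),
    0 < n -> K0 * lg n <= w -> loaded w [:: [:: n]; mx_seq MA; mx_seq MB] st ->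
    runs w P (set_coins st [::]) (fun t st' =>
      t <= tm n /\ read_array st' 0 (n * n) = mx_seq (MA *m MB)%R).

Lemma mm_call_ok w K0 tm P : 0 < w -> mm_spec w K0 tm P ->
  forall s st Q, sim w st s -> mmcs w K0 tm s Q ->
  exists t st' s', [/\ exec w (mm_call P) st t st', sim w st' s', Q s' & t + hk s <= hk s'].
Proof.
move=> w0 HP s st Q [W R M C] [n [n0 Kn s59 nl [Cs M0 bits H]]].
pose mA := (\matrix_(i < n, j < n) ((hm s 21 (i * n + j))%:R : 'F_2))%R.
pose mB := (\matrix_(i < n, j < n) ((hm s 22 (i * n + j))%:R : 'F_2))%R.
have r59 : reg st 59 = n by rewrite R.
have nn : binop_sem w Mul n n = n * n by rewrite /binop_sem modn_small.
pose st1 := set_reg (set_reg (set_reg st 100 (1 %% 2 ^ w)) 101 (n * n)) 102 (n * n).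
have l1 := lim2 w0.
have E1 : exec w (Const 100 1) st 1 (set_reg st 100 (1 %% 2 ^ w)) by apply: exec_const.
have E2 : exec w (Op Mul 101 59 59) (set_reg st 100 (1 %% 2 ^ w)) 1
    (set_reg (set_reg st 100 (1 %% 2 ^ w)) 101 (n * n)).
  have := exec_op w Mul 101 59 59 (set_reg st 100 (1 %% 2 ^ w)).
  by rewrite /= r59 nn.
have E3 : exec w (Op Mul 102 59 59) (set_reg (set_reg st 100 (1 %% 2 ^ w)) 101 (n * n)) 1 st1.
  have := exec_op w Mul 102 59 59 (set_reg (set_reg st 100 (1 %% 2 ^ w)) 101 (n * n)).
  by rewrite /= r59 nn.
have W1 : wf w st1.
  apply: exec_wf E3 _; apply: exec_wf E2 _; exact: exec_wf E1 _.
(* The part of the memory that the relocated program can see, read as a state of its own. *)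
pose st0 := State (fun x => reg st1 (x + 100)) (fun a => Defs.mem st1 (a + 20)) [::].
have L : loaded w [:: [:: n]; mx_seq mA; mx_seq mB] st0.
  have mseq (a : nat) (G : nat -> nat) (X : 'M['F_2]_n) : (forall q, q < n * n -> G q < 2) ->
     (forall i j : 'I_n, X i j = ((G (i * n + j)%N)%:R)%R) ->
     forall i, i < size (mx_seq X) -> G i = nth 0 (mx_seq X) i.
    move=> Gb XE i; rewrite size_mx_seq => ni.
    rewrite -(@mx_seqP _ X G) ?nth_mkseq // => x y.
    by rewrite XE bitK // Gb // ltn_flat.
  split.
  - by move=> x; apply: (proj1 W1).
  - by move=> a i; apply: (proj2 W1).
  - case=> [|[|[|//]]] _ /=; rewrite ?size_mx_seq //.
    by rewrite modn_small.
  - case=> [|[|[|b]]] //=; last by move=> i; rewrite nth_nil.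
    + by case=> // _; rewrite M.
    + apply: (mseq 0 (fun q => Defs.mem st 21 q)).
        by move=> q qn; rewrite M; case: (bits q qn).
      by move=> i j; rewrite mxE M.
    + apply: (mseq 0 (fun q => Defs.mem st 22 q)).
        by move=> q qn; rewrite M; case: (bits q qn).
      by move=> i j; rewrite mxE M.
have [t [st2 [E [T RA]]]] := HP n mA mB st0 n0 Kn L.
have S0 : shifted (set_coins st0 [::]) st1 by split=> //; rewrite /= C Cs.
have [st3 [E4 [R4 M4 C4] [LR LM]]] := exec_shift E S0.
pose s' := Hst (hr s) (fun a => if a < 20 then hm s a else Defs.mem st3 a) (hc s)
   (hk s + (tm n + 3)).
exists (1 + (1 + (1 + t))), st3, s'; split.
- by apply: exec_seq E1 _; apply: exec_seq E2 _; apply: exec_seq E3 E4.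
- split.
  + exact: exec_wf E4 W1.
  + move=> x x60; rewrite LR; last by lia.
    by rewrite -R //=; do 3!(case: eqP => [?|_]; first by lia).
  + by move=> a i /=; case: ifP => // a20; rewrite LM //= M.
  + rewrite C4 /= Cs.
    (* Started without coins, an execution can never pass a [Flip], so the list stays empty. *)
    suff: coins st2 = [::] by [].
    have: coins (set_coins st0 [::]) = [::] by [].
    elim: E => //= {HP} *; try by auto.
    by match goal with H : coins _ = _ :: _, H' : coins _ = [::] |- _ => rewrite H' in H end.
- apply: H => //.
  + by move=> a a20; rewrite /= a20.
  + move=> x z xn zn; rewrite /=.
    have eM : Defs.mem st3 20 (x * n + z) = (mA *m mB)%R (Ordinal xn) (Ordinal zn).
      rewrite -nth_mx_seq -RA nth_mkseq ?ltn_flat //=.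
      by rewrite -(M4 0).
    rewrite eM F2lt F2K; split=> //; rewrite mxE; apply: eq_bigr => y _.
    by rewrite !mxE.
- by rewrite /=; lia.
Qed.

(** * Block elimination *)

(** Registers 15, 21, 22, 23 hold the width, the block size, and the first rows of target and
    source. The multipliers are saved in array 4 beforehand because the pivot columns of the target
    are themselves overwritten. *)
Definition elim_prog : prog :=
  26 ::= V 21 *! V 21 ;;
  27 ::= V 15 /! V 21 ;;
  59 ::= V 21 ;;
  PFor 25 26
    (PSto 4 (V 25) (A 2 ((V 22 +! V 25 /! V 21) *! V 15 +! A 3 (V 23 +! V 25 %! V 21)))) ;;
  PFor 24 27 (
    PSto 20 (N 0) (V 21) ;;
    PFor 25 26 (
      PSto 21 (V 25) (A 4 (V 25)) ;;
      PSto 22 (V 25)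
        (A 2 ((V 23 +! V 25 /! V 21) *! V 15 +! (V 24 *! V 21 +! V 25 %! V 21)))) ;;
    PCall ;;
    PFor 25 26
      (PSto 2 ((V 22 +! V 25 /! V 21) *! V 15 +! (V 24 *! V 21 +! V 25 %! V 21))
        ((A 2 ((V 22 +! V 25 /! V 21) *! V 15 +! (V 24 *! V 21 +! V 25 %! V 21))
          +! A 20 (V 25)) %! N 2))).

Definition F2m (W : nat) (g : nat -> nat) (r c : nat) : 'F_2 := ((g (r * W + c))%:R)%R.

Definition elimv (M : nat -> nat -> 'F_2) (piv : nat -> nat) (u v s r c : nat) : 'F_2 :=
  (M r c + (if (u <= r < u + s)%N then \sum_(y < s) M r (piv (v + y)) * M (v + y)%N c else 0))%R.

Definition bitmx (R W : nat) (g : nat -> nat) : Prop :=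
  forall r c, r < R -> c < W -> g (r * W + c) < 2.

Definition ecost (tm : nat -> nat) (W s : nat) : nat :=
  30 * (s * s) + 30 + W %/ s * (90 * (s * s) + tm s + 60).

(** Target and source rows are disjoint, so the source stays intact while strips of [s] columns of
    the target are updated in place. *)
Lemma elim_wp w K0 tm R W s u v st (Q : hst -> Prop) :
  hr st 15 = W -> hr st 21 = s -> hr st 22 = u -> hr st 23 = v ->
  0 < s -> s %| W -> 0 < W -> s <= R -> K0 * lg s <= w -> 2 < lim w -> R * W < lim w ->
  u + s <= R -> v + s <= R -> (u + s <= v) || (v + s <= u) ->
  (forall r, r < R -> hm st 3 r < W) -> bitmx R W (hm st 2) -> hc st = [::] ->
  (forall st', frame [:: 24; 25; 26; 27; 59] [:: 2; 4; 20; 21; 22] st st' ->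
     hk st' <= hk st + ecost tm W s -> bitmx R W (hm st' 2) ->
     (forall r c, r < R -> c < W ->
       F2m W (hm st' 2) r c = elimv (F2m W (hm st 2)) (hm st 3) u v s r c) -> Q st') ->
  wp w (mmcs w K0 tm) elim_prog st Q.
Proof.
move=> e15 e21 e22 e23 s0 sW W0 sR Ks l2 RWl uR vR dis pivb Mb Cs HQ.
have cm := @mmcs_mono w K0 tm.
have sleW : s <= W by apply: dvdn_leq.
have ssl : s * s < lim w by apply: leq_ltn_trans RWl; apply: leq_mul.
have cW x : x < W -> x < lim w.
  by move=> xW; apply: leq_ltn_trans RWl; apply: leq_trans (ltnW xW) _; apply: leq_pmull; lia.
have cR x : x <= R -> x < lim w.
  by move=> xW; apply: leq_ltn_trans RWl; apply: leq_trans xW _; apply: leq_pmulr.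
have sl : s < lim w by apply: cR.
have cell r c : r < R -> c < W -> r * W + c < lim w.
  by move=> rR cW'; apply: ltn_trans RWl; apply: ltn_flat.
have cellm r : r <= R -> r * W < lim w.
  by move=> rR; apply: leq_ltn_trans RWl; rewrite leq_mul2r rR orbT.
rewrite /elim_prog.
apply: wp_seq; apply: wp_asg => /=; first by sp; rewrite e21.
apply: wp_seq; apply: wp_asg => /=; first by sp.
apply: wp_seq; apply: wp_asg => /=; first by sp.
set st1 := tick _ (upr _ 59 _).
have F01 : frame [:: 26; 27; 59] [::] st st1 by rewrite /st1; fr.
have T1 : hk st1 = hk st + 10 by rewrite /st1 /=; lia.
have [f26 f27 f59] : [/\ hr st1 26 = s * s, hr st1 27 = W %/ s & hr st1 59 = s].
  by rewrite /st1 /= e21 e15.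
clearbody st1.
have qd q : q < s * s -> q %/ s < s by rewrite ltn_divLR.
have qm q : q %% s < s by rewrite ltn_mod.
have jW j : j < W %/ s -> j * s + s <= W.
  by move=> js; rewrite -mulSnr -(divnK sW) leq_mul2r js orbT.
apply: wp_seq.
apply: (@wp_forF w _ cm 25 26 _ st1 _ (s * s) 20 [:: 25] [:: 4] (fun i s' =>
  forall q, q < i -> hm s' 4 q = hm st 2 ((u + q %/ s) * W + hm st 3 (v + q %% s)))) => //=.
  move=> i s1 iK F1 xi I1.
  have F : frame [:: 25; 26; 27; 59] [:: 4] st s1 by fr.
  have [g15 g21 g22 g23] : [/\ hr s1 15 = W, hr s1 21 = s, hr s1 22 = u & hr s1 23 = v].
    by rewrite !(frR F).
  have g2 : hm s1 2 = hm st 2 by rewrite (frM F).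
  have g3 : hm s1 3 = hm st 3 by rewrite (frM F).
  have i1 := qd _ iK; have i2 := qm i.
  have p1 : hm st 3 (v + i %% s) < W by apply: pivb; lia.
  have c1 := @cell (u + i %/ s) _ (ltac:(lia)) p1.
  have c2 : (u + i %/ s) * W < lim w by apply: cellm; lia.
  have c3 : u + i %/ s < lim w by apply: cR; lia.
  have c4 : v + i %% s < lim w by apply: cR; lia.
  apply: wp_sto => /=; [by sp|by sp; rewrite ?xi ?g15 ?g21 ?g22 ?g23 ?g3|split=> /=].
  - by fr.
  - by [].
  - by lia.
  - move=> q; rewrite ltnS leq_eqVlt xi g15 g21 g22 g23 g2 g3.
    by case: eqP => [->//|_] /= /I1.
move=> s2 F2 x2 T2 I2.
have F02 : frame [:: 25; 26; 27; 59] [:: 4] st s2 by fr.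
set M := F2m W (hm st 2).
(* The entries already updated after [j] full strips and [q] cells of the next one. *)
pose cond j q r c := (u <= r < u + s) && ((c %/ s < j) || ((c %/ s == j) && ((r - u) * s + c %% s < q))).
pose Inv j q (s' : hst) := forall r c, r < R -> c < W -> hm s' 2 (r * W + c) < 2 /\
  F2m W (hm s' 2) r c = if cond j q r c then elimv M (hm st 3) u v s r c else M r c.
have condS j r c : cond j (s * s) r c = cond j.+1 0 r c.
  rewrite /cond; case: (boolP (u <= r < u + s)) => //= /andP[r1 r2].
  have -> : (r - u) * s + c %% s < s * s by apply: ltn_flat; rewrite // ltn_psubLR //; lia.
  by rewrite ltn0 andbF orbF andbT ltnS [RHS]leq_eqVlt orbC.
apply: (@wp_forF w _ cm 24 27 _ s2 _ (W %/ s) (90 * (s * s) + tm s + 50)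
  [:: 24; 25] [:: 2; 20; 21; 22] (fun j s' => Inv j 0 s')) => //=.
- by apply: leq_ltn_trans (leq_div _ _) _; apply: leq_ltn_trans RWl; apply: leq_pmull; lia.
- by rewrite (frR F2).
- move=> r c rR cW'; rewrite (frM F02) //; split; first exact: Mb.
  by rewrite /cond !ltn0 andbF /= andbF.
- move=> j s3 jK F3 xj I3.
  have F03 : frame [:: 24; 25; 26; 27; 59] [:: 2; 4; 20; 21; 22] st s3 by fr.
  have [g15 g21 g22 g23] : [/\ hr s3 15 = W, hr s3 21 = s, hr s3 22 = u & hr s3 23 = v].
    by rewrite !(frR F03).
  have [g26 g59] : hr s3 26 = s * s /\ hr s3 59 = s.
    by rewrite !(frR F3) // !(frR F2).
  have g4 q : q < s * s -> hm s3 4 q = hm st 2 ((u + q %/ s) * W + hm st 3 (v + q %% s)).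
    by move=> qs; rewrite (frM F3) // I2.
  have jsW := jW _ jK.
  have colW q : j * s + q %% s < W by apply: leq_trans jsW; rewrite ltn_add2l.
  have js1 : j * s < lim w by apply: cW; lia.
  have vrow y c : y < s -> c < W -> hm s3 2 ((v + y) * W + c) < 2 /\
      F2m W (hm s3 2) (v + y) c = M (v + y) c.
    move=> ys cW'; have [h1 h2] := I3 (v + y) c (ltac:(lia)) cW'; split=> //.
    rewrite h2 /cond; have -> : (u <= v + y < u + s) = false by apply/negP; case/orP: dis; lia.
    by [].
  have idx q r0 : q < s * s -> r0 + s <= R -> [/\ r0 + q %/ s < lim w,
      (r0 + q %/ s) * W < lim w, j * s + q %% s < lim w
    & (r0 + q %/ s) * W + (j * s + q %% s) < lim w].
    move=> qs rR; have q1 := qd _ qs; have q2 := qm q; have q3 := colW q.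
    split; [by apply: cR; lia|by apply: cellm; lia|exact: cW|by apply: cell => //; lia].
  apply: wp_seq; apply: wp_sto => /=; [exact: lim_gt0|by []|].
  apply: wp_seq.
  apply: (@wp_forF w _ cm 25 26 _ _ _ (s * s) 30 [:: 25] [:: 21; 22] (fun i s' =>
    forall q, q < i -> hm s' 21 q = hm s3 4 q /\
      hm s' 22 q = hm s3 2 ((v + q %/ s) * W + (j * s + q %% s)))) => //=.
    move=> q s4 qK F4 xq I4.
    have [k15 k21 k23 k24] : [/\ hr s4 15 = W, hr s4 21 = s, hr s4 23 = v & hr s4 24 = j].
      by rewrite !(frR F4).
    have k2 : hm s4 2 = hm s3 2 by rewrite (frM F4).
    have k4 : hm s4 4 = hm s3 4 by rewrite (frM F4).
    have [c1 c2 c3 c4] := idx q v qK vR.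
    apply: wp_seq; apply: wp_sto => /=; [by []|by []|].
    apply: wp_sto => /=; [by []|by sp; rewrite /= ?xq ?k15 ?k21 ?k23 ?k24|split=> /=].
    - by fr.
    - by [].
    - by lia.
    - move=> p; rewrite ltnS leq_eqVlt k4 k2 xq k15 k21 k23 k24.
      by case: eqP => [->//|_] /= /I4.
  move=> s4 F4 x4 T4 I4.
  have b4 q : q < s * s -> hm s4 21 q < 2 /\ hm s4 22 q < 2.
    move=> qs; have [-> ->] := I4 _ qs; have q1 := qd _ qs; have q2 := qm q.
    rewrite g4 //; split; first by apply: Mb; [lia|apply: pivb; lia].
    by have [] := vrow (q %/ s) (j * s + q %% s) q1 (colW q).
  apply: wp_seq; exists s; split=> //; first by rewrite (frR F4).
  have [k24 k26] : hr s4 24 = j /\ hr s4 26 = s * s by rewrite !(frR F4) //= g26.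
  split.
  - by rewrite (frC F4) /= (frC F03).
  - by rewrite (frM F4) //=.
  - by [].
  move=> s5 R5 M5 C5 T5 I5.
  have F34 : frame [:: 24; 25] [:: 2; 20; 21; 22] s3 s4 by fr.
  have F35 : frame [:: 24; 25] [:: 2; 20; 21; 22] s3 s5.
    split=> /=.
    + by move=> y yX; rewrite R5 (frR F34).
    + move=> a aX a20; have {}a20 : a < 20 by case/orP: a20.
      by rewrite M5 // (frM F34) // a20.
    + by rewrite C5 (frC F34).
  have h2 : hm s5 2 = hm s3 2 by rewrite M5 // (frM F4).
  have [h24 h26] : hr s5 24 = j /\ hr s5 26 = s * s by rewrite R5.
  apply: (@wp_forF w _ cm 25 26 _ s5 _ (s * s) 37 [:: 25] [:: 2] (fun q s' => Inv j q s')) => //=.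
  - by move=> r c rR cW'; rewrite /F2m /= h2; apply: I3.
  - move=> q s6 qK F6 xq I6.
    have F36 : frame [:: 24; 25] [:: 2; 20; 21; 22] s3 s6 by fr.
    have [k15 k21 k22] : [/\ hr s6 15 = W, hr s6 21 = s & hr s6 22 = u].
      by rewrite !(frR F36).
    have k24' : hr s6 24 = j by rewrite (frR F6).
    have m20 : hm s6 20 = hm s5 20 by rewrite (frM F6).
    have [c1 c2 c3 c4] := idx q u qK uR.
    have q1 := qd _ qK; have q2 := qm q; have q3 := colW q.
    have [B2 E2] := I6 (u + q %/ s) (j * s + q %% s) (ltac:(lia)) q3.
    have [B5 E5] := I5 (q %/ s) (q %% s) q1 q2; rewrite -divn_eq in B5 E5.
    have cU : u <= u + q %/ s < u + s by rewrite leq_addr ltn_add2l.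
    have ccq : cond j q (u + q %/ s) (j * s + q %% s) = false.
      by rewrite /cond flat_div // flat_mod // addKn -divn_eq !ltnn andbF /= andbF.
    rewrite ccq in E2.
    have cst : (hm s6 2 ((u + q %/ s) * W + (j * s + q %% s)) + hm s6 20 q) < lim w.
      by rewrite m20; lia.
    apply: wp_sto => /=; rewrite ?xq ?k15 ?k21 ?k22 ?k24'; [by sp|by sp|].
    split=> /=.
    + by fr.
    + by [].
    + by lia.
    + move=> r c rR cW'; rewrite /F2m /= flat_inj //.
      case: (boolP ((r == u + q %/ s) && (c == j * s + q %% s))) => [/andP[/eqP-> /eqP->]|ne].
        rewrite ltn_mod; split=> //; rewrite F2mod natrD.
        have -> : cond j q.+1 (u + q %/ s) (j * s + q %% s).
          by rewrite /cond cU flat_div // flat_mod // addKn -divn_eq eqxx ltnS leqnn orbT.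
        rewrite /F2m in E2; rewrite E2 m20 E5 /elimv /M.
        rewrite cU.
        congr (_ + _)%R; apply: eq_bigr => y _; have ys := ltn_ord y.
        have L : q %/ s * s + y < s * s by apply: ltn_flat.
        have L' : y * s + q %% s < s * s by apply: ltn_flat.
        have [e21' _] := I4 _ L; have [_ e22'] := I4 _ L'.
        rewrite e21' e22' g4 // !flat_div // !flat_mod //.
        have [_ v2] := vrow _ _ ys q3; rewrite /F2m in v2.
        by rewrite v2.
      have [h1 h2'] := I6 r c rR cW'; split=> //; move: h2'; rewrite /F2m => ->.
      congr (if _ then _ else _); rewrite /cond.
      case: (boolP (u <= r < u + s)) => //= /andP[r1 r2].
      case: (ltnP (c %/ s) j) => //= cj; case: eqP => //= ej.
      rewrite ltnS [RHS]leq_eqVlt; case: eqP => //= eX.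
      case/negP: ne; rewrite -eX flat_div ?ltn_mod // flat_mod ?ltn_mod // -ej -divn_eq eqxx andbT.
      by apply/eqP; lia.
  - move=> s6 F6 x6 T6 I6; split=> /=.
    + by fr.
    + by rewrite (frR F6).
    + by move: T6 T5 T4 => /=; lia.
    + move=> r c rR cW'; have := I6 r c rR cW'; rewrite /F2m /=.
      by rewrite condS.
move=> s3 F3 x3 T3 I3; apply: HQ.
- by fr.
- rewrite /ecost; move: T3 T2 => /=; rewrite T1.
  move: (W %/ s) (s * s) (tm s) => a b e T3 T2; lia.
- by move=> r c rR cW'; case: (I3 r c rR cW').
- move=> r c rR cW'; case: (I3 r c rR cW') => _ ->.
  rewrite /cond.
  have -> : c %/ s < W %/ s.
    by rewrite ltn_divLR // divnK.
  rewrite andbT /elimv; case: (u <= r < u + s)%N => //=; by rewrite addr0.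
Qed.

(** * Algebra of reduced blocks *)

Section Elimination.
Local Open Scope ring_scope.
Variables (R W : nat).
Implicit Types (M : nat -> nat -> 'F_2) (piv : nat -> nat) (f : nat -> 'F_2).

Lemma F2addrr (x : 'F_2) : x + x = 0.
Proof. by apply: addrr_pchar2; rewrite pchar_Fp. Qed.

(** For a reduced block this is a projection onto its row span: [f] is read at the pivots and the
    rows are combined with these coefficients. *)
Definition pr M piv (v s : nat) f (c : nat) : 'F_2 :=
  \sum_(y < s) f (piv (v + y)%N) * M (v + y)%N c.

Definition red M piv (v s : nat) : Prop :=
  forall x c, (v <= x < v + s)%N -> (c < W)%N -> pr M piv v s (M x) c = M x c.

Definition clean M piv (u t v s : nat) : Prop :=
  forall x c, (u <= x < u + t)%N -> (c < W)%N -> pr M piv v s (M x) c = 0.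

Lemma prD M piv v s f g c :
  pr M piv v s (fun z => f z + g z) c = pr M piv v s f c + pr M piv v s g c.
Proof. by rewrite -big_split; apply: eq_bigr => y _; rewrite mulrDl. Qed.

Lemma pr_ext M M' piv v s f f' c : 
  (forall y, (y < s)%N -> f (piv (v + y)%N) = f' (piv (v + y)%N)) ->
  (forall y, (y < s)%N -> M (v + y)%N c = M' (v + y)%N c) ->
  pr M piv v s f c = pr M' piv v s f' c.
Proof. by move=> H1 H2; apply: eq_bigr => y _; rewrite H1 // H2. Qed.

Lemma pr_pr M piv v s v' s' f c :
  pr M piv v s (pr M piv v' s' f) c =
  \sum_(z < s') f (piv (v' + z)%N) * pr M piv v s (M (v' + z)%N) c.
Proof.
rewrite /pr; under eq_bigr => y _ do rewrite mulr_suml.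
rewrite exchange_big; apply: eq_bigr => z _; rewrite mulr_sumr.
by apply: eq_bigr => y _; rewrite mulrA.
Qed.

Lemma pr_idem M piv v s f c : red M piv v s -> (c < W)%N ->
  pr M piv v s (pr M piv v s f) c = pr M piv v s f c.
Proof.
move=> H cW; rewrite pr_pr; apply: eq_bigr => z _; rewrite H //.
by rewrite leq_addr ltn_add2l ltn_ord.
Qed.

Lemma pr_clean M piv v s v' s' f c : clean M piv v' s' v s -> (c < W)%N ->
  pr M piv v s (pr M piv v' s' f) c = 0.
Proof.
move=> H cW; rewrite pr_pr big1 // => z _; rewrite H ?mulr0 //.
by rewrite leq_addr ltn_add2l ltn_ord.
Qed.

Definition elimd M M' piv u v s : Prop :=
  forall r c, (r < R)%N -> (c < W)%N -> M' r c = elimv M piv u v s r c.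

Lemma elimd_in M M' piv u v s r c : elimd M M' piv u v s -> (r < R)%N -> (c < W)%N ->
  (u <= r < u + s)%N -> M' r c = M r c + pr M piv v s (M r) c.
Proof. by move=> H rR cW ur; rewrite H // /elimv ur. Qed.

Lemma elimd_out M M' piv u v s r c : elimd M M' piv u v s -> (r < R)%N -> (c < W)%N ->
  ~~ (u <= r < u + s)%N -> M' r c = M r c.
Proof. by move=> H rR cW /negbTE ur; rewrite H // /elimv ur addr0. Qed.

Variable piv : nat -> nat.
Hypothesis pivW : forall r, (r < R)%N -> (piv r < W)%N.

Lemma red_out M M' u v s V S : elimd M M' piv u v s -> (V + S <= R)%N ->
  (V + S <= u)%N || (u + s <= V)%N -> red M piv V S -> red M' piv V S.
Proof.
move=> H VR dis HR x c xV cW.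
have out y : (V <= y < V + S)%N -> forall c, (c < W)%N -> M' y c = M y c.
  by move=> yV c' cW'; apply: (elimd_out H) => //; [lia|apply/negP; lia].
rewrite out // -(HR x c xV cW); apply: pr_ext => y yS.
  by rewrite out // pivW //; lia.
by rewrite out //; lia.
Qed.

(** Projecting onto a reduced block is idempotent, so adding its projection to a row doubles the
    projection, which is zero in characteristic 2. *)
Lemma elim_clean M M' u v s : elimd M M' piv u v s ->
  (u + s <= R)%N -> (v + s <= R)%N -> (u + s <= v)%N || (v + s <= u)%N ->
  red M piv v s -> clean M' piv u s v s.
Proof.
move=> H uR vR dis HR x c xu cW.
have -> : pr M' piv v s (M' x) c =
    pr M piv v s (fun z => M x z + pr M piv v s (M x) z) c.
  apply: pr_ext => y ys.
    by rewrite (elimd_in H) //; [lia|apply: pivW; lia].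
  by apply: (elimd_out H) => //; [lia|apply/negP; lia].
by rewrite prD pr_idem // F2addrr.
Qed.

(** Combinations of rows with zero projection have zero projection. Later work inside the cleaned
    range therefore does not disturb it. *)
Lemma clean_elim M M' u v s U T V S : elimd M M' piv u v s ->
  (U <= u)%N -> (u + s <= U + T)%N -> (U <= v)%N -> (v + s <= U + T)%N ->
  (U + T <= R)%N -> (V + S <= R)%N -> (V + S <= U)%N || (U + T <= V)%N ->
  clean M piv U T V S -> clean M' piv U T V S.
Proof.
move=> H Uu uU Uv vU UR VR dis HC x c xU cW.
have outV y : (y < S)%N -> M' (V + y)%N c = M (V + y)%N c.
  by move=> yS; apply: (elimd_out H) => //; [lia|apply/negP; lia].
have [xu|xu] := boolP (u <= x < u + s)%N; last first.
  rewrite -(HC x c xU cW); apply: pr_ext => // y yS.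
  by apply: (elimd_out H) => //; [lia|apply: pivW; lia].
have -> : pr M' piv V S (M' x) c =
    pr M piv V S (fun z => M x z + pr M piv v s (M x) z) c.
  by apply: pr_ext => // y ys; rewrite (elimd_in H) //; [lia|apply: pivW; lia].
rewrite prD HC // add0r pr_clean // => z d zv dW; apply: HC => //; lia.
Qed.

(** Call the halves A and B. Only rows of B are added to A, and these are invisible at the pivots of
    A, so A still reads its old coefficients; and the new A is invisible at the pivots of B. The
    projection onto the union thus recovers the rows of both halves. *)
Lemma elim_merge M M' a s : elimd M M' piv a (a + s) s -> (a + (s + s) <= R)%N ->
  red M piv a s -> red M piv (a + s) s -> clean M piv (a + s) s a s ->
  red M' piv a (s + s).
Proof.
move=> H aR RA RB CB x c xa cW.
set b := (a + s)%N.
have inA y d : (y < s)%N -> (d < W)%N ->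
    M' (a + y)%N d = M (a + y)%N d + pr M piv b s (M (a + y)%N) d.
  by move=> ys dW; apply: (elimd_in H) => //; lia.
have outB y d : (y < s)%N -> (d < W)%N -> M' (b + y)%N d = M (b + y)%N d.
  by move=> ys dW; apply: (elimd_out H) => //; rewrite /b; [lia|apply/negP; lia].
have split_pr f : pr M' piv a (s + s) f c =
    pr M piv a s f c + pr M piv b s (pr M piv a s f) c + pr M piv b s f c.
  rewrite /pr big_split_ord /=; congr (_ + _); last first.
    by apply: eq_bigr => y _; rewrite addnA -/b outB.
  rewrite -/(pr M piv b s (pr M piv a s f) c) pr_pr -big_split; apply: eq_bigr => y _ /=.
  by rewrite inA // mulrDr.
have pW y : (y < s)%N -> (piv (a + y)%N < W)%N by move=> ys; apply: pivW; lia.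
have pbW y : (y < s)%N -> (piv (b + y)%N < W)%N by move=> ys; apply: pivW; rewrite /b; lia.
rewrite split_pr.
have [xs|xs] := ltnP x b.
  have xA : (a <= x < a + s)%N by rewrite -/b; lia.
  have ex : M' x c = M x c + pr M piv b s (M x) c.
    by rewrite (elimd_in H) //; lia.
  have ea d : (d < W)%N -> pr M piv a s (M' x) d = M x d.
    move=> dW; have -> : pr M piv a s (M' x) d =
      pr M piv a s (fun z => M x z + pr M piv b s (M x) z) d.
      by apply: pr_ext => // y ys; rewrite (elimd_in H) //; [lia|apply: pW].
    by rewrite prD RA // pr_clean // addr0.
  have eb : pr M piv b s (M' x) c = 0.
    have -> : pr M piv b s (M' x) c =
      pr M piv b s (fun z => M x z + pr M piv b s (M x) z) c.
      by apply: pr_ext => // y ys; rewrite (elimd_in H) //; [lia|apply: pbW].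
    by rewrite prD pr_idem // F2addrr.
  rewrite eb addr0 ea // ex; congr (_ + _).
  by apply: pr_ext => // y ys; rewrite ea // pbW.
have xB : (b <= x < b + s)%N by move: xa; rewrite /b in xs *; lia.
have ex d : (d < W)%N -> M' x d = M x d.
  by move=> dW; apply: (elimd_out H) => //; [lia|apply/negP; rewrite /b in xs; lia].
have ea d : (d < W)%N -> pr M piv a s (M' x) d = 0.
  by move=> dW; rewrite -(CB x d xB dW); apply: pr_ext => // y ys; rewrite ex // pW.
rewrite ea // add0r ex //.
have -> : pr M piv b s (pr M piv a s (M' x)) c = 0.
  by rewrite /pr big1 // => y _; rewrite -/(pr M piv a s (M' x) _) ea ?mul0r // pbW.
rewrite add0r -(RB x c xB cW); apply: pr_ext => // y ys; exact/ex/pbW.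
Qed.

Definition mxF (k : nat) M : 'M['F_2]_(k, W) := \matrix_(r < k, c < W) M r c.

(** The source rows do not change, so repeating the operation with the same coefficients undoes it
    in characteristic 2, and one inclusion serves for both directions. *)
Lemma elim_span k M M' u v s : (k <= R)%N -> (v + s <= k)%N ->
  (u + s <= v)%N || (v + s <= u)%N -> elimd M M' piv u v s ->
  (mxF k M' :=: mxF k M)%MS.
Proof.
move=> kR vk dis H.
have out y d : (y < s)%N -> (d < W)%N -> M' (v + y)%N d = M (v + y)%N d.
  by move=> ys dW; apply: (elimd_out H) => //; [lia|apply/negP; lia].
have vyk (y : 'I_s) : (v + y < k)%N by have := ltn_ord y; lia.
have key N N' (C : nat -> nat -> 'F_2) :
    (forall r c, (r < k)%N -> (c < W)%N ->
       N' r c = N r c + \sum_(y < s) C r y * N (v + y)%N c) ->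
    (mxF k N' <= mxF k N)%MS.
  move=> HN; apply/row_subP => i.
  have -> : row i (mxF k N') = row i (mxF k N) +
      \sum_(y < s) C i y *: row (Ordinal (vyk y)) (mxF k N).
    apply/rowP => c; rewrite !mxE HN // summxE; congr (_ + _).
    by apply: eq_bigr => y _; rewrite !mxE.
  apply: addmx_sub; first exact: row_sub.
  by apply: summx_sub => y _; apply: scalemx_sub; apply: row_sub.
pose C r y : 'F_2 := if (u <= r < u + s)%N then M r (piv (v + y)%N) else 0.
have HC r c : (r < k)%N -> (c < W)%N ->
    M' r c = M r c + \sum_(y < s) C r y * M (v + y)%N c.
  move=> rk cW; rewrite H //; last by lia.
  rewrite /elimv /C; case: ifP => // _; rewrite big1 // => y _; exact: mul0r.
apply/eqmxP/andP; split; first exact: key HC.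
apply: (key _ _ C) => r c rk cW; rewrite HC // -addrA -big_split /= big1 ?addr0 // => y _.
by rewrite out // F2addrr.
Qed.

(** A vector lies in the span of a reduced matrix exactly when its projection fixes it. The
    projection of the unit vector [b] is the sum of the rows whose pivot is [b]. *)
Lemma span_test k M (b : 'I_W) : (k <= R)%N -> red M piv 0 k ->
  ((delta_mx 0 b : 'rV['F_2]_W) <= mxF k M)%MS <->
  forall c, (c < W)%N -> \sum_(r < k | piv r == b) M r c = (c == b)%:R.
Proof.
move=> kR HR; split=> [/submxP[D HD] c cW|H].
  have HD' d (dW : (d < W)%N) : \sum_(r < k) D 0 r * M r d = (d == b)%:R.
    have := congr1 (fun X : 'rV_W => X 0 (Ordinal dW)) HD; rewrite !mxE eqxx /=.
    rewrite -val_eqE /= => ->; apply: eq_bigr => r _; by rewrite mxE.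
  rewrite -(HD' _ cW) big_mkcond /=.
  have -> : \sum_(r < k) D 0 r * M r c = \sum_(r < k) D 0 r * pr M piv 0 k (M r) c.
    by apply: eq_bigr => r _; rewrite HR //= add0n.
  under [RHS]eq_bigr => r _ do rewrite /pr mulr_sumr.
  rewrite exchange_big /=; apply: eq_bigr => y _; rewrite !add0n.
  have pW : (piv y < W)%N by apply: pivW; apply: leq_trans kR.
  transitivity ((\sum_(r < k) D 0 r * M r (piv y)) * M y c).
    by rewrite HD' //; case: eqP => _; rewrite ?mul1r ?mul0r.
  by rewrite mulr_suml; apply: eq_bigr => r _; rewrite mulrA.
have -> : delta_mx 0 b = \sum_(r < k | piv r == b) row r (mxF k M).
  apply/rowP => c; rewrite !mxE eqxx /= summxE -val_eqE /= -H //.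
  by apply: eq_bigr => r _; rewrite !mxE.
by apply: summx_sub => r _; apply: row_sub.
Qed.

End Elimination.

(** * Reduction by a binary counter of blocks *)

Definition pskip : prog := 31 ::= N 0.

(** The pivot is the last nonzero column, or 0 for a zero row. The loop performs the carries of the
    counter, register 29 being [i + 1]; the final elimination clears the rows that the new block
    will later be merged with. *)
Definition reduce_body : prog :=
  PSto 3 (V 20) (N 0) ;;
  PFor 28 15 (PIf (A 2 (V 20 *! V 15 +! V 28)) (PSto 3 (V 20) (V 28)) pskip) ;;
  21 ::= N 1 ;;
  29 ::= V 20 +! N 1 ;;
  PWhile (V 29 /! V 21 %! N 2 ==! N 0) (
    22 ::= V 29 -! (V 21 +! V 21) ;;
    23 ::= V 29 -! V 21 ;;
    elim_prog ;;
    21 ::= V 21 +! V 21) ;;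
  22 ::= V 29 ;;
  23 ::= V 29 -! V 21 ;;
  elim_prog.

Definition reduce_prog : prog := PFor 20 14 reduce_body.

Section Levels.
Variables (R W : nat).

(* After [i] rows, the block at level [l] exists when bit [l] of [i] is set; it is fully
   reduced and already eliminated from the [2 ^ l] rows that follow it. *)
Definition level_inv (M : nat -> nat -> 'F_2) piv i l : Prop :=
  odd (i %/ 2 ^ l) ->
  red W M piv ((i %/ 2 ^ l).-1 * 2 ^ l) (2 ^ l) /\
  clean W M piv (i %/ 2 ^ l * 2 ^ l) (2 ^ l) ((i %/ 2 ^ l).-1 * 2 ^ l) (2 ^ l).

Lemma divn_succ d i : 0 < d -> ~~ (d %| i.+1) -> i.+1 %/ d = i %/ d.
Proof. by move=> d0 h; rewrite divnS // (negbTE h) add0n. Qed.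

Lemma divn_bounds d i : 0 < d -> i %/ d * d <= i < (i %/ d).+1 * d.
Proof. by move=> d0; rewrite leq_divM ltn_ceil. Qed.

Lemma mult_gap d x y : d %| x -> d %| y -> x < y -> x + d <= y.
Proof.
case/dvdnP=> a -> /dvdnP[b ->] h.
have d0 : 0 < d by case: d h => //; rewrite !muln0.
rewrite -mulSnr leq_mul2r; move: h; rewrite ltn_mul2r d0 /= => ->.
by rewrite orbT.
Qed.

(* At level [l] the finished block ends below the block being processed. *)
Lemma level_room i t l : 2 ^ t %| i.+1 -> t <= l ->
  i %/ 2 ^ l * 2 ^ l + 2 ^ t <= i.+1.
Proof.
move=> d tl; have /andP[h1 h2] := @divn_bounds (2 ^ l) i (expn_gt0 2 l).
apply: mult_gap => //.
by apply: dvdn_mull; apply: dvdn_exp2l; lia.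
Qed.

(** [i + 1] and the end of the range reserved at level [l] are distinct multiples of [2 ^ t], hence
    at least [2 ^ t] apart. *)
Lemma level_room_above i t l : 2 ^ t %| i.+1 -> ~~ (2 ^ l %| i.+1) -> t < l ->
  i.+1 + 2 ^ t <= i %/ 2 ^ l * 2 ^ l + 2 ^ l.
Proof.
move=> d nd tl; have /andP[h1 h2] := @divn_bounds (2 ^ l) i (expn_gt0 2 l).
rewrite -mulSnr; apply: mult_gap => //.
  by apply: dvdn_mull; apply: dvdn_exp2l; lia.
rewrite ltn_neqAle h2 andbT; apply: contra nd => /eqP->; exact: dvdn_mull.
Qed.

(** The situation at a carry: the block of level [l] is present and ends where the fresh block of
    the same size begins. *)
Lemma odd_quot_sub i l : 2 ^ l.+1 %| i.+1 ->
  [/\ odd (i %/ 2 ^ l), (i %/ 2 ^ l) * 2 ^ l = i.+1 - 2 ^ l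
    & (i %/ 2 ^ l).-1 * 2 ^ l = i.+1 - (2 ^ l + 2 ^ l)].
Proof.
move=> d; have d' : 2 ^ l %| i.+1 by apply: dvdn_trans d; apply: dvdn_exp2l.
have p0 : 0 < 2 ^ l by rewrite expn_gt0.
have e : i.+1 %/ 2 ^ l = (i %/ 2 ^ l).+1 by rewrite divnS // d'.
have ev : ~~ odd (i.+1 %/ 2 ^ l).
  by rewrite -dvdn2 dvdn_divRL // -expnS.
have o : odd (i %/ 2 ^ l) by move: ev; rewrite e /= negbK.
have m : i.+1 = (i %/ 2 ^ l).+1 * 2 ^ l by rewrite -e divnK.
split=> //; first by rewrite m mulSn addKn.
case: (i %/ 2 ^ l) o m => //= q _ ->.
by rewrite !mulSn addnA addKn.
Qed.

(** An elimination confined to the [2 ^ l] rows after a block leaves the block alone and keeps those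
    rows clean. *)
Lemma level_inv_elim M M' piv i l u v s : (forall r, r < R -> piv r < W) -> i + i <= R ->
  elimd R W M M' piv u v s ->
  i %/ 2 ^ l * 2 ^ l <= u -> u + s <= i %/ 2 ^ l * 2 ^ l + 2 ^ l ->
  i %/ 2 ^ l * 2 ^ l <= v -> v + s <= i %/ 2 ^ l * 2 ^ l + 2 ^ l ->
  level_inv M piv i l -> level_inv M' piv i l.
Proof.
move=> pW iR E h1 h2 h3 h4 G o; have [G1 G2] := G o.
have e : (i %/ 2 ^ l).-1 * 2 ^ l + 2 ^ l = i %/ 2 ^ l * 2 ^ l.
  by rewrite -mulSnr prednK //; case: (i %/ 2 ^ l) o.
have h5 : i %/ 2 ^ l * 2 ^ l <= i by apply: leq_divM.
move: (i %/ 2 ^ l * 2 ^ l) (2 ^ l) ((i %/ 2 ^ l).-1) e h1 h2 h3 h4 h5 G1 G2.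
move=> U d q e h1 h2 h3 h4 h5 G1 G2.
by split; [apply: (red_out pW E) G1|apply: (clean_elim pW E) G2]; move: (q * d) e; lia.
Qed.

End Levels.

Definition lcost tm W l := ecost tm W (2 ^ l) + 40.
(** An amortized cost: level [l] acts once for each multiple of [2 ^ l] among the row counts [1] to
    [i]. *)
Definition pot tm W K i := \sum_(l < K) i %/ 2 ^ l * lcost tm W l.

Lemma pot_step tm W K i t : t < K -> 2 ^ t %| i.+1 ->
  pot tm W K i + \sum_(l < t.+1) lcost tm W l <= pot tm W K i.+1.
Proof.
move=> tK d; rewrite /pot.
rewrite (big_ord_widen _ (fun l => lcost tm W l) tK) [X in _ + X <= _]big_mkcond -big_split /=.
apply: leq_sum => l _; have p0 : 0 < 2 ^ l by rewrite expn_gt0.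
case: ifP => lt; last by rewrite addn0 leq_mul2r leq_div2r ?orbT.
rewrite divnS // (dvdn_trans _ d); last by apply: dvdn_exp2l; lia.
by rewrite mulSn addnC.
Qed.

Lemma red_piv W M piv piv' v s : (forall y, v <= y < v + s -> piv y = piv' y) ->
  red W M piv v s -> red W M piv' v s.
Proof.
move=> H HR x c xv cW; rewrite -(HR x c xv cW); apply: eq_bigr => y _.
by rewrite H // leq_addr ltn_add2l ltn_ord.
Qed.

Lemma clean_piv W M piv piv' u t v s : (forall y, v <= y < v + s -> piv y = piv' y) ->
  clean W M piv u t v s -> clean W M piv' u t v s.
Proof.
move=> H HR x c xv cW; rewrite -(HR x c xv cW); apply: eq_bigr => y _.
by rewrite H // leq_addr ltn_add2l ltn_ord.
Qed.

Lemma level_inv_piv W M piv piv' i l : (forall y, y < i -> piv y = piv' y) ->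
  level_inv W M piv i l -> level_inv W M piv' i l.
Proof.
move=> H G o; have [G1 G2] := G o.
have lt y : (i %/ 2 ^ l).-1 * 2 ^ l <= y < (i %/ 2 ^ l).-1 * 2 ^ l + 2 ^ l -> piv y = piv' y.
  case/andP=> _ yl; apply: H; apply: leq_trans yl _.
  rewrite -mulSnr prednK; last by case: (i %/ 2 ^ l) o.
  exact: leq_divM.
by split; [apply: red_piv G1|apply: clean_piv G2].
Qed.

Section Reduce.
Variables (w K0 : nat) (tm : nat -> nat) (W Lk : nat).
Let k2 := 2 ^ Lk.
(** The last block has [k2] rows and is eliminated from the [k2] rows after it like any other;
    padding rows give it room to do so. *)
Let R := k2 + k2.
Hypothesis k2W : k2 %| W.
Hypothesis W0 : 0 < W.
Hypothesis Kw : K0 * lg k2 <= w.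
Hypothesis l2 : 2 < lim w.
Hypothesis RWl : R * W < lim w.
Let cm := @mmcs_mono w K0 tm.

Let k20 : 0 < k2. Proof. by rewrite expn_gt0. Qed.
Let Wl x : x <= W -> x < lim w.
Proof. by move=> xW; apply: leq_ltn_trans RWl; apply: leq_trans xW _; apply: leq_pmull; rewrite addn_gt0 k20. Qed.
Let Rl x : x <= R -> x < lim w.
Proof. by move=> xW; apply: leq_ltn_trans RWl; apply: leq_trans xW _; apply: leq_pmulr. Qed.

Definition MF (s : hst) := F2m W (hm s 2).

(** A single row is reduced as soon as its pivot entry is 1 or the whole row is zero. *)
Lemma leaf_wp i s (Q : hst -> Prop) :
  hr s 20 = i -> hr s 15 = W -> i < k2 -> bitmx R W (hm s 2) ->
  (forall s', frame [:: 28; 31] [:: 3] s s' -> hk s' <= hk s + 18 * W + 9 ->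
     (forall y, y != i -> hm s' 3 y = hm s 3 y) -> hm s' 3 i < W ->
     red W (MF s) (hm s' 3) i 1 -> Q s') ->
  wp w (mmcs w K0 tm)
   (PSto 3 (V 20) (N 0) ;;
    PFor 28 15 (PIf (A 2 (V 20 *! V 15 +! V 28)) (PSto 3 (V 20) (V 28)) pskip)) s Q.
Proof.
move=> e20 e15 ik Mb HQ.
apply: wp_seq; apply: wp_sto => /=; [by []|exact: lim_gt0|].
have iR : i < R by rewrite /R; lia.
set s0 := tick _ _.
have F0 : frame [::] [:: 3] s s0 by rewrite /s0; fr.
apply: (@wp_forF w _ cm 28 15 _ s0 _ W 10 [:: 28; 31] [:: 3] (fun c s' =>
  [/\ (forall y, y != i -> hm s' 3 y = hm s 3 y), hm s' 3 i < W &
      (hm s 2 (i * W + hm s' 3 i) = 1) \/ (forall d, d < c -> hm s 2 (i * W + d) = 0)])) => //.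
- exact: Wl.
- split=> /=.
  + by move=> y yi; rewrite e20 (negbTE yi).
  + by rewrite e20 eqxx.
  + by right.
- move=> c s1 cW F1 xc [I1 I2 I3].
  have F : frame [:: 28; 31] [:: 3] s s1 by fr.
  have [f20 f15] : hr s1 20 = i /\ hr s1 15 = W by rewrite !(frR F).
  have m2 : hm s1 2 = hm s 2 by rewrite (frM F).
  have sf : i * W + c < lim w by apply: ltn_trans RWl; apply: ltn_flat.
  have sf2 : i * W < lim w by apply: leq_ltn_trans sf; apply: leq_addr.
  have B := Mb i c iR cW.
  apply: wp_if => /=; first by sp; rewrite /= ?f20 ?f15 ?xc.
    rewrite f20 f15 xc m2 => b1; apply: wp_sto => //=; split=> /=; [by fr|by []|by lia|].
    split=> /=; rewrite ?f20 ?xc ?eqxx //.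
      by move=> y yi; rewrite (negbTE yi) I1.
    by left; lia.
  rewrite f20 f15 xc m2 => b0; apply: wp_asg => /=; first exact: lim_gt0.
  split=> /=; [by fr|by []|by lia|].
  split=> //=; case: I3 => [h|h]; [by left|right=> d].
  by rewrite ltnS leq_eqVlt => /orP[/eqP->|/h].
- move=> s1 F1 x1 T1 [I1 I2 I3]; apply: HQ => //.
  + by fr.
  + by move: T1; rewrite /s0 /=; lia.
  + move=> x c; rewrite addn1 ltnS -eqn_leq => /eqP<- cW.
    rewrite /pr big_ord_recl big_ord0 addr0 addn0 /MF /F2m.
    case: I3 => [->|I3]; first by rewrite mul1r.
    by rewrite !I3 // mulr0.
Qed.


Let pivb (p : nat -> nat) := forall r, r < R -> p r < W.

(** Only the first [k2] rows count, so eliminations that act on the padding are harmless. *)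
Definition spaneq M M' := forall e : 'rV['F_2]_W, (e <= mxF W k2 M)%MS = (e <= mxF W k2 M')%MS.

Lemma spaneq_elim M M' piv u v s : v + s <= k2 -> (u + s <= v) || (v + s <= u) ->
  elimd R W M M' piv u v s -> spaneq M' M.
Proof.
move=> vk dis E e; by rewrite (elim_span (leq_addr _ _ : k2 <= R) vk dis E).
Qed.

Lemma spaneq_trans M1 M2 M3 : spaneq M1 M2 -> spaneq M2 M3 -> spaneq M1 M3.
Proof. by move=> H1 H2 e; rewrite H1 H2. Qed.

Definition Xr := [:: 21; 22; 23; 24; 25; 26; 27; 28; 29; 31; 59].
Definition Yr := [:: 2; 3; 4; 20; 21; 22].

Lemma reduce_body_wp i s (Q : hst -> Prop) :
  hr s 20 = i -> hr s 15 = W -> i < k2 -> bitmx R W (hm s 2) -> pivb (hm s 3) ->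
  hc s = [::] -> (forall l, level_inv W (MF s) (hm s 3) i l) ->
  (forall s', frame Xr Yr s s' ->
     hk s' + pot tm W Lk.+1 i <= hk s + 18 * W + 60 + pot tm W Lk.+1 i.+1 ->
     bitmx R W (hm s' 2) -> pivb (hm s' 3) ->
     (forall l, level_inv W (MF s') (hm s' 3) i.+1 l) ->
     spaneq (MF s') (MF s) -> Q s') ->
  wp w (mmcs w K0 tm) reduce_body s Q.
Proof.
move=> e20 e15 ik Mb pb Cs G HQ; rewrite /reduce_body.
have Mo : forall (p q r : prog) s Q, wp w (mmcs w K0 tm) (p ;; q) s
    (fun s' => wp w (mmcs w K0 tm) r s' Q) -> wp w (mmcs w K0 tm) (p ;; q ;; r) s Q by [].
apply: Mo; apply: (leaf_wp e20 e15 ik Mb) => s1 F1 T1 P1 P1i RD1.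
have MF1 : MF s1 = MF s by rewrite /MF (frM F1).
have Mb1 : bitmx R W (hm s1 2) by rewrite (frM F1).
have pb1 : pivb (hm s1 3).
  by move=> r rR; case: (eqVneq r i) => [->//|ri]; rewrite P1 // pb.
have G1 l : level_inv W (MF s1) (hm s1 3) i l.
  by rewrite MF1; apply: (level_inv_piv _ (G l)) => y yi; rewrite P1 //; lia.
have C1 : hc s1 = [::] by rewrite (frC F1).
have [f20 f15] : hr s1 20 = i /\ hr s1 15 = W by rewrite !(frR F1).
have iR : i.+1 < lim w by apply: Rl; rewrite /R; lia.
have l1 : 1 < lim w by lia.
apply: wp_seq; apply: wp_asg => //=.
apply: wp_seq; apply: wp_asg => /=; first by sp; rewrite //= f20 addn1.
set s2 := tick _ _.
have F02 : frame Xr Yr s s2 by rewrite /s2; fr.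
have Fm2 : hm s2 = hm s1 by [].
have C2 : hc s2 = [::] by [].
have T2 : hk s2 = hk s1 + 6 by rewrite /s2 /=; lia.
have [g21 g29] : hr s2 21 = 1 /\ hr s2 29 = i.+1 by rewrite /s2 /= f20 addn1.
have g15 : hr s2 15 = W by [].
clearbody s2.
(* The number of carries when the counter passes from [i] to [i + 1]. *)
set t := logn 2 i.+1.
have dt l : l <= t -> 2 ^ l %| i.+1 by move=> lt; rewrite pfactor_dvdn.
have ndt l : t < l -> ~~ (2 ^ l %| i.+1) by move=> lt; rewrite pfactor_dvdn // -ltnNge.
have tL : t <= Lk.
  by rewrite -(leq_exp2l (m := 2)) //; apply: leq_trans ik; apply: dvdn_leq; rewrite // dt.
have lk l : l <= t -> 2 ^ l <= k2 by move=> lt; rewrite leq_exp2l //; apply: leq_trans tL.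
have li l : l <= t -> 2 ^ l <= i.+1 by move=> lt; apply: dvdn_leq; rewrite // dt.
have dW l : l <= t -> 2 ^ l %| W.
  by move=> lt; apply: dvdn_trans k2W; apply: dvdn_exp2l; apply: leq_trans tL.
have Kl l : l <= t -> K0 * lg (2 ^ l) <= w.
  move=> lt; apply: leq_trans Kw; rewrite leq_mul2l; apply/orP; right.
  by rewrite /lg ltnS; apply: leq_trunc_log; apply: lk.
have p0 l : 0 < 2 ^ l by rewrite expn_gt0.
have Sl l : l <= t -> 2 ^ l < lim w.
  by move=> lt; apply: Rl; rewrite /R; have := lk l lt; lia.
(* After [l] carries the last [2 ^ l] rows up to row [i] form one reduced block, and only the levels
   from [l] on still carry their invariant for [i]. *)
pose J l (s' : hst) := [/\ frame [:: 21; 22; 23; 24; 25; 26; 27; 59] [:: 2; 4; 20; 21; 22] s2 s',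
   hr s' 21 = 2 ^ l, hk s' <= hk s2 + \sum_(l' < l) lcost tm W l',
   bitmx R W (hm s' 2) &
   [/\ red W (MF s') (hm s1 3) (i.+1 - 2 ^ l) (2 ^ l),
       forall l', l <= l' -> level_inv W (MF s') (hm s1 3) i l' &
       spaneq (MF s') (MF s)]].
apply: wp_seq; exists t, J; split.
- split=> //.
  + by rewrite big_ord0 addn0.
  + by rewrite Fm2.
  + have MF2 : MF s2 = MF s by rewrite -MF1 /MF Fm2.
    rewrite MF2 expn0 subn1; split=> // l' _.
    by rewrite -MF1; apply: G1.
- move=> l s3 lt [F3 h21 T3 Mb3 [RD3 G3 SP3]].
  have h29 : hr s3 29 = i.+1 by rewrite (frR F3).
  have h15 : hr s3 15 = W by rewrite (frR F3).
  have pl := p0 l.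
  have dl : 2 ^ l %| i.+1 by apply: dt; lia.
  have e2 : 2 ^ l.+1 = 2 ^ l + 2 ^ l by rewrite expnS mul2n addnn.
  have [oq q1 q2] := odd_quot_sub (dt _ lt).
  have i2 := li _ lt; rewrite e2 in i2.
  have k22 := lk _ lt; rewrite e2 in k22.
  split=> /=.
  + by sp; rewrite //= ?lim_gt0.
  + rewrite h29 h21; have : 2 %| i.+1 %/ 2 ^ l by rewrite dvdn_divRL // -expnS dt.
    by rewrite /dvdn => ->.
  apply: wp_seq; apply: wp_asg => /=.
    by sp; rewrite /= ?h21 ?h29 // -e2; apply: Sl.
  apply: wp_seq; apply: wp_asg => /=.
    by sp; rewrite /= ?h21 ?h29 //; lia.
  apply: wp_seq; set s4 := tick _ (upr _ 23 _).
  have F4 : frame [:: 22; 23] [::] s3 s4 by rewrite /s4; fr.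
  have T4 : hk s4 = hk s3 + 18 by rewrite /s4 /=; lia.
  have [m21 m22 m23 m15] : [/\ hr s4 21 = 2 ^ l, hr s4 22 = i.+1 - (2 ^ l + 2 ^ l),
      hr s4 23 = i.+1 - 2 ^ l & hr s4 15 = W].
    by rewrite /s4 /= h21 h29.
  have M4 : hm s4 = hm s3 by [].
  have C4 : hc s4 = [::] by rewrite (frC F4) (frC F3).
  clearbody s4.
  have P4 : hm s4 3 = hm s1 3 by rewrite M4 (frM F3) // Fm2.
  have eA : i.+1 - (2 ^ l + 2 ^ l) + 2 ^ l = i.+1 - 2 ^ l by lia.
  apply: (@elim_wp _ _ _ R W (2 ^ l) (i.+1 - (2 ^ l + 2 ^ l)) (i.+1 - 2 ^ l)) => //.
  + by apply: dW; lia.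
  + by rewrite /R; lia.
  + by apply: Kl; lia.
  + by rewrite /R; lia.
  + by rewrite /R; lia.
  + by rewrite eA leqnn.
  + by rewrite P4.
  + by rewrite M4.
  move=> s5 F5 T5 Mb5 E5; apply: wp_asg => /=.
    by sp; rewrite (frR F5) //= m21 -e2; apply: Sl.
  have E5' : elimd R W (MF s4) (MF s5) (hm s1 3) (i.+1 - (2 ^ l + 2 ^ l)) (i.+1 - 2 ^ l) (2 ^ l).
    by move=> r c rR cW; rewrite /MF E5 // P4.
  have MF4 : MF s4 = MF s3 by rewrite /MF M4.
  split=> /=.
  + by fr.
  + by rewrite (frR F5) //= m21 -e2.
  + rewrite big_ord_recr /=; move: T3 T4 T5; rewrite /lcost.
    by move: (\sum_(_ < _) _) (ecost _ _ _) => a b; lia.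
  + exact: Mb5.
  rewrite /MF /=; split.
  + rewrite e2; rewrite -eA in E5'; apply: (elim_merge pb1 E5').
    * by rewrite /R; lia.
    * by have [] := G3 l (leqnn _) oq; rewrite q2 MF4.
    * by rewrite eA MF4.
    * by have [_] := G3 l (leqnn _) oq; rewrite q1 q2 eA MF4.
  + move=> l' ll' o'; have [GA GB] := G3 l' (ltnW ll') o'.
    have rm := level_room (dt _ lt) ll'; rewrite e2 in rm.
    have /andP[_ ub] := @divn_bounds (2 ^ l') i (p0 l').
    rewrite mulSnr in ub; rewrite -MF4 in GA GB.
    apply: (level_inv_elim pb1 _ E5' _ _ _ _ _ o'); [by rewrite /R; lia|..|by move=> _; split];
      move: (_ * 2 ^ l') rm ub => U; lia.
  + apply: spaneq_trans SP3; rewrite -MF4.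
    by apply: (spaneq_elim _ _ E5'); lia.
- move=> s3 [F3 h21 T3 Mb3 [RD3 G3 SP3]].
  have h29 : hr s3 29 = i.+1 by rewrite (frR F3).
  have h15 : hr s3 15 = W by rewrite (frR F3).
  have pt := p0 t.
  have dtt := dt t (leqnn t); have it := li _ (leqnn t).
  have kt := lk t (leqnn t).
  have ot : odd (i.+1 %/ 2 ^ t).
    have := ndt t.+1 (ltnSn _); rewrite expnS -dvdn_divRL // dvdn2 negbK //.
  split=> /=.
  + by sp; rewrite //= ?lim_gt0.
  + by rewrite h29 h21 modn2 ot.
  apply: wp_seq; apply: wp_asg => //=.
  apply: wp_seq; apply: wp_asg => /=.
    by sp; rewrite /= ?h21 ?h29 //; lia.
  set s4 := tick _ (upr _ 23 _).
  have F4 : frame [:: 22; 23] [::] s3 s4 by rewrite /s4; fr.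
  have T4 : hk s4 = hk s3 + 14 by rewrite /s4 /=; lia.
  have [m21 m22 m23 m15] : [/\ hr s4 21 = 2 ^ t, hr s4 22 = i.+1,
      hr s4 23 = i.+1 - 2 ^ t & hr s4 15 = W].
    by rewrite /s4 /= h21 h29.
  have M4 : hm s4 = hm s3 by [].
  have C4 : hc s4 = [::] by rewrite (frC F4) (frC F3).
  clearbody s4.
  have P4 : hm s4 3 = hm s1 3 by rewrite M4 (frM F3) // Fm2.
  have ktj : i.+1 + 2 ^ t <= R by rewrite /R; lia.
  apply: (@elim_wp _ _ _ R W (2 ^ t) i.+1 (i.+1 - 2 ^ t)) => //.
  + by apply: dW.
  + by rewrite /R; lia.
  + by apply: Kl.
  + by rewrite /R; lia.
  + by rewrite subnK // leqnn orbT.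
  + by rewrite P4.
  + by rewrite M4.
  move=> s5 F5 T5 Mb5 E5.
  have E5' : elimd R W (MF s4) (MF s5) (hm s1 3) i.+1 (i.+1 - 2 ^ t) (2 ^ t).
    by move=> r c rR cW; rewrite /MF E5 // P4.
  have P5 : hm s5 3 = hm s1 3 by rewrite (frM F5).
  have MF4 : MF s4 = MF s3 by rewrite /MF M4.
  have FF : frame Xr Yr s s5 by fr.
  apply: HQ => //.
  + have := @pot_step tm W Lk.+1 i t (ltac:(lia)) dtt; rewrite big_ord_recr /=.
    move: T1 T2 T3 T4 T5; rewrite /lcost.
    move: (\sum_(_ < _) _) (ecost _ _ _) (pot _ _ _ _) (pot _ _ _ _) => a b c d.
    lia.
  + by rewrite P5.
  + move=> l o; rewrite P5.
    (* Below [t] the new digit is 0 and nothing is claimed; above [t] the digit and its block are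
       the old ones; at [t] stands the block just built. *)
    case: (ltngtP l t) => lt.
    * have : 2 %| i.+1 %/ 2 ^ l.
        by rewrite dvdn_divRL ?dt //; [rewrite -expnS dt|exact: ltnW].
      by rewrite dvdn2 o.
    * have nd := ndt _ lt; rewrite divn_succ // in o *.
      have [GA GB] := G3 l (ltnW lt) o; rewrite -MF4 in GA GB.
      have rm := level_room dtt (ltnW lt); have rm2 := level_room_above dtt nd lt.
      apply: (level_inv_elim pb1 _ E5' _ _ _ _ _ o); [by rewrite /R; lia|..|by move=> _; split];
        move: (_ * 2 ^ l) rm rm2 => U; lia.
    * rewrite {}lt in o *; have eq1 : i.+1 %/ 2 ^ t * 2 ^ t = i.+1 by rewrite divnK.
      have eq2 : (i.+1 %/ 2 ^ t).-1 * 2 ^ t = i.+1 - 2 ^ t by rewrite -subn1 mulnBl eq1 mul1n.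
      rewrite eq1 eq2 in RD3 *; rewrite -MF4 in RD3.
      split.
        by apply: (red_out pb1 E5') RD3; rewrite /R; lia.
      by apply: (elim_clean pb1 E5') => //; rewrite /R; lia.
  + rewrite -MF1; apply: spaneq_trans (_ : spaneq (MF s3) _).
      by rewrite -MF4; apply: (spaneq_elim _ _ E5'); lia.
    by move=> e; rewrite SP3 MF1.
Qed.

Lemma reduce_wp s (Q : hst -> Prop) :
  hr s 14 = k2 -> hr s 15 = W -> bitmx R W (hm s 2) -> pivb (hm s 3) -> hc s = [::] ->
  (forall s', frame (20 :: Xr) Yr s s' ->
     hk s' <= hk s + 6 + k2 * (18 * W + 68) + pot tm W Lk.+1 k2 ->
     bitmx R W (hm s' 2) -> pivb (hm s' 3) -> red W (MF s') (hm s' 3) 0 k2 ->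
     spaneq (MF s') (MF s) -> Q s') ->
  wp w (mmcs w K0 tm) reduce_prog s Q.
Proof.
move=> e14 e15 Mb pb Cs HQ.
apply: (@wp_for w _ cm 20 14 _ s _ k2 (fun i s' => [/\ frame (20 :: Xr) Yr s s',
   hk s' <= hk s + 2 + i * (18 * W + 68) + pot tm W Lk.+1 i, bitmx R W (hm s' 2),
   pivb (hm s' 3) & (forall l, level_inv W (MF s') (hm s' 3) i l) /\ spaneq (MF s') (MF s)])) => //.
- by apply: Rl; apply: leq_addr.
- split=> //=.
  + by fr.
  + by rewrite /=; lia.
  + split=> // l; rewrite /level_inv div0n //.
- move=> i s1 ik x20 x14 [F1 T1 Mb1 pb1 [G1 SP1]].
  have f15 : hr s1 15 = W by rewrite (frR F1).
  apply: (@reduce_body_wp i) => //=.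
    by rewrite (frC F1).
  move=> s2 F2 T2 Mb2 pb2 G2 SP2; split=> /=.
  + by rewrite (frR F2).
  + by rewrite (frR F2).
  split=> //.
  + by fr.
  + by move: T1 T2 => /=; lia.
  + by split=> //; apply: spaneq_trans SP2 SP1.
- move=> s1 x20 x14 [F1 T1 Mb1 pb1 [G1 SP1]]; apply: HQ => //=; first by lia.
  (* At [i = k2] the quotient at level [Lk] is 1, and the block of this level consists of the first
     [k2] rows. *)
  have := G1 Lk; rewrite /level_inv divnn k20 /= mul0n => /(_ isT)[].
  by [].
Qed.

End Reduce.

(** * The decoder *)

Definition bitn (x j : nat) : nat := odd (x %/ 2 ^ j).

(** Horner's rule from the top bit downwards, since labels store the least significant bit first. *)
Definition readnum (x : nat) (off : expr) : prog :=
  43 ::= off ;; x ::= N 0 ;;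
  PFor 42 10 (x ::= V x +! V x +! A 1 (V 43 +! V 10 -! N 1 -! V 42)).

Lemma half_pow num d : num %/ 2 ^ d = (num %/ 2 ^ d.+1) + (num %/ 2 ^ d.+1) + bitn num d.
Proof.
rewrite /bitn addnn expnSr divnMA -[LHS]odd_double_half addnC.
by rewrite -divn2.
Qed.

Lemma big_ord_recr_cond n (P : pred nat) (F : nat -> nat) :
  \sum_(i < n.+1 | P i) F i = \sum_(i < n | P i) F i + (if P n then F n else 0).
Proof. by rewrite big_mkcond big_ord_recr /= -big_mkcond. Qed.

Section Dec.
Variables (w K0 : nat) (tm : nat -> nat).
Hypothesis l2 : 7 < lim w.
Let cm := @mmcs_mono w K0 tm.
Notation wp := (wp w (mmcs w K0 tm)).

Lemma readnum_wp x off s (Q : hst -> Prop) L num o :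
  x \in [:: 16; 17; 18; 19; 35; 36] -> hr s 10 = L -> safe w s off -> ev s off = o ->
  num < 2 ^ L -> num < lim w -> o + L < lim w ->
  (forall j, j < L -> hm s 1 (o + j) = bitn num j) ->
  (forall s', frame [:: x; 42; 43] [::] s s' -> hr s' x = num ->
     hk s' <= hk s + 30 + cost off + 30 * L -> Q s') ->
  wp (readnum x off) s Q.
Proof.
move=> xs e10 sfo eo numL numl oL bits HQ.
have [x42 x43 x10] : [/\ x != 42, x != 43 & x != 10].
  by move: xs; rewrite !inE; repeat (case/orP => [/eqP->|]) => //; move/eqP->.
apply: wp_seq; apply: wp_asg => //=.
apply: wp_seq; apply: wp_asg => /=; first exact: lim_gt0.
set s1 := tick _ (upr _ x _).
have F1 : frame [:: x; 42; 43] [::] s s1 by rewrite /s1; fr.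
have x1 : hr s1 x = 0 by rewrite /s1 hr_tick hr_upr eqxx.
have e43 : hr s1 43 = o by rewrite /s1 hr_tick hr_upr eq_sym (negbTE x43).
have f10 : hr s1 10 = L by rewrite (frR F1) // !inE negb_or eq_sym x10.
have T1 : hk s1 = hk s + (cost off).+1 + 2 by rewrite /s1.
clearbody s1.
apply: (@wp_forF w _ cm 42 10 _ s1 _ L 20 [:: x; 42] [::] (fun i s' => hr s' x = num %/ 2 ^ (L - i))) => //.
- by rewrite !inE eqxx orbT.
- by rewrite !inE negb_or eq_sym x10.
- by lia.
- by rewrite hr_upr (negbTE x42) x1 subn0 divn_small.
- move=> i s2 iL F2 xi I2.
  have F : frame [:: x; 42; 43] [::] s s2 by fr.
  have g43 : hr s2 43 = o by rewrite (frR F2) // !inE negb_or eq_sym x43.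
  have g10 : hr s2 10 = L by rewrite (frR F2) // !inE negb_or eq_sym x10.
  have g1 : hm s2 1 = hm s 1 by rewrite (frM F).
  have io : o + L - 1 - i = o + (L - i.+1) by lia.
  have eLi : (L - i.+1).+1 = L - i by lia.
  have B := bits (L - i.+1) (ltac:(lia)).
  have [l3 l4 l5] : [/\ 1 < lim w, 0 < o + L & i <= o + L - 1] by split; lia.
  have hp := half_pow num (L - i.+1).
  rewrite eLi in hp.
  have le : num %/ 2 ^ (L - i.+1) < lim w by apply: leq_ltn_trans (leq_div _ _) numl.
  have le1 : num %/ 2 ^ (L - i) + num %/ 2 ^ (L - i) < lim w.
    by apply: leq_ltn_trans le; rewrite hp leq_addr.
  apply: wp_asg.
    by rewrite /=; sp; rewrite /= ?g43 ?g10 ?xi ?io ?g1 ?I2 ?B -?hp //.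
  rewrite [ev _ _]/= g43 g10 xi io g1 I2 B -hp.
  split; [by fr|by rewrite hr_tick hr_upr eq_sym (negbTE x42)|by rewrite /= leq_add2l|].
  by rewrite hr_upr (negbTE x42) hr_tick hr_upr eqxx.
- move=> s2 F2 x2 T2 I2; apply: HQ.
  + by fr.
  + by rewrite I2 subnn divn1.
  + by lia.
Qed.

(** The length of an edge label is taken from the third string, the label of the first fault; this
    code runs only when there is one. The number of faults is rounded up to a power of two. *)
Definition dec_dims : prog :=
  12 ::= A 0 (N 2) ;;
  13 ::= V 12 -! (V 10 +! V 10) ;;
  14 ::= N 1 ;;
  PWhile (V 14 <! V 11) (14 ::= V 14 +! V 14) ;;
  15 ::= ((V 13 +! N 1) /! V 14 +! N 1) *! V 14.

Definition dec_zero : prog :=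
  32 ::= V 14 +! V 14 ;;
  30 ::= V 32 *! V 15 ;;
  PFor 28 30 (PSto 2 (V 28) (N 0)) ;;
  PFor 28 32 (PSto 3 (V 28) (N 0)).

Definition dec_path : prog :=
  PFor 33 11 (
    34 ::= (V 10 +! V 10) +! (V 10 +! V 10) +! V 33 *! V 12 ;;
    readnum 35 (V 34) ;;
    readnum 36 (V 34 +! V 10) ;;
    PSto 2 (V 33 *! V 15 +! V 13)
      (((V 17 <! V 35) +! (V 17 <! V 36) +! (V 19 <! V 35) +! (V 19 <! V 36)) %! N 2)).

Definition dec_copy : prog :=
  37 ::= V 11 *! V 13 ;;
  PFor 28 37 (PSto 2 (V 28 /! V 13 *! V 15 +! V 28 %! V 13)
    (A 1 ((V 10 +! V 10) +! (V 10 +! V 10) +! V 28 /! V 13 *! V 12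
          +! (V 10 +! V 10 +! V 28 %! V 13)))).

(** The sum of the rows with pivot [b] is compared column by column with the unit vector [b].
    Register 38 stays 1 when they agree, which means that the faults separate the two vertices;
    hence the final complement. *)
Definition dec_test : prog :=
  38 ::= N 1 ;;
  PFor 39 15 (
    40 ::= (V 39 ==! V 13) ;;
    PFor 41 14 (PIf (A 3 (V 41) ==! V 13)
      (40 ::= V 40 +! A 2 (V 41 *! V 15 +! V 39)) pskip) ;;
    PIf (V 40 %! N 2) (38 ::= N 0) pskip) ;;
  0 ::= N 1 -! V 38.

Variables (L k b ps pt : nat) (la lb : nat -> nat) (ph : nat -> nat -> nat).
Let We := L + L + b.
Let Lk := up_log 2 k.
Let k2 := 2 ^ Lk.
(** The least multiple of [k2] above [b + 1], so that strips of every size [2 ^ l <= k2] tile the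
    columns. *)
Definition dec_width (b k2 : nat) := ((b + 1) %/ k2 + 1) * k2.
Let W := dec_width b k2.
Let R := k2 + k2.
Let o4 := (L + L) + (L + L).
Hypothesis k0 : 0 < k.
Hypothesis RWl : R * W < lim w.
Hypothesis ol : o4 + k * We < lim w.
Hypothesis lal : forall q, q < k -> la q < 2 ^ L /\ la q < lim w.
Hypothesis lbl : forall q, q < k -> lb q < 2 ^ L /\ lb q < lim w.
Hypothesis phl : forall q j, q < k -> j < b -> ph q j < 2.

Definition edge_bits (g : nat -> nat) : Prop := forall q, q < k ->
  [/\ forall j, j < L -> g (o4 + q * We + j) = bitn (la q) j,
      forall j, j < L -> g (o4 + q * We + L + j) = bitn (lb q) j &
      forall j, j < b -> g (o4 + q * We + (L + L + j)) = ph q j].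

(** Two comparisons give the side of one vertex, so the sum of four tells whether the tree edge [q]
    separates the two vertices, that is, lies on the tree path between them. *)
Definition path_bit q := ((ps < la q) + (ps < lb q) + (pt < la q) + (pt < lb q)) %% 2.

Definition dec_mx (r c : nat) : nat :=
  if r < k then (if c < b then ph r c else if c == b then path_bit r else 0) else 0.

Let k20 : 0 < k2. Proof. by rewrite expn_gt0. Qed.
Let kk2 : k <= k2. Proof. exact: up_logP. Qed.
Let bW : b < W.
Proof.
rewrite /W /dec_width addn1 mulSn.
have := ltn_ceil (b + 1) k20; rewrite mulSn; lia.
Qed.
Let k2W : k2 %| W. Proof. exact: dvdn_mull. Qed.
Let Wl x : x <= W -> x < lim w.
Proof. by move=> xW; apply: leq_ltn_trans RWl; apply: leq_trans xW _; apply: leq_pmull; rewrite addn_gt0 k20. Qed.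
Let Rl x : x <= R -> x < lim w.
Proof. by move=> xW; apply: leq_ltn_trans RWl; apply: leq_trans xW _; apply: leq_pmulr; lia. Qed.

Definition dims (s : hst) := [/\ hr s 10 = L, hr s 11 = k, hr s 12 = We, hr s 13 = b &
  [/\ hr s 14 = k2, hr s 15 = W, hr s 17 = ps & hr s 19 = pt]].

Lemma dims_frame X Y s s' : frame X Y s s' -> all (fun y => y \notin X) [:: 10; 11; 12; 13; 14; 15; 17; 19] ->
  dims s -> dims s'.
Proof.
move=> F /allP ne [h1 h2 h3 h4 [h5 h6 h7 h8]].
by rewrite /dims !(frR F) //; apply: ne.
Qed.

Lemma dec_dims_wp s (Q : hst -> Prop) :
  hr s 10 = L -> hr s 11 = k -> hm s 0 2 = We -> hr s 17 = ps -> hr s 19 = pt ->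
  (forall s', frame [:: 12; 13; 14; 15] [::] s s' -> dims s' -> hk s' <= hk s + 60 + 20 * k ->
    Q s') ->
  wp dec_dims s Q.
Proof.
move=> e10 e11 e02 e17 e19 HQ.
have LL : L + L < lim w by apply: leq_ltn_trans ol; rewrite /o4; lia.
have kl : k < lim w by apply: Rl; rewrite /R; lia.
apply: wp_seq; apply: wp_asg => /=; first by lia.
apply: wp_seq; apply: wp_asg => /=; first by sp; rewrite /= ?e10 ?e02 // /We; lia.
apply: wp_seq; apply: wp_asg => /=; first by lia.
set s1 := tick _ (upr _ 14 _).
have F1 : frame [:: 12; 13; 14] [::] s s1 by rewrite /s1; fr.
have [f12 f13 f14] : [/\ hr s1 12 = We, hr s1 13 = b & hr s1 14 = 1].
  by rewrite /s1 /= e02 e10 /We addKn.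
have f11 : hr s1 11 = k by rewrite (frR F1).
have T1 : hk s1 <= hk s + 20 by rewrite /s1 /=; lia.
clearbody s1.
apply: wp_seq; exists Lk, (fun i s' => [/\ frame [:: 14] [::] s1 s', hr s' 14 = 2 ^ i & hk s' <= hk s1 + 8 * i]).
split.
- by split=> //; rewrite muln0 addn0.
- move=> i s2 iL [F2 x14 T2].
  have p : 2 ^ i < k.
    by rewrite ltnNge; apply/negP => h; have := @up_log_min 2 k i isT h; rewrite -/Lk leqNgt iL.
  rewrite /= x14 (frR F2) //= f11 p; split=> //.
  apply: wp_asg => /=; rewrite x14.
    by sp; rewrite /= ?x14; apply: Rl; apply: leq_add; rewrite leq_exp2l // ltnW.
  split; first by fr.
  + by rewrite /= expnS mul2n addnn.
  + by move: T2 => /=; lia.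
- move=> s2 [F2 x14 T2]; rewrite /= x14 (frR F2) //= f11 -/k2 ltnNge kk2 /=; split=> //.
  have g13 : hr s2 13 = b by rewrite (frR F2).
  apply: wp_asg => /=; rewrite g13 x14 -/k2.
    have h1 : (b + 1) %/ k2 + 1 <= W by rewrite /W /dec_width leq_pmulr.
    have [z1 z2] : b + 1 < lim w /\ (b + 1) %/ k2 + 1 < lim w.
      by split; apply: Wl; rewrite // addn1.
    have z3 : ((b + 1) %/ k2 + 1) * k2 < lim w by apply: Wl; exact: leqnn.
    by sp; rewrite /= ?g13 ?x14 //; lia.
  apply: HQ; first by fr.
  + have F02 : frame [:: 12; 13; 14] [::] s s2 by fr.
    have [y10 y11 y17 y19] : [/\ hr s2 10 = L, hr s2 11 = k, hr s2 17 = ps & hr s2 19 = pt].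
      by rewrite !(frR F02).
    have y12 : hr s2 12 = We by rewrite (frR F2).
    by split=> //=; split.
  + move: T2 T1 => /=; have : Lk <= k by rewrite /Lk up_log_min // ltnW // ltn_expl.
    lia.
Qed.

Lemma dec_zero_wp s (Q : hst -> Prop) : dims s ->
  (forall s', frame [:: 28; 30; 32] [:: 2; 3] s s' -> hk s' <= hk s + 30 + 30 * (R * W) ->
    (forall r c, r < R -> c < W -> hm s' 2 (r * W + c) = 0) ->
    (forall r, r < R -> hm s' 3 r = 0) -> Q s') ->
  wp dec_zero s Q.
Proof.
move=> D HQ; have [e10 e11 e12 e13 [e14 e15 e17 e19]] := D.
apply: wp_seq; apply: wp_asg => /=; first by sp; rewrite /= e14; apply: Rl.
apply: wp_seq; apply: wp_asg => /=; first by sp; rewrite /= e14 e15.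
set s1 := tick _ (upr _ 30 _).
have F1 : frame [:: 28; 30; 32] [::] s s1 by rewrite /s1; fr.
have [f30 f32] : hr s1 30 = R * W /\ hr s1 32 = R by rewrite /s1 /= e14 e15.
have T1 : hk s1 = hk s + 8 by rewrite /s1 /=; lia.
clearbody s1.
apply: wp_seq.
apply: (@wp_forF w _ cm 28 30 _ s1 _ (R * W) 3 [:: 28] [:: 2] (fun i s' =>
  forall q, q < i -> hm s' 2 q = 0)) => //.
  move=> i s2 iK F2 xi I2; apply: wp_sto => //=; first exact: lim_gt0.
  split; [by fr|by []|by rewrite /=; lia|].
  move=> q /=; rewrite ltnS leq_eqVlt xi => /orP[/eqP->|qi]; first by rewrite eqxx.
  by rewrite I2 //; case: eqP.
move=> s2 F2 x2 T2 I2.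
apply: (@wp_forF w _ cm 28 32 _ s2 _ R 3 [:: 28] [:: 3] (fun i s' =>
  forall q, q < i -> hm s' 3 q = 0)) => //.
- exact: Rl.
- by rewrite (frR F2).
- move=> i s3 iK F3 xi I3; apply: wp_sto => //=; first exact: lim_gt0.
  split; [by fr|by []|by rewrite /=; lia|].
  move=> q /=; rewrite ltnS leq_eqVlt xi => /orP[/eqP->|qi]; first by rewrite eqxx.
  by rewrite I3 //; case: eqP.
move=> s3 F3 x3 T3 I3; apply: HQ => //.
- by fr.
- have : R <= R * W by rewrite leq_pmulr //; lia.
  by move: T3 T2; rewrite T1; move: (R * W) => RW; lia.
- by move=> r c rR cW; rewrite (frM F3) // I2 // ltn_flat.
Qed.

Lemma edge_off q j : q < k -> j < We -> o4 + q * We + j < lim w.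
Proof.
by move=> qk jW; apply: leq_ltn_trans ol; rewrite -addnA leq_add2l ltnW // ltn_flat.
Qed.

Lemma dec_path_wp s (Q : hst -> Prop) : dims s -> edge_bits (hm s 1) ->
  (forall r c, r < R -> c < W -> hm s 2 (r * W + c) = 0) ->
  (forall s', frame [:: 33; 34; 35; 36; 42; 43] [:: 2] s s' ->
    hk s' <= hk s + 6 + k * (60 * L + 200) ->
    (forall r c, r < R -> c < W -> hm s' 2 (r * W + c) =
       if (r < k) && (c == b) then path_bit r else 0) -> Q s') ->
  wp dec_path s Q.
Proof.
move=> D EB Z HQ; have [e10 e11 e12 e13 [e14 e15 e17 e19]] := D.
apply: (@wp_forF w _ cm 33 11 _ s _ k (60 * L + 190) [:: 33; 34; 35; 36; 42; 43] [:: 2]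
  (fun i s' => forall r c, r < R -> c < W -> hm s' 2 (r * W + c) =
       if (r < i) && (c == b) then path_bit r else 0)) => //.
- by apply: Rl; rewrite /R; lia.
- move=> i s1 ik F1 xi I1.
  have [f10 f11 f12 f13 [f14 f15 f17 f19]] := dims_frame F1 isT D.
  have f1 : hm s1 1 = hm s 1 by rewrite (frM F1).
  have [E1 E2 E3] := EB i ik.
  have ofl : o4 + i * We + (L + L) <= o4 + k * We.
    rewrite -addnA leq_add2l; apply: (@leq_trans (i.+1 * We)); last by rewrite leq_mul2r ik orbT.
    by rewrite mulSnr leq_add2l /We; lia.
  have [y1 y2 y3 y4] : [/\ L + L < lim w, L + L + (L + L) < lim w, i * We < lim w &
      L + L + (L + L) + i * We < lim w].
    by move: ofl ol; rewrite /o4; move: (i * We) (k * We) => x y; split; lia.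
  have iR : i < R by rewrite /R; lia.
  apply: wp_seq; apply: wp_asg => /=; first by sp; rewrite /= ?f10 ?xi ?f12.
  set s2 := tick _ (upr _ 34 _).
  have F2 : frame [:: 34] [::] s1 s2 by rewrite /s2; fr.
  have g34 : hr s2 34 = o4 + i * We by rewrite /s2 /= f10 xi f12.
  have g10 : hr s2 10 = L by rewrite (frR F2).
  have T2 : hk s2 = hk s1 + 12 by rewrite /s2 /=; lia.
  clearbody s2.
  have [lai lali] := lal ik; have [lbi lbli] := lbl ik.
  apply: wp_seq; apply: (@readnum_wp _ _ _ _ L (la i) (o4 + i * We)) => //.
  + by move: ofl ol; lia.
  + by move=> j jL; rewrite (frM F2) // f1 E1.
  move=> s3 F3 x35 T3.
  have F13 : frame [:: 34; 35; 42; 43] [::] s1 s3 by fr.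
  apply: wp_seq; apply: (@readnum_wp _ _ _ _ L (lb i) (o4 + i * We + L)) => //.
  + by rewrite (frR F13).
  + by rewrite /=; sp; rewrite /= (frR F3) // g34 (frR F13) // f10; move: ofl ol; lia.
  + by rewrite /= (frR F3) // g34 (frR F13) // f10.
  + by move: ofl ol; lia.
  + by move=> j jL; rewrite (frM F13) // f1 E2.
  move=> s4 F4 x36 T4.
  have F14 : frame [:: 34; 35; 36; 42; 43] [::] s1 s4 by fr.
  have x35' : hr s4 35 = la i by rewrite (frR F4).
  have [h33 h15 h13 h17 h19] : [/\ hr s4 33 = i, hr s4 15 = W, hr s4 13 = b, hr s4 17 = ps
    & hr s4 19 = pt] by rewrite !(frR F14).
  have cl : i * W + b < lim w by apply: ltn_trans RWl; apply: ltn_flat.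
  have cl2 : i * W < lim w by apply: leq_ltn_trans cl; apply: leq_addr.
  apply: wp_sto => /=.
  + by sp; rewrite /= ?h33 ?h15 ?h13.
  + have := leq_b1 (ps < la i); have := leq_b1 (ps < lb i).
    have := leq_b1 (pt < la i); have := leq_b1 (pt < lb i).
    move=> b1 b2 b3 b4; sp; rewrite /= ?h17 ?h19 ?x35' ?x36;
      clear -l2 b1 b2 b3 b4; lia.
  split=> /=.
  + by fr.
  + by rewrite (frR F14).
  + by move: T3 T4; rewrite T2 /=; lia.
  + move=> r c rR cW; rewrite h33 h15 h13 flat_inj //.
    case: (eqVneq r i) => [->|ri] /=.
      case: (eqVneq c b) => [_|cb] /=.
        by rewrite ltnSn /path_bit h17 h19 x35' x36.
      have -> : hm s4 2 = hm s1 2 by rewrite (frM F4) // (frM F3) // (frM F2).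
      by rewrite I1 // (negbTE cb) !andbF.
    have -> : hm s4 2 = hm s1 2 by rewrite (frM F4) // (frM F3) // (frM F2).
    by rewrite I1 // ltnS [in RHS]leq_eqVlt (negbTE ri).
- move=> s1 F1 x1 T1 I1; apply: HQ => //.
  by move: T1; lia.
Qed.

Lemma dec_copy_wp s (Q : hst -> Prop) : dims s -> edge_bits (hm s 1) ->
  (forall r c, r < R -> c < W -> hm s 2 (r * W + c) =
       if (r < k) && (c == b) then path_bit r else 0) ->
  (forall s', frame [:: 28; 37] [:: 2] s s' -> hk s' <= hk s + 10 + k * b * 60 ->
    (forall r c, r < R -> c < W -> hm s' 2 (r * W + c) = dec_mx r c) -> Q s') ->
  wp dec_copy s Q.
Proof.
move=> D EB Z HQ; have [e10 e11 e12 e13 [e14 e15 e17 e19]] := D.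
have kb : k * b < lim w.
  apply: leq_ltn_trans RWl; apply: leq_mul; [by rewrite /R; lia|exact: ltnW].
apply: wp_seq; apply: wp_asg => /=; first by sp; rewrite /= e11 e13.
apply: (@wp_forF w _ cm 28 37 _ _ _ (k * b) 50 [:: 28] [:: 2]
  (fun i s' => forall r c, r < R -> c < W -> hm s' 2 (r * W + c) =
       if (r < k) && (c < b) && (r * b + c < i) then ph r c else
       if (r < k) && (c == b) then path_bit r else 0)) => //.
- by rewrite /= e11 e13.
- by move=> r c rR cW /=; rewrite ltn0 andbF Z.
- move=> q s1 qk F1 xq I1.
  have F : frame [:: 28; 37] [:: 2] s s1 by fr.
  have [f10 f11 f12 f13 [f14 f15 f17 f19]] := dims_frame F isT D.
  have b0 : 0 < b by case: (b) qk; rewrite ?muln0.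
  have q1 : q %/ b < k by rewrite ltn_divLR.
  have q2 : q %% b < b by rewrite ltn_mod.
  have q3 : q %% b < W by apply: ltn_trans bW.
  have f1 : hm s1 1 = hm s 1 by rewrite (frM F).
  have [_ _ E3] := EB _ q1.
  have eo : o4 + q %/ b * We + (L + L + q %% b) < lim w.
    by apply: edge_off; rewrite // /We ltn_add2l.
  have [y1 y2 y3 y4] : [/\ L + L < lim w, L + L + (L + L) < lim w, q %/ b * We < lim w &
      L + L + (L + L) + q %/ b * We < lim w].
    by move: eo; rewrite /o4; move: (q %/ b * We) (q %% b) => x y; split; lia.
  have y5 : L + L + q %% b < lim w by move: eo; move: (q %/ b * We) (q %% b) => x y; lia.
  have qR : q %/ b < R by rewrite /R; move: (q %/ b) q1 => x; lia.
  have cl : q %/ b * W + q %% b < lim w by apply: ltn_trans RWl; apply: ltn_flat.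
  have cl2 : q %/ b * W < lim w by apply: leq_ltn_trans cl; apply: leq_addr.
  apply: wp_sto => /=.
  + by sp; rewrite /= ?xq ?f15 ?f13.
  + by sp; rewrite /= ?xq ?f15 ?f13 ?f10 ?f12.
  split=> /=; [by fr|by []|by lia|].
  move=> r c rR cW; rewrite xq f15 f13 f10 f12 f1 E3 // flat_inj //.
  case: (eqVneq r (q %/ b)) => [->|rq] /=.
    case: (eqVneq c (q %% b)) => [->|cq] /=.
      by rewrite q1 q2 -divn_eq ltnSn.
    rewrite I1 // q1 /=; case: (ltnP c b) => //= cb.
    congr (if _ then _ else _); rewrite ltnS [RHS]leq_eqVlt.
    have -> : (q %/ b * b + c == q) = false; last by [].
    by rewrite [in X in _ == X](divn_eq q b) eqn_add2l (negbTE cq).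
  rewrite I1 //; case: (ltnP c b) => cb; last by rewrite !andbF.
  congr (if _ then _ else _); congr andb; rewrite ltnS [RHS]leq_eqVlt.
  have -> : (r * b + c == q) = false; last by [].
  by rewrite [in X in _ == X](divn_eq q b) flat_inj // (negbTE rq).
- move=> s1 F1 x1 T1 I1; apply: HQ.
  + by fr.
  + by move: T1 => /=; move: (k * b) => x; lia.
  + move=> r c rR cW; rewrite I1 // /dec_mx.
    case: (ltnP r k) => //= rk; case: (ltnP c b) => //= cb.
    by rewrite ltn_flat.
Qed.

Definition tst (s : hst) c := (c == b) + \sum_(r < k2 | hm s 3 r == b) hm s 2 (r * W + c).

Definition tstall s i := all (fun c => tst s c %% 2 == 0) (iota 0 i).
Lemma tstallS s i : tstall s i.+1 = tstall s i && (tst s i %% 2 == 0).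
Proof. by rewrite /tstall -[i.+1]addn1 iotaD all_cat /= andbT. Qed.
Arguments tstall : simpl never.

Lemma dec_test_wp s (Q : hst -> Prop) : dims s -> bitmx R W (hm s 2) ->
  (forall s', hk s' <= hk s + 30 + W * (k2 * 40 + 60) ->
     hr s' 0 = ~~ tstall s W -> Q s') ->
  wp dec_test s Q.
Proof.
move=> D Mb HQ; have [e10 e11 e12 e13 [e14 e15 e17 e19]] := D.
have kR : k2 < R by rewrite /R; lia.
apply: wp_seq; apply: wp_asg => /=; first by lia.
apply: wp_seq.
apply: (@wp_forF w _ cm 39 15 _ _ _ W (k2 * 40 + 50) [:: 38; 39; 40; 41; 31] [::]
  (fun i s' => hr s' 38 = tstall s i)) => //.
- exact: Wl.
- move=> c s1 cW F1 xc I1.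
  have [f10 f11 f12 f13 [f14 f15 f17 f19]] := dims_frame F1 isT D.
  have f2 : hm s1 2 = hm s 2 by rewrite (frM F1).
  have f3 : hm s1 3 = hm s 3 by rewrite (frM F1).
  apply: wp_seq; apply: wp_asg => //=.
  rewrite xc f13.
  apply: wp_seq.
  apply: (@wp_forF w _ cm 41 14 _ _ _ k2 30 [:: 40; 41; 31] [::]
    (fun i s' => hr s' 40 = (c == b) + \sum_(r < i | hm s 3 r == b) hm s 2 (r * W + c))) => //.
  + by apply: Rl; exact: ltnW.
  + by rewrite big_ord0 addn0.
  + move=> r s2 rk F2 xr I2.
    have [g13 g15 g39] : [/\ hr s2 13 = b, hr s2 15 = W & hr s2 39 = c].
      by rewrite !(frR F2).
    have g2 : hm s2 2 = hm s 2 by rewrite (frM F2).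
    have g3 : hm s2 3 = hm s 3 by rewrite (frM F2).
    have rR : r < R by lia.
    have cl : r * W + c < lim w by apply: ltn_trans RWl; apply: ltn_flat.
    have cl2 : r * W < lim w by apply: leq_ltn_trans cl; apply: leq_addr.
    have B := Mb r c rR cW.
    have S : (c == b) + \sum_(r < r | hm s 3 r == b) hm s 2 (r * W + c) <= 1 + r.
      apply: leq_add; first by case: (c == b).
      rewrite -[leqRHS](card_ord r) -sum1_card [leqLHS]big_mkcond.
      by apply: leq_sum => x _; case: ifP => // _; apply: Mb => //; apply: ltn_trans rR.
    have SL : (c == b) + \sum_(r < r | hm s 3 r == b) hm s 2 (r * W + c) +
        hm s 2 (r * W + c) < lim w.
      have : k2 + 1 < lim w by apply: Rl; lia.
      by move: S B; move: (hm s 2 _) (_ + \sum_(_ < _ | _) _) => x y; lia.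
    have /= rec := big_ord_recr_cond r (fun r => hm s 3 r == b) (fun r => hm s 2 (r * W + c)).
    apply: wp_if => /=; first by sp.
      rewrite xr g3 g13 eqb0 negbK => pr1.
      apply: wp_asg => /=; first by sp; rewrite /= ?xr ?g15 ?g39 ?g2 ?I2.
      split=> /=; [by fr|by []|by lia|].
      by rewrite xr g15 g39 g2 I2 rec pr1 addnA.
    rewrite xr g3 g13 => /eqP; rewrite eqb0 => pr1.
    apply: wp_asg => /=; first exact: lim_gt0.
    split=> /=; [by fr|by []|by lia|].
    by rewrite I2 rec (negbTE pr1) addn0.
  move=> s2 F2 x2 T2 I2.
  have [g38 g39] : hr s2 38 = hr s1 38 /\ hr s2 39 = c by rewrite !(frR F2).
  rewrite -/(tst s c) in I2.
  apply: wp_if => /=; first by sp; lia.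
    rewrite I2 => t1; apply: wp_asg => /=; first exact: lim_gt0.
    split=> /=; [by fr|by []|by move: T2 => /=; lia|].
    by rewrite tstallS (negbTE t1) andbF.
  rewrite I2 => t1; apply: wp_asg => /=; first exact: lim_gt0.
  split=> /=; [by fr|by []|by move: T2 => /=; lia|].
  by rewrite tstallS t1 eqxx andbT g38 I1.
move=> s1 F1 x1 T1 I1; apply: wp_asg => /=; rewrite I1.
  by sp; [lia|exact: leq_b1].
apply: HQ => /=; first by move: T1 => /=; move: (k2 * 40) => y; lia.
by case: tstall.
Qed.

Definition dec_main : prog :=
  dec_dims ;; dec_zero ;; dec_path ;; dec_copy ;; reduce_prog ;; dec_test.

Definition dec_time := 60 + 20 * k + (30 + 30 * (R * W)) + (6 + k * (60 * L + 200)) +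
  (10 + k * b * 60) + (6 + k2 * (18 * W + 68) + pot tm W Lk.+1 k2) +
  (30 + W * (k2 * 40 + 60)).

Definition in_span : bool :=
  ((\row_(c < W) (c == b :> nat)%:R : 'rV['F_2]_W)%R <=
   mxF W k2 (fun r c => ((dec_mx r c)%:R)%R))%MS.

Lemma F2eq0 n : (((n%:R : 'F_2) == 0)%R) = (n %% 2 == 0).
Proof. by rewrite -val_eqE /= F2val. Qed.

Lemma F2add_eq0 (x y : 'F_2) : ((x + y == 0)%R) = (x == y).
Proof.
apply/eqP/eqP => [h|->]; last exact: F2addrr.
by rewrite -[x]addr0 -(F2addrr y) addrA h add0r.
Qed.

Lemma dec_main_wp s (Q : hst -> Prop) :
  hr s 10 = L -> hr s 11 = k -> hm s 0 2 = We -> hr s 17 = ps -> hr s 19 = pt ->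
  edge_bits (hm s 1) -> hc s = [::] -> K0 * lg k2 <= w ->
  (forall s', hk s' <= hk s + dec_time -> hr s' 0 = ~~ in_span -> Q s') ->
  wp dec_main s Q.
Proof.
move=> e10 e11 e02 e17 e19 EB Cs Kw HQ; rewrite /dec_main.
apply: wp_seq; apply: dec_dims_wp => // s1 F1 D1 T1.
have EB1 : edge_bits (hm s1 1) by rewrite (frM F1).
apply: wp_seq; apply: dec_zero_wp => // s2 F2 T2 Z2 P2.
have D2 := dims_frame F2 isT D1.
have EB2 : edge_bits (hm s2 1) by rewrite (frM F2).
apply: wp_seq; apply: dec_path_wp => // s3 F3 T3 Z3.
have D3 := dims_frame F3 isT D2.
have EB3 : edge_bits (hm s3 1) by rewrite (frM F3).
apply: wp_seq; apply: dec_copy_wp => // s4 F4 T4 Z4.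
have D4 := dims_frame F4 isT D3.
have [_ _ _ _ [g14 g15 _ _]] := D4.
have W0 : 0 < W by apply: leq_ltn_trans bW.
have Mb4 : bitmx R W (hm s4 2).
  move=> r c rR cW; rewrite Z4 // /dec_mx; case: (ltnP r k) => // rk.
  by case: (ltnP c b) => cb; [exact: phl|case: eqP => // _; rewrite ltn_mod].
have pb4 r : r < R -> hm s4 3 r < W by move=> rR; rewrite (frM F4) // (frM F3) // P2.
have C4 : hc s4 = [::] by rewrite (frC F4) (frC F3) (frC F2) (frC F1).
apply: wp_seq.
have l2' : 2 < lim w by apply: leq_trans l2.
apply: (@reduce_wp _ _ _ W Lk k2W W0 Kw l2' RWl s4) => //.
move=> s5 F5 T5 Mb5 pb5 RD SP.
have D5 := dims_frame F5 isT D4.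
apply: dec_test_wp => // s6 T6 E6; apply: HQ.
  rewrite /dec_time; move: T1 T2 T3 T4 T5 T6.
  move: (R * W) (k * (60 * L + 200)) (k * b * 60) (k2 * _) (pot _ _ _ _) (W * _).
  by clear=> *; lia.
rewrite E6; congr (nat_of_bool (~~ _)).
have -> : in_span = ((delta_mx 0%R (Ordinal bW) : 'rV['F_2]_W) <= mxF W k2 (MF W s5))%MS.
  rewrite SP /in_span; congr (_ <= _)%MS.
    by apply/rowP => c; rewrite !mxE eqxx /= -val_eqE.
  apply/matrixP => r c; rewrite !mxE.
  have rR : r < R by apply: leq_trans (ltn_ord r) _; apply: leq_addr.
  by rewrite /MF /F2m Z4.
(* In characteristic 2, a sum with the entry of the unit vector is even exactly when the two are
   equal. *)
have rect c : c < W -> (tst s5 c %% 2 == 0) =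
    (\sum_(r < k2 | hm s5 3 r == b) MF W s5 r c == (c == b)%:R)%R.
  move=> cW; rewrite -F2eq0 /tst natrD addrC F2add_eq0 natr_sum.
  by [].
have ST := @span_test R W (hm s5 3) pb5 k2 (MF W s5) (Ordinal bW) (leq_addr _ _) RD.
apply/idP/idP => [/allP h|h].
  apply/ST => c cW; apply/eqP; rewrite -rect //; apply: h; rewrite mem_iota //.
apply/allP => c; rewrite mem_iota /= add0n => cW; rewrite rect //.
by apply/eqP; move/ST: h => ->.
Qed.

End Dec.

(** * Labels as bit strings *)

Definition nbits (L x : nat) : bitseq := mkseq (fun j => odd (x %/ 2 ^ j)) L.
Definition vlab (L c p : nat) : bitseq := nbits L c ++ nbits L p.
Definition elab (L x y b : nat) (ph : nat -> bool) : bitseq :=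
  nbits L x ++ nbits L y ++ mkseq ph b.

Lemma size_nbits L x : size (nbits L x) = L. Proof. exact: size_mkseq. Qed.
Lemma size_vlab L c p : size (vlab L c p) = L + L.
Proof. by rewrite size_cat !size_nbits. Qed.
Lemma size_elab L x y b ph : size (elab L x y b ph) = L + L + b.
Proof. by rewrite !size_cat !size_nbits size_mkseq addnA. Qed.

Lemma nth_nbits L x j : j < L -> nth false (nbits L x) j = odd (x %/ 2 ^ j).
Proof. exact: nth_mkseq. Qed.

Lemma nth_vlab1 L c p j : j < L -> nth false (vlab L c p) j = odd (c %/ 2 ^ j).
Proof. by move=> jL; rewrite nth_cat size_nbits jL nth_nbits. Qed.
Lemma nth_vlab2 L c p j : j < L -> nth false (vlab L c p) (L + j) = odd (p %/ 2 ^ j).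
Proof. by move=> jL; rewrite nth_cat size_nbits ltnNge leq_addr /= addKn nth_nbits. Qed.
Lemma nth_elab1 L x y b ph j : j < L -> nth false (elab L x y b ph) j = odd (x %/ 2 ^ j).
Proof. by move=> jL; rewrite nth_cat size_nbits jL nth_nbits. Qed.
Lemma nth_elab2 L x y b ph j : j < L -> nth false (elab L x y b ph) (L + j) = odd (y %/ 2 ^ j).
Proof.
move=> jL; rewrite nth_cat size_nbits ltnNge leq_addr /= addKn.
by rewrite nth_cat size_nbits jL nth_nbits.
Qed.
Lemma nth_elab3 L x y b ph j : j < b -> nth false (elab L x y b ph) (L + L + j) = ph j.
Proof.
move=> jL; rewrite -addnA nth_cat size_nbits ltnNge leq_addr /= addKn.
by rewrite nth_cat size_nbits ltnNge leq_addr /= addKn nth_mkseq.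
Qed.

Lemma nth_flatten_const (T : Type) (x0 : T) m (ss : seq (seq T)) i j :
  all (fun s => size s == m) ss -> j < m -> i < size ss ->
  nth x0 (flatten ss) (i * m + j) = nth x0 (nth [::] ss i) j.
Proof.
move=> H jm; elim: ss i H => [//|s ss IH] [|i] /= /andP[/eqP sm H] iss.
  by rewrite mul0n add0n nth_cat sm jm.
by rewrite nth_cat sm mulSn -addnA ltnNge leq_addr /= addKn IH.
Qed.

Lemma size_flatten_const (T : Type) m (ss : seq (seq T)) :
  all (fun s => size s == m) ss -> size (flatten ss) = size ss * m.
Proof.
elim: ss => [//|s ss IH] /= /andP[/eqP sm H]; by rewrite size_cat sm IH // mulSn.
Qed.

(** Register 0 holds the number of strings, two more than the number of faults, and a vertex label
    has [2 * L] bits. Different component names mean disconnected; equal names mean connected when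
    nothing fails; only the remaining case needs linear algebra. *)
Definition dec_prog : prog :=
  10 ::= A 0 (N 0) /! N 2 ;;
  11 ::= V 0 -! N 2 ;;
  readnum 16 (N 0) ;;
  readnum 17 (V 10) ;;
  readnum 18 (V 10 +! V 10) ;;
  readnum 19 (V 10 +! V 10 +! V 10) ;;
  PIf (V 16 ==! V 18) (PIf (V 11) dec_main (0 ::= N 1)) (0 ::= N 0).

Section DecProg.
Variables (w K0 : nat) (tm : nat -> nat).
Variables (L k b cs ct ps pt : nat) (la lb : nat -> nat) (ph : nat -> nat -> bool).
Let k2 := 2 ^ up_log 2 k.
Let W := dec_width b k2.
Hypothesis L0 : 0 < L.
Hypothesis l2 : 7 < lim w.
Hypothesis RWl : 0 < k -> (k2 + k2) * W < lim w.
Hypothesis Kw : K0 * lg k2 <= w.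
Hypothesis lal : forall q, q < k -> la q < 2 ^ L.
Hypothesis lbl : forall q, q < k -> lb q < 2 ^ L.
Hypothesis Ll : 2 ^ L <= lim w.
Hypotheses (cs2 : cs < 2 ^ L) (ps2 : ps < 2 ^ L) (ct2 : ct < 2 ^ L) (pt2 : pt < 2 ^ L).

Definition query_labels : seq bitseq :=
  [:: vlab L cs ps, vlab L ct pt & [seq elab L (la q) (lb q) b (ph q) | q <- iota 0 k]].

Let fl := flatten query_labels.

Lemma nth_nat_of_bool (s : bitseq) i : nth 0 (map nat_of_bool s) i = nth false s i.
Proof. by elim: s i => [|x s IH] [|i] //=. Qed.

Let esz : all (fun s => size s == L + L + b) [seq elab L (la q) (lb q) b (ph q) | q <- iota 0 k].
Proof. by apply/allP => s /mapP[q _ ->]; rewrite size_elab. Qed.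

Lemma size_fl : size fl = (L + L) + (L + L) + k * (L + L + b).
Proof.
by rewrite /fl /= size_cat size_vlab size_cat size_vlab (size_flatten_const esz) size_map size_iota addnA.
Qed.

Lemma nth_fl_edge q j : q < k -> j < L + L + b ->
  nth false fl ((L + L) + (L + L) + q * (L + L + b) + j) =
  nth false (elab L (la q) (lb q) b (ph q)) j.
Proof.
move=> qk jb; rewrite /fl /= nth_cat size_vlab - !addnA [L + (L + _)]addnA ltnNge leq_addr /= addKn.
rewrite nth_cat size_vlab [L + (L + _)]addnA ltnNge leq_addr /= addKn.
rewrite [L + (L + b)]addnA (nth_flatten_const _ esz) ?size_map ?size_iota //.
by rewrite (nth_map 0) ?size_iota // nth_iota.
Qed.

Lemma dec_prog_wp d (Q : hst -> Prop) :
  loaded w (strings_input query_labels) d ->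
  (forall s', hk s' <= 400 + 200 * L + (if k == 0 then 0 else dec_time tm L k b) ->
     (hr s' 0 != 0) = (cs == ct) && ((k == 0) || ~~ in_span k b ps pt la lb ph) -> Q s') ->
  wp w (mmcs w K0 tm) dec_prog (hst_of (set_coins d [::])) Q.
Proof.
move=> [LR LM Lr Lm] HQ.
set s0 := hst_of _.
have C0 : hc s0 = [::] by [].
have e0 : hr s0 0 = k.+2 by rewrite /= Lr //= size_map size_map size_iota.
have esh q : q < k.+2 -> hm s0 0 q = nth 0 (shape query_labels) q.
  by move=> qk; rewrite /= Lm //= !size_map size_iota.
have e00 : hm s0 0 0 = L + L by rewrite esh //= size_vlab.
have e02 : 0 < k -> hm s0 0 2 = L + L + b.
  move=> k0; rewrite esh // /= (nth_map [::]) ?size_map ?size_iota //.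
  by rewrite (nth_map 0) ?size_iota // size_elab.
have e1 q : q < (L + L) + (L + L) + k * (L + L + b) -> hm s0 1 q = nth false fl q.
  by move=> qs; rewrite /= Lm /= ?nth_nat_of_bool // size_map -/fl size_fl.
have oll : (L + L) + (L + L) + k * (L + L + b) < lim w.
  by have := LR 1; rewrite Lr //= size_map -/fl size_fl.
have kl : k.+2 < lim w by have := LR 0; rewrite -/(lim w) -e0.
have ol0 : (L + L) + (L + L) < lim w by apply: leq_ltn_trans oll; apply: leq_addr.
have numl x : x < 2 ^ L -> x < lim w by move=> h; apply: leq_trans Ll.
have f1 j : j < L -> [/\ nth false fl j = odd (cs %/ 2 ^ j),
    nth false fl (L + j) = odd (ps %/ 2 ^ j),
    nth false fl (L + L + j) = odd (ct %/ 2 ^ j) &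
    nth false fl (L + L + L + j) = odd (pt %/ 2 ^ j)].
  move=> jL; rewrite /fl /=; split; rewrite nth_cat size_vlab.
  - by rewrite ltn_addr // nth_vlab1.
  - by rewrite ltn_add2l jL nth_vlab2.
  - rewrite ltnNge leq_addr /= addKn nth_cat size_vlab ltn_addr //.
    by rewrite nth_vlab1.
  - rewrite - !addnA [L + (L + (L + j))]addnA ltnNge leq_addr /= addKn nth_cat size_vlab.
    by rewrite ltn_add2l jL nth_vlab2.
have T0 : hk s0 = 0 by [].
clearbody s0.
have big j x : j < L -> x <= L + L + L -> x + j < (L + L) + (L + L) + k * (L + L + b).
  by move=> jL xL; apply: ltn_addr; lia.
rewrite /dec_prog.
apply: wp_seq; apply: wp_asg => /=; first by sp; lia.
apply: wp_seq; apply: wp_asg => /=; first by sp; rewrite /= ?e0; lia.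
set s1 := tick _ (upr _ 11 _).
have F1 : frame [:: 10; 11] [::] s0 s1 by rewrite /s1; fr.
have [g10 g11] : hr s1 10 = L /\ hr s1 11 = k.
  by rewrite /s1 /= e00 e0 addnn divn2 doubleK subn2.
have T1 : hk s1 = 9 by rewrite /s1 /= T0.
clearbody s1.
have l2' : 3 < lim w by lia.
apply: wp_seq; apply: (@readnum_wp _ _ _ l2 16 (N 0) _ _ L cs 0) => //.
- exact: lim_gt0.
- exact: numl.
- by lia.
- move=> j jL; rewrite add0n (frM F1) // e1; last by apply: (big j 0).
  by case: (f1 j jL) => ->.
move=> s2 F2 x2 T2.
have f210 : hr s2 10 = L by rewrite (frR F2).
apply: wp_seq; apply: (@readnum_wp _ _ _ l2 17 (V 10) _ _ L ps L) => //.
- exact: numl.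
- by lia.
- move=> j jL; rewrite (frM F2) // (frM F1) // e1; last by apply: big => //; lia.
  by case: (f1 j jL) => _ ->.
move=> s3 F3 x3 T3.
have f310 : hr s3 10 = L by rewrite (frR F3).
apply: wp_seq; apply: (@readnum_wp _ _ _ l2 18 (V 10 +! V 10) _ _ L ct (L + L)) => //.
- by rewrite /=; sp; rewrite /= f310; lia.
- by rewrite /= f310.
- exact: numl.
- by lia.
- move=> j jL; rewrite (frM F3) // (frM F2) // (frM F1) // e1; last by apply: big => //; lia.
  by case: (f1 j jL) => _ _ ->.
move=> s4 F4 x4 T4.
have f410 : hr s4 10 = L by rewrite (frR F4).
apply: wp_seq; apply: (@readnum_wp _ _ _ l2 19 (V 10 +! V 10 +! V 10) _ _ L pt (L + L + L)) => //.
- by rewrite /=; sp; rewrite /= f410; lia.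
- by rewrite /= f410.
- exact: numl.
- by lia.
- move=> j jL; rewrite (frM F4) // (frM F3) // (frM F2) // (frM F1) // e1; last by apply: big => //; lia.
  by case: (f1 j jL) => _ _ _ ->.
move=> s5 F5 x5 T5.
have F15 : frame [:: 16; 17; 18; 19; 42; 43] [::] s1 s5 by fr.
have [h10 h11] : hr s5 10 = L /\ hr s5 11 = k by rewrite !(frR F15).
have h16 : hr s5 16 = cs by rewrite (frR F5) // (frR F4) // (frR F3).
have h17 : hr s5 17 = ps by rewrite (frR F5) // (frR F4).
have h18 : hr s5 18 = ct by rewrite (frR F5).
have F05 : frame [:: 10; 11; 16; 17; 18; 19; 42; 43] [::] s0 s5 by fr.
have T15 : hk s5 <= 350 + 120 * L by move: T1 T2 T3 T4 T5 => /=; lia.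
apply: wp_if => /=; first by [].
  rewrite h16 h18 eqb0 negbK => /eqP ecs; rewrite ecs eqxx in HQ.
  apply: wp_if => /=; first by [].
    rewrite h11 => k0; have {}k0 : 0 < k by lia.
    have nk : (k == 0) = false by apply/eqP; lia.
    rewrite nk /= in HQ.
    apply: (@dec_main_wp w K0 tm l2 L k b ps pt la lb (fun q j => nat_of_bool (ph q j)) k0 (RWl k0)) => //=.
    + by move=> q qk; split; [exact: lal|apply/numl/lal].
    + by move=> q qk; split; [exact: lbl|apply/numl/lbl].
    + by move=> q j _ _; case: (ph q j).
    + by rewrite (frM F05) // e02.
    + rewrite (frM F05) // => q qk.
      have off j : j < L + L + b -> L + L + (L + L) + q * (L + L + b) + j <
          L + L + (L + L) + k * (L + L + b).
        by move=> jb; rewrite -addnA ltn_add2l ltn_flat.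
      split=> j jL.
      * rewrite e1; last by apply: off; lia.
        by rewrite nth_fl_edge ?nth_elab1 //; lia.
      * rewrite -addnA e1; last by apply: off; lia.
        by rewrite nth_fl_edge ?nth_elab2 //; lia.
      * rewrite e1; last by apply: off; lia.
        by rewrite nth_fl_edge ?nth_elab3 //; lia.
    + by rewrite (frC F05).
    move=> s6 T6 E6; apply: HQ.
      by move: T6 => /=; lia.
    by rewrite E6; case: in_span.
  rewrite h11 => k0; apply: wp_asg => /=; first by lia.
  by apply: HQ; rewrite ?k0 //=; lia.
rewrite h16 h18 => /eqP; rewrite eqb0 => ecs.
apply: wp_asg => /=; first exact: lim_gt0.
by apply: HQ; rewrite /= ?(negbTE ecs) //; lia.
Qed.

End DecProg.

(** * Spanning forests and interval tours *)

(* [par] and [rnk] are a union-find structure.  The cycles of [nxt] are the components: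
   accepting the edge [i] exchanges the successors of its ends, and [xa i], [ya i] are these
   successors.  In every later cycle the two sides of the tree edge [i] are the two arcs
   delimited by [xa i] and [ya i].  [nt i] is 1 when the edge [i] is rejected. *)
Record forest_state := Fst {
  par : nat -> nat; rnk : nat -> nat; nxt : nat -> nat;
  xa : nat -> nat; ya : nat -> nat; nt : nat -> nat }.

Definition upd (f : nat -> nat) i v := fun j => if j == i then v else f j.
(** Union by rank keeps ranks below [L], so a fixed number [L] of parent steps always ends at the
    root. There is no path compression. *)
Definition ufroot (L : nat) (p : nat -> nat) x := iter L p x.

(** A rejected edge gets two equal end points, so its interval is empty and it contributes to no
    side. *)
Definition fstep L (st : forest_state) k u v : forest_state :=
  let ru := ufroot L (par st) u in
  let rv := ufroot L (par st) v in
  if ru == rv then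
    Fst (par st) (rnk st) (nxt st) (upd (xa st) k u) (upd (ya st) k u) (upd (nt st) k 1)
  else
    Fst (if rnk st ru < rnk st rv then upd (par st) ru rv else upd (par st) rv ru)
        (if rnk st ru == rnk st rv then upd (rnk st) ru (rnk st ru).+1 else rnk st)
        (upd (upd (nxt st) u (nxt st v)) v (nxt st u))
        (upd (xa st) k (nxt st u)) (upd (ya st) k (nxt st v)) (upd (nt st) k 0).

Definition finit : forest_state :=
  Fst id (fun=> 0) id (fun=> 0) (fun=> 0) (fun=> 0).

Section Forest.
Variables (n L : nat) (U V : nat -> nat).
Hypothesis nL : n < 2 ^ L.
Hypothesis Un : forall i, U i < n.
Hypothesis Vn : forall i, V i < n.

Fixpoint forest k : forest_state :=
  if k is k'.+1 then fstep L (forest k') k' (U k') (V k') else finit.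

Notation rt st := (ufroot L (par st)).

Definition csize (f : nat -> nat) r := count (fun v => f v == r) (iota 0 n).

Record uf_inv (st : forest_state) : Prop := UfInv {
  ufP : forall v, v < n -> par st v < n;
  ufR : forall v, v < n -> par st v != v -> rnk st v < rnk st (par st v);
  ufS : forall r, r < n -> par st r = r -> 2 ^ rnk st r <= csize (rt st) r;
  ufL : forall v, v < n -> rnk st v < L
}.

Lemma iter_lt p j v : (forall v, v < n -> p v < n) -> v < n -> iter j p v < n.
Proof. by move=> H vn; elim: j => //= j; apply: H. Qed.

Lemma iter_fix (p : nat -> nat) x j : p x = x -> iter j p x = x.
Proof. by move=> px; elim: j => //= j ->. Qed.

Lemma rank_iter p rk v j : (forall v, v < n -> p v < n) ->
  (forall v, v < n -> p v != v -> rk v < rk (p v)) -> v < n ->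
  p (iter j p v) = iter j p v \/ j <= rk (iter j p v).
Proof.
move=> Hp Hr vn; elim: j => [|j [IH|IH]]; [by right|by left; rewrite /= !IH|].
have [e|e] := eqVneq (p (iter j p v)) (iter j p v); first by left; rewrite /= !e.
by right; rewrite /=; apply: leq_ltn_trans IH _; apply: Hr => //; apply: iter_lt.
Qed.

Lemma root_fix_gen p rk v : (forall v, v < n -> p v < n) ->
  (forall v, v < n -> p v != v -> rk v < rk (p v)) ->
  (forall v, v < n -> rk v < L) -> v < n -> p (ufroot L p v) = ufroot L p v.
Proof.
move=> Hp Hr Hl vn; case: (rank_iter L Hp Hr vn) => // h.
by have := Hl _ (iter_lt L Hp vn); rewrite ltnNge h.
Qed.

Lemma root_fix st v : uf_inv st -> v < n -> par st (rt st v) = rt st v.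
Proof. by case=> H1 H2 H3 H4; apply: root_fix_gen H4. Qed.

Lemma root_lt st v : uf_inv st -> v < n -> rt st v < n.
Proof. by case=> H1 _ _ _; apply: iter_lt. Qed.

Lemma root_unique p x j t : p (ufroot L p x) = ufroot L p x -> p t = t -> iter j p x = t ->
  ufroot L p x = t.
Proof.
move=> H1 H2 H3; have := iter_fix j H1; rewrite -iterD addnC iterD H3.
by move=> <-; apply: iter_fix.
Qed.

Lemma link_iter (p : nat -> nat) l w' j x r : iter j p x = r -> p r = r -> p l = l ->
  exists i, iter i (upd p l w') x = (if r == l then w' else r).
Proof.
move=> H pr pl; elim: j x H => [|j IH] x; rewrite ?iterSr /=.
  move=> ->; case: eqP => [->|_]; last by exists 0.
  by exists 1; rewrite /= /upd eqxx.
move=> H; case: (eqVneq x l) => [xl|xl].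
  exists 1; rewrite /= /upd xl eqxx.
  by rewrite xl pl iter_fix // in H; rewrite -H eqxx.
have [i Hi] := IH _ H; exists i.+1; rewrite iterSr.
by rewrite {2}/upd (negbTE xl).
Qed.

Section Link.
Variables (st : forest_state) (l w' : nat) (rk' : nat -> nat).
Hypotheses (I : uf_inv st) (ln : l < n) (wn : w' < n) (lw : l != w').
Hypotheses (pl : par st l = l) (pw : par st w' = w').
Hypothesis rk'E : forall v, v != w' -> rk' v = rnk st v.
Hypothesis rk'w : (rk' w' = rnk st w' /\ rnk st l < rnk st w') \/
  (rk' w' = (rnk st w').+1 /\ rnk st l = rnk st w').
Let p' := upd (par st) l w'.
Let st' := Fst p' rk' (nxt st) (xa st) (ya st) (nt st).

Let p'n v : v < n -> p' v < n.
Proof. by move=> vn; rewrite /p' /upd; case: eqP => // _; apply: (ufP I). Qed.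

Let rkle v : rnk st v <= rk' v.
Proof. by case: (eqVneq v w') => [->|vw]; [case: rk'w => [[-> _]|[-> _]]|rewrite rk'E]. Qed.

Let p'r v : v < n -> p' v != v -> rk' v < rk' (p' v).
Proof.
move=> vn; rewrite /p' /upd; case: (v =P l) => [-> _|/eqP vl].
  by rewrite rk'E //; case: rk'w => [[-> //]|[-> ->]].
move=> pv; have vw : v != w' by apply: contra pv => /eqP->; rewrite pw.
by rewrite rk'E //; apply: leq_trans (rkle _); apply: (ufR I).
Qed.

(** The assumption that [L] steps end at a root of the new structure is discharged later, once its
    ranks are known to stay below [L]. *)
Let ufroot'_gen v : v < n -> p' (ufroot L p' v) = ufroot L p' v ->
  ufroot L p' v = if rt st v == l then w' else rt st v.
Proof.
move=> vn H.
have [i Hi] := @link_iter (par st) l w' L v _ erefl (root_fix I vn) pl.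
apply: root_unique H _ Hi; rewrite /p' /upd.
case: (rt st v =P l) => [_|/eqP rl]; first by rewrite eq_sym (negbTE lw).
by rewrite (negbTE rl) root_fix.
Qed.

Let csz : 2 ^ rk' w' <= csize (rt st) w' + csize (rt st) l.
Proof.
have h1 := ufS I wn pw; have h2 := ufS I ln pl.
case: rk'w => [[e _]|[e e']]; rewrite e; first by apply: leq_trans h1 (leq_addr _ _).
by rewrite expnS mul2n -addnn; apply: leq_add => //; rewrite -e'.
Qed.

Let csize' r (p : nat -> nat) : (forall v, v < n -> p v = if rt st v == l then w' else rt st v) ->
  r != l -> csize p r = if r == w' then csize (rt st) w' + csize (rt st) l else csize (rt st) r.
Proof.
move=> H rl; rewrite /csize.
have E : {in iota 0 n, (fun v => p v == r) =1
    (fun v => (rt st v == r) || ((r == w') && (rt st v == l)))}.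
  move=> v; rewrite mem_iota /= add0n => vn; rewrite H //.
  case: (rt st v =P l) => [->|_]; last by rewrite andbF orbF.
  by rewrite [l == r]eq_sym (negbTE rl) andbT eq_sym.
rewrite (eq_in_count E); case: (eqVneq r w') => [->|rw] /=.
  have cI : count (predI (fun v => rt st v == w') (fun v => rt st v == l)) (iota 0 n) = 0.
    rewrite (eq_count (a2 := pred0)) ?count_pred0 // => v /=.
    by case: eqP => //= ->; rewrite eq_sym (negbTE lw).
  by rewrite -count_predUI cI addn0.
by apply: eq_count => v /=; rewrite orbF.
Qed.

Let rk'L v : v < n -> rk' v < L.
Proof.
move=> vn; case: (eqVneq v w') => [->|vw]; last by rewrite rk'E // (ufL I).
rewrite -(ltn_exp2l (m := 2)) //; apply: leq_ltn_trans nL; apply: leq_trans csz _.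
have cI : count (predI (fun v => rt st v == w') (fun v => rt st v == l)) (iota 0 n) = 0.
  rewrite (eq_count (a2 := pred0)) ?count_pred0 // => x /=.
  by case: eqP => //= ->; rewrite eq_sym (negbTE lw).
rewrite /csize -count_predUI cI addn0 -[leqRHS](size_iota 0); exact: count_size.
Qed.

Lemma link_root v : v < n -> ufroot L p' v = if rt st v == l then w' else rt st v.
Proof.
move=> vn; apply: ufroot'_gen => //; exact: (root_fix_gen (rk := rk')).
Qed.

Lemma link_inv : uf_inv st'.
Proof.
split=> //= r rn pr.
have rl : r != l.
  apply/eqP => e; move: pr; rewrite e /p' /upd eqxx => h.
  by have := lw; rewrite h eqxx.
rewrite (csize' link_root rl); case: (eqVneq r w') => [->|rw]; first exact: csz.
by rewrite rk'E //; apply: (ufS I) => //; move: pr; rewrite /p' /upd (negbTE rl).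
Qed.

End Link.

Lemma uf_inv_ext st st2 : par st2 = par st -> rnk st2 = rnk st -> uf_inv st -> uf_inv st2.
Proof. by case: st st2 => ? ? ? ? ? ? [? ? ? ? ? ?] /= -> -> [H1 H2 H3 H4]; split. Qed.

Lemma fstep_uf st k u v : uf_inv st -> u < n -> v < n -> rt st u != rt st v ->
  uf_inv (fstep L st k u v) /\
  exists l w', [/\ (l == rt st u) && (w' == rt st v) || (l == rt st v) && (w' == rt st u) &
    forall x, x < n -> rt (fstep L st k u v) x = if rt st x == l then w' else rt st x].
Proof.
move=> I un vn uv; rewrite /fstep (negbTE uv).
have ru := root_lt I un; have rv := root_lt I vn.
have pu := root_fix I un; have pv := root_fix I vn.
case: (ltnP (rnk st (rt st u)) (rnk st (rt st v))) => h.
  have ne : (rnk st (rt st u) == rnk st (rt st v)) = false by apply/eqP; lia.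
  rewrite ne; split.
    apply: uf_inv_ext (@link_inv st _ _ (rnk st) I ru rv uv pu pv _ _) => //.
    by left.
  exists (rt st u), (rt st v); rewrite !eqxx; split=> // x xn.
  by apply: (@link_root st _ _ (rnk st)) => //; left.
set rk' := (if _ == _ then _ else _).
have vu : rt st v != rt st u by rewrite eq_sym.
have E1 x : x != rt st u -> rk' x = rnk st x.
  by move=> xu; rewrite /rk' /upd; case: ifP => // _; rewrite (negbTE xu).
have E2 : (rk' (rt st u) = rnk st (rt st u) /\ rnk st (rt st v) < rnk st (rt st u)) \/
  (rk' (rt st u) = (rnk st (rt st u)).+1 /\ rnk st (rt st v) = rnk st (rt st u)).
  rewrite /rk' /upd; case: (rnk st (rt st u) =P rnk st (rt st v)) => e; rewrite ?eqxx; [right|left]; split=> //; lia.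
split.
  exact: uf_inv_ext (@link_inv st _ _ rk' I rv ru vu pv pu E1 E2).
exists (rt st v), (rt st u); rewrite !eqxx orbT; split=> // x xn.
exact: (@link_root st _ _ rk').
Qed.

(** Connectivity is stated dually: [cH] says that each component is one cycle of [nxt], and [cT]
    that the accepted edges connect each component. [cG] provides the indicator of one side of an
    accepted edge: along the cycles it switches on entering [xa i] and [ya i], and among accepted
    edges only across [i]. *)
Record cyc_inv (k : nat) (st : forest_state) : Prop := CycInv {
  cN : forall x, x < n -> nxt st x < n;
  cI : forall x y, x < n -> y < n -> nxt st x = nxt st y -> x = y;
  cR : forall x, x < n -> rt st (nxt st x) = rt st x;
  cH : forall h : nat -> bool, (forall x, x < n -> h (nxt st x) = h x) ->
    forall x y, x < n -> y < n -> rt st x = rt st y -> h x = h y;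
  cT : forall h : nat -> bool, (forall i, i < k -> nt st i = 0 -> h (U i) = h (V i)) ->
    forall x y, x < n -> y < n -> rt st x = rt st y -> h x = h y;
  cE : forall i, i < k -> rt st (U i) = rt st (V i);
  cX : forall i, i < k -> [/\ xa st i < n, ya st i < n, nt st i < 2 &
    nt st i = 1 -> xa st i = ya st i];
  cG : forall i, i < k -> nt st i = 0 -> exists g : nat -> bool,
    (forall x, x < n -> g x (+) g (nxt st x) = (nxt st x == xa st i) (+) (nxt st x == ya st i)) /\
    (forall j, j < k -> nt st j = 0 -> g (U j) (+) g (V j) = (i == j))
}.

Lemma init_uf : uf_inv finit.
Proof.
split=> //=; first by move=> v; rewrite eqxx.
- move=> r rn _; rewrite expn0 -has_count; apply/hasP; exists r; first by rewrite mem_iota.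
  by rewrite /ufroot iter_fix.
- move=> v vn; case: (L) nL => //; rewrite expn0; lia.
Qed.

Lemma init_cyc : cyc_inv 0 finit.
Proof.
have r0 x : rt finit x = x by rewrite /ufroot iter_fix.
by split=> // [h _ x y _ _|h _ x y _ _]; rewrite !r0 => ->.
Qed.

Lemma addb_switch a b c d : (a (+) b (+) (c (+) d)) = (a (+) c) (+) (b (+) d).
Proof. by case: a; case: b; case: c; case: d. Qed.

(* [f] permutes each class, so the sum of [h x + h (f x)] over the class of [u] is 0. *)
Lemma class_sum (f : nat -> nat) (rr : nat -> nat) (h : nat -> bool) u :
  (forall x, x < n -> f x < n) ->
  (forall x y, x < n -> y < n -> f x = f y -> x = y) ->
  (forall x, x < n -> rr (f x) = rr x) -> u < n ->
  (forall x, x < n -> x != u -> rr x = rr u -> h (f x) = h x) -> h (f u) = h u.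
Proof.
move=> fn fi fr un H.
pose fo (x : 'I_n) : 'I_n := Ordinal (fn x (ltn_ord x)).
have foi : injective fo.
  by move=> x y /(congr1 val) /= /(fi _ _ (ltn_ord x) (ltn_ord y)) /val_inj.
have E : \big[addb/false]_(x : 'I_n | rr x == rr u) h x =
   \big[addb/false]_(x : 'I_n | rr x == rr u) h (f x).
  rewrite (reindex_inj foi) /=; apply: eq_bigl => x; by rewrite fr.
rewrite (bigD1 (Ordinal un)) //= [RHS](bigD1 (Ordinal un)) //= in E.
have E2 : \big[addb/false]_(x : 'I_n | (rr x == rr u) && (x != Ordinal un)) h (f x) =
   \big[addb/false]_(x : 'I_n | (rr x == rr u) && (x != Ordinal un)) h x.
  apply: eq_bigr => x /andP[/eqP e ne]; exact: H.
by rewrite E2 in E; move: E; case: (h u); case: (h (f u)); case: (\big[_/_]_(_ | _) _).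
Qed.

Lemma fstep_same st k u v : rt st u = rt st v ->
  fstep L st k u v = Fst (par st) (rnk st) (nxt st) (upd (xa st) k u) (upd (ya st) k u) (upd (nt st) k 1).
Proof. by move=> e; rewrite /fstep e eqxx. Qed.

Lemma upd_lt f k v i : i < k -> upd f k v i = f i.
Proof. by move=> ik; rewrite /upd; case: eqP => // e; rewrite e ltnn in ik. Qed.

Lemma upd_eq f k v : upd f k v k = v. Proof. by rewrite /upd eqxx. Qed.

Lemma fstep_cyc_same st k : uf_inv st -> cyc_inv k st -> rt st (U k) = rt st (V k) ->
  cyc_inv k.+1 (fstep L st k (U k) (V k)).
Proof.
move=> I C e; rewrite fstep_same //; split=> /=; try by case: C.
- move=> h H; apply: (cT C) => i ik ni; apply: H; first exact: ltnW.
  by rewrite upd_lt.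
- by move=> i; rewrite ltnS leq_eqVlt => /orP[/eqP->|/(cE C)].
- move=> i; rewrite ltnS leq_eqVlt => /orP[/eqP->|ik].
    by rewrite !upd_eq; split.
  by rewrite !upd_lt //; apply: (cX C).
- move=> i; rewrite ltnS leq_eqVlt => /orP[/eqP->|ik]; first by rewrite upd_eq.
  rewrite !upd_lt // => ni; have [g [g1 g2]] := cG C ik ni.
  exists g; split=> // j; rewrite ltnS leq_eqVlt => /orP[/eqP->|jk]; first by rewrite upd_eq.
  by rewrite upd_lt //; apply: g2.
Qed.

Lemma fstep_cyc_link st k : uf_inv st -> cyc_inv k st -> rt st (U k) != rt st (V k) ->
  cyc_inv k.+1 (fstep L st k (U k) (V k)).
Proof.
move=> I C uv; have [I' [l [w' [lw RT]]]] := fstep_uf k I (Un k) (Vn k) uv.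
set u := U k in uv lw RT I' *; set v := V k in uv lw RT I' *.
have un : u < n by apply: Un.
have vn : v < n by apply: Vn.
set st' := fstep L st k u v in RT I' *.
have nuv : u != v by apply: contra uv => /eqP->.
have nE : nxt st' = upd (upd (nxt st) u (nxt st v)) v (nxt st u) by rewrite /st' /fstep (negbTE uv).
have xE : xa st' = upd (xa st) k (nxt st u) by rewrite /st' /fstep (negbTE uv).
have yE : ya st' = upd (ya st) k (nxt st v) by rewrite /st' /fstep (negbTE uv).
have tE : nt st' = upd (nt st) k 0 by rewrite /st' /fstep (negbTE uv).
have nu : nxt st' u = nxt st v by rewrite nE /upd (negbTE nuv) eqxx.
have nv : nxt st' v = nxt st u by rewrite nE /upd eqxx.
have no x : x != u -> x != v -> nxt st' x = nxt st x.
  by move=> xu xv; rewrite nE /upd (negbTE xu) (negbTE xv).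
have same x y : x < n -> y < n -> rt st x = rt st y -> rt st' x = rt st' y.
  by move=> xn yn e; rewrite !RT // e.
have uv' : rt st' u = rt st' v.
  rewrite !RT //; case/orP: lw => /andP[/eqP-> /eqP->]; rewrite eqxx.
    by rewrite eq_sym (negbTE uv).
  by rewrite (negbTE uv).
have back x y : x < n -> y < n -> rt st' x = rt st' y ->
  rt st x = rt st y \/ ((rt st x = rt st u /\ rt st y = rt st v) \/ (rt st x = rt st v /\ rt st y = rt st u)).
  move=> xn yn; rewrite !RT //.
  case/orP: lw => /andP[/eqP-> /eqP->].
    case: (rt st x =P rt st u) => [ex|_]; case: (rt st y =P rt st u) => [ey|_] e.
    - by left; rewrite ex.
    - by right; left.
    - by right; right.
    - by left.
  case: (rt st x =P rt st v) => [ex|_]; case: (rt st y =P rt st v) => [ey|_] e.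
  - by left; rewrite ex.
  - by right; right.
  - by right; left.
  - by left.
(* Exchanging two successors is precomposition with a transposition, so injectivity of the successor
   carries over. *)
pose sw x := if x == u then v else if x == v then u else x.
have swE x : nxt st' x = nxt st (sw x).
  rewrite /sw; case: (eqVneq x u) => [->//|xu]; case: (eqVneq x v) => [->//|xv]; exact: no.
have swn x : x < n -> sw x < n by rewrite /sw; case: (x == u) => //; case: (x == v).
have swK x : sw (sw x) = x.
  rewrite /sw; case: (eqVneq x u) => [->|xu]; first by rewrite eq_sym (negbTE nuv) eqxx.
  case: (eqVneq x v) => [->|xv]; first by rewrite eqxx.
  by rewrite (negbTE xu) (negbTE xv).
have csame : forall x, x < n -> rt st' (nxt st' x) = rt st' x.
  move=> x xn; rewrite swE /sw.
  case: (eqVneq x u) => [->|xu].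
    by rewrite uv'; apply: same => //; [apply: (cN C)|apply: (cR C)].
  case: (eqVneq x v) => [->|xv].
    by rewrite -uv'; apply: same => //; [apply: (cN C)|apply: (cR C)].
  by apply: same => //; [apply: (cN C)|apply: (cR C)].
have xk i : i < k -> xa st' i = xa st i by move=> ik; rewrite xE upd_lt.
have yk i : i < k -> ya st' i = ya st i by move=> ik; rewrite yE upd_lt.
have tk i : i < k -> nt st' i = nt st i by move=> ik; rewrite tE upd_lt.
have hsplit h x y : (forall x y, x < n -> y < n -> rt st x = rt st y -> h x = h y) ->
    h u = h v -> x < n -> y < n -> rt st' x = rt st' y -> h x = h y :> bool.
  move=> H huv xn yn /(back _ _ xn yn)[e|[[e1 e2]|[e1 e2]]]; first exact: H.
  - by rewrite (H x u) // huv (H v y).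
  - by rewrite (H x v) // -huv (H u y).
have unu : nxt st u <> nxt st v by move/(cI C) => h; move: nuv; rewrite h ?eqxx.
split=> //.
- by move=> x xn; rewrite swE; apply: (cN C); apply: swn.
- by move=> x y xn yn; rewrite !swE => /(cI C) h; rewrite -(swK x) h ?swK ?swn.
- move=> h H x y.
  have e1 : h (nxt st u) = h v by rewrite -nv H.
  have e2 : h (nxt st v) = h u by rewrite -nu H.
  (* On the class of [u] the old and the new successor differ only at [u], and invariance everywhere
     else in the class forces it there. *)
  have e3 : h (nxt st u) = h u.
    apply: (class_sum (f := nxt st) (rr := rt st)) => //; [exact: cN C|exact: cI C|exact: cR C|].
    move=> z zn zu zr; rewrite -no //; first exact: H.
    by apply/eqP => zv; move: zr uv; rewrite zv => ->; rewrite eqxx.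
  have huv : h u = h v by rewrite -e3.
  apply: hsplit => //; apply: (cH C) => z zn.
  case: (eqVneq z u) => [->//|zu]; case: (eqVneq z v) => [->|zv]; first by rewrite e2.
  by rewrite -no ?H.
- move=> h H x y.
  have huv : h u = h v by apply: H => //; rewrite tE upd_eq.
  apply: hsplit => //; apply: (cT C) => i ik ni; apply: H; first exact: ltnW.
  by rewrite tk.
- move=> i; rewrite ltnS leq_eqVlt => /orP[/eqP->//|ik].
  by apply: same => //; apply: (cE C).
- move=> i; rewrite ltnS leq_eqVlt => /orP[/eqP->|ik].
    by rewrite xE yE tE !upd_eq; split=> //; apply: (cN C).
  by rewrite xk ?yk ?tk //; apply: (cX C).
- move=> i; rewrite ltnS leq_eqVlt => /orP[/eqP-> _|ik].
    (* The two sides of the new edge are the two components that it joins. *)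
    exists (fun x => rt st x == rt st v); split.
      move=> x xn; rewrite xE yE !upd_eq.
      case: (eqVneq x u) => [->|xu].
        rewrite nu (cR C) // eqxx (negbTE uv); have /eqP/negbTE -> : nxt st v <> nxt st u by move/esym.
        by rewrite eqxx.
      case: (eqVneq x v) => [->|xv].
        rewrite nv (cR C) // eqxx (negbTE uv); have /eqP/negbTE -> := unu.
        by rewrite eqxx.
      rewrite no // (cR C) // addbb; symmetry.
      have -> : (nxt st x == nxt st u) = false.
        by apply/eqP => /(cI C) h; move: xu; rewrite h ?eqxx.
      have -> // : (nxt st x == nxt st v) = false.
      by apply/eqP => /(cI C) h; move: xv; rewrite h ?eqxx.
    move=> j; rewrite ltnS leq_eqVlt => /orP[/eqP->|jk].
      by rewrite -/u -/v !eqxx (negbTE uv).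
    rewrite (cE C) // addbb => _; symmetry; apply/eqP; lia.
  rewrite tk // => ni; have [g [g1 g2]] := cG C ik ni.
  (* Adding the constant [c] on the component of [v] makes the function agree across the new edge
     and preserves all its switches within either component. *)
  pose c := g u (+) g v.
  exists (fun x => g x (+) ((rt st x == rt st v) && c)); split.
    move=> x xn; rewrite xk ?yk //.
    case: (eqVneq x u) => [->|xu].
      rewrite nu (cR C) // eqxx (negbTE uv) /= addbF -g1 // /c.
      by case: (g u); case: (g v); case: (g (nxt st v)).
    case: (eqVneq x v) => [->|xv].
      rewrite nv (cR C) // eqxx (negbTE uv) /= addbF -g1 // /c.
      by case: (g u); case: (g v); case: (g (nxt st u)).
    by rewrite no // (cR C) // addb_switch addbb addbF g1.
  move=> j; rewrite ltnS leq_eqVlt => /orP[/eqP-> _|jk].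
    rewrite -/u -/v eqxx (negbTE uv) /= addbF /c.
    have -> : (i == k) = false by apply/eqP; lia.
    by case: (g u); case: (g v).
  rewrite tk // => nj; rewrite (cE C jk) addb_switch addbb addbF; exact: g2.
Qed.

Lemma forest_inv k : uf_inv (forest k) /\ cyc_inv k (forest k).
Proof.
elim: k => [|k [I C]]; first by split; [exact: init_uf|exact: init_cyc].
case: (eqVneq (rt (forest k) (U k)) (rt (forest k) (V k))) => [e|ne].
  split; last exact: fstep_cyc_same.
  by rewrite /= fstep_same //; apply: uf_inv_ext I.
by split; [case: (fstep_uf k I (Un k) (Vn k) ne)|exact: fstep_cyc_link].
Qed.

Lemma forest_stable i k : i < k -> [/\ nt (forest k) i = nt (forest i.+1) i,
  xa (forest k) i = xa (forest i.+1) i & ya (forest k) i = ya (forest i.+1) i].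
Proof.
elim: k => [//|k IH]; rewrite ltnS leq_eqVlt => /orP[/eqP->//|ik].
have [<- <- <-] := IH ik; rewrite [forest k.+1]/= /fstep.
by case: ifP => _ /=; rewrite !upd_lt.
Qed.

End Forest.

(** * The tour of all vertices, and sides as intervals *)

Section ForestLabels.
Variables (n m L : nat) (u0 v0 : nat -> nat).
Hypothesis n0 : 0 < n.
Hypothesis nL : n < 2 ^ L.
Hypothesis u0n : forall i, i < m -> u0 i < n.
Hypothesis v0n : forall i, i < m -> v0 i < n.

(* The edges after the first [m] are virtual: they join all the cycles into one. *)
Definition Ue i := if i < m then u0 i else 0.
Definition Ve i := if i < m then v0 i else if i - m < n then i - m else 0.

Let Un i : Ue i < n. Proof. by rewrite /Ue; case: ifP => // /u0n. Qed.
Let Vn i : Ve i < n. Proof. by rewrite /Ve; case: ifP => [/v0n//|_]; case: ifP. Qed.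

Definition forestm k := forest L Ue Ve k.
Definition vcomp v := ufroot L (par (forestm m)) v.
Definition cyc := nxt (forestm (m + n)).
Definition tour := traject cyc 0 n.
Definition pos v := index v tour.
Definition lowp i := pos (xa (forestm (m + n)) i).
Definition highp i := pos (ya (forestm (m + n)) i).
Definition nontree i := nt (forestm (m + n)) i.
(** The cyclic tour is cut open at vertex 0. Exclusive or makes the order of the two end points
    immaterial, and which of the two arcs is meant never matters. *)
Definition side i v := (pos v < lowp i) (+) (pos v < highp i).

Let If := forest_inv nL Un Vn (m + n).
Let Im := forest_inv nL Un Vn m.

Let cycn x : x < n -> cyc x < n. Proof. exact: (cN (proj2 If)). Qed.

Let all_joined x : x < n -> ufroot L (par (forestm (m + n))) x = ufroot L (par (forestm (m + n))) 0.
Proof.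
move=> xn; have := cE (proj2 If) (i := m + x).
have hm : (m + x < m) = false by apply/negbTE; rewrite -leqNgt leq_addr.
by rewrite ltn_add2l /Ue /Ve hm addKn xn => /(_ isT)/esym.
Qed.

Let cyco (x : 'I_n) : 'I_n := Ordinal (cycn (ltn_ord x)).
Let cycoI : injective cyco.
Proof. by move=> x y /(congr1 val) /= /(cI (proj2 If) (ltn_ord x) (ltn_ord y)) /val_inj. Qed.
Let o0 : 'I_n := Ordinal n0.

Let cyco_conn x : fconnect cyco o0 x.
Proof.
(* Reachability from 0 along the tour is invariant under [nxt], hence constant, because the virtual
   edges leave a single component. *)
pose h z := if insub z is Some y then fconnect cyco o0 y else false.
have hE (y : 'I_n) : h y = fconnect cyco o0 y by rewrite /h valK.
rewrite -hE -(cH (proj2 If) (h := h) _ n0 (ltn_ord x)).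
- by rewrite -[0]/(val o0) hE connect0.
- move=> z zn; rewrite -[z]/(val (Ordinal zn)) -[nxt _ _]/(val (cyco (Ordinal zn))) !hE.
  by apply/esym/same_fconnect1_r.
- by symmetry; apply: all_joined.
Qed.

Let tourE : tour = map val (fingraph.orbit cyco o0).
Proof.
have on : fingraph.order cyco o0 = n.
  rewrite /fingraph.order -[RHS](card_ord n); apply: eq_card => x; exact: cyco_conn.
rewrite /fingraph.orbit on /tour.
have gen k x : traject cyc (val x) k = map val (traject cyco x k).
  by elim: k x => //= k IH x; rewrite -IH.
exact: (gen n o0).
Qed.

Lemma tour_uniq : uniq tour.
Proof. by rewrite tourE map_inj_uniq ?orbit_uniq //; apply: val_inj. Qed.

Lemma mem_tour v : (v \in tour) = (v < n).
Proof.
rewrite tourE; apply/mapP/idP => [[x _ ->]|vn]; first exact: ltn_ord.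
by exists (Ordinal vn) => //; rewrite -fconnect_orbit cyco_conn.
Qed.

Lemma size_tour : size tour = n. Proof. exact: size_traject. Qed.

Lemma pos_lt v : v < n -> pos v < n.
Proof. by move=> vn; rewrite -size_tour index_mem mem_tour. Qed.

Lemma pos_iter j : j < n -> pos (iter j cyc 0) = j.
Proof.
move=> jn; rewrite /pos -(nth_traject _ jn) index_uniq ?size_tour //; exact: tour_uniq.
Qed.

Lemma iter_pos v : v < n -> iter (pos v) cyc 0 = v.
Proof.
by move=> vn; rewrite -(nth_traject _ (pos_lt vn)) nth_index // mem_tour.
Qed.

Lemma pos_inj x y : x < n -> y < n -> (pos x == pos y) = (x == y).
Proof.
move=> xn yn; apply/eqP/eqP => [e|->//].
by rewrite -(iter_pos xn) e iter_pos.
Qed.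

Lemma xa_lt i : i < m + n -> xa (forestm (m + n)) i < n /\ ya (forestm (m + n)) i < n.
Proof. by move=> im; have [] := cX (proj2 If) im. Qed.

Lemma low_lt i : i < m -> lowp i < n /\ highp i < n.
Proof. by move=> im; have [h1 h2] := xa_lt (ltn_addr n im); split; apply: pos_lt. Qed.

Lemma nontree_lt i : i < m -> nontree i < 2.
Proof. by move=> im; have [] := cX (proj2 If) (ltn_addr n im). Qed.

Lemma nontree_same i : i < m -> nontree i = 1 -> lowp i = highp i.
Proof. by move=> im h; have [_ _ _ /(_ h) e] := cX (proj2 If) (ltn_addr n im); rewrite /lowp e. Qed.

Lemma comp_lt v : v < n -> vcomp v < n.
Proof. by move=> vn; apply: (root_lt (proj1 Im)). Qed.

Lemma ltb_succ j a : (j < a) (+) (j.+1 < a) = (j.+1 == a).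
Proof. by case: (ltngtP j.+1 a). Qed.

(** Along the tour [side i] switches at the same steps as the function given by [cG], so the two
    differ by a constant, which cancels between the ends of [j]. *)
Lemma side_tree i j : i < m -> j < m -> nontree i = 0 -> nontree j = 0 ->
  side i (u0 j) (+) side i (v0 j) = (i == j).
Proof.
move=> im jm ti tj; have [g [g1 g2]] := cG (proj2 If) (ltn_addr n im) ti.
have [xn yn] := xa_lt (ltn_addr n im).
have H k : k < n -> side i (iter k cyc 0) (+) g (iter k cyc 0) = side i 0 (+) g 0.
  elim: k => [//|k IH] kn; rewrite -IH; last exact: ltnW.
  have zn : iter k cyc 0 < n by apply: iter_lt.
  have := g1 _ zn; rewrite -/(cyc _) -iterS.
  have zn' : iter k.+1 cyc 0 < n by apply: iter_lt.
  rewrite -(pos_inj zn' xn) -(pos_inj zn' yn) -/(lowp i) -/(highp i) pos_iter // - !ltb_succ.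
  rewrite /side !pos_iter //; last exact: ltnW.
  move: (g _) (g _) => a b.
  by case: a; case: b; case: (k < _); case: (k < _); case: (_ < _); case: (_ < _).
have H' x : x < n -> side i x = side i 0 (+) g 0 (+) g x.
  move=> xn'; have := H (pos x) (pos_lt xn'); rewrite iter_pos // => <-.
  by case: (side _ _); case: (g x).
have := g2 j (ltn_addr n jm) tj; rewrite /Ue /Ve jm => <-.
rewrite (H' (u0 j)) ?u0n // (H' (v0 j)) ?v0n //.
by case: (side _ _); case: (g 0); case: (g (u0 j)); case: (g (v0 j)).
Qed.

Lemma side_nontree i v : i < m -> nontree i = 1 -> side i v = false.
Proof. by move=> im h; rewrite /side (nontree_same im h) addbb. Qed.

(** The flag of an edge is fixed when the edge is processed, so the flags after the virtual edges
    are still those that describe the forest of the real graph. *)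
Lemma comp_tree (h : nat -> bool) x y :
  (forall i, i < m -> nontree i = 0 -> h (u0 i) = h (v0 i)) ->
  x < n -> y < n -> vcomp x = vcomp y -> h x = h y.
Proof.
move=> H xn yn; apply: (cT (proj2 Im)) => // i im ni.
rewrite /Ue /Ve im; apply: H => //; rewrite /nontree /forestm.
have [-> _ _] := forest_stable L Ue Ve (ltn_addr n im).
by have [<- _ _] := forest_stable L Ue Ve im.
Qed.

Lemma comp_edge i : i < m -> vcomp (u0 i) = vcomp (v0 i).
Proof. by move=> im; have := cE (proj2 Im) im; rewrite /Ue /Ve im. Qed.

End ForestLabels.

(** * The encoder *)

Definition find_prog (x y : nat) : prog := x ::= V y ;; PFor 28 13 (x ::= A 4 (V x)).

Definition step_prog : prog :=
  24 ::= A 10 (V 23) ;; 25 ::= A 11 (V 23) ;;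
  find_prog 26 24 ;; find_prog 27 25 ;;
  PIf (V 26 ==! V 27)
    (PSto 7 (V 23) (V 24) ;; PSto 8 (V 23) (V 24) ;; PSto 9 (V 23) (N 1))
    (29 ::= A 6 (V 24) ;; 30 ::= A 6 (V 25) ;;
     PSto 7 (V 23) (V 29) ;; PSto 8 (V 23) (V 30) ;; PSto 9 (V 23) (N 0) ;;
     PSto 6 (V 24) (V 30) ;; PSto 6 (V 25) (V 29) ;;
     32 ::= A 5 (V 26) ;; 33 ::= A 5 (V 27) ;;
     PIf (V 32 <! V 33) (PSto 4 (V 26) (V 27)) (PSto 4 (V 27) (V 26)) ;;
     PIf (V 32 ==! V 33) (PSto 5 (V 26) (V 32 +! N 1)) (31 ::= N 0)).

Definition agree (n k : nat) (st : forest_state) (s : hst) : Prop :=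
  [/\ forall v, v < n -> hm s 4 v = par st v, forall v, v < n -> hm s 5 v = rnk st v,
      forall v, v < n -> hm s 6 v = nxt st v &
      forall i, i < k -> [/\ hm s 7 i = xa st i, hm s 8 i = ya st i & hm s 9 i = nt st i]].

Lemma eq_dbl x y : (x + x == y + y) = (x == y).
Proof. by apply/eqP/eqP; lia. Qed.

Section Enc.
Variables (w n m L b : nat) (u0 v0 : nat -> nat).
Notation wp := (wp w nocall).
Let cm := @nocall_mono.
Hypothesis n0 : 0 < n.
Hypothesis nL : n < 2 ^ L.
Hypothesis Ln : 2 ^ L <= n + n.
Hypothesis L0 : 0 < L.
Hypothesis b0 : 0 < b.
Hypothesis u0n : forall i, i < m -> u0 i < n.
Hypothesis v0n : forall i, i < m -> v0 i < n.
Hypothesis big : (m + n + 2) * (L + L + b + 4) < lim w.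

Let Un i : Ue m u0 i < n. Proof. by rewrite /Ue; case: ifP => // /u0n. Qed.
Let Vn i : Ve n m v0 i < n. Proof. by rewrite /Ve; case: ifP => [/v0n//|_]; case: ifP. Qed.
Notation FO k := (forestm n m L u0 v0 k).
Let inv k := forest_inv nL Un Vn k.

Lemma lim_small x : x <= 4 * (m + n + 2) -> x < lim w.
Proof.
clear -big; move=> h; apply: leq_ltn_trans big; apply: leq_trans h _.
by rewrite mulnC leq_mul2l; apply/orP; right; lia.
Qed.

Lemma lim_L x : x <= 2 * (L + L + b + 4) -> x < lim w.
Proof.
clear -big; move=> h; apply: leq_ltn_trans big; apply: leq_trans h _.
by rewrite leq_mul2r; apply/orP; right; lia.
Qed.

Lemma find_wp x y s (Q : hst -> Prop) st k v :
  (x, y) \in [:: (26, 24); (27, 25); (26, 21)] -> hr s 13 = L -> hr s y = v -> v < n ->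
  agree n k st s -> uf_inv n L st ->
  (forall s', frame [:: x; 28] [::] s s' -> hr s' x = ufroot L (par st) v ->
     hk s' <= hk s + 20 * L + 20 -> Q s') ->
  wp (find_prog x y) s Q.
Proof.
move=> xs e13 ey vn [Ap _ _ _] UI HQ.
have [x28 x13 xy] : [/\ x != 28, x != 13 & x != y].
  by move: xs; rewrite !inE => /or3P[] /eqP[-> ->].
rewrite /find_prog; apply: wp_seq; apply: wp_asg => //.
set s1 := tick _ _.
have F1 : frame [:: x] [::] s s1 by rewrite /s1; fr.
have x1 : hr s1 x = v by rewrite /s1 hr_tick hr_upr eqxx.
have T1 : hk s1 = hk s + 2 by [].
clearbody s1.
apply: (@wp_forF w _ cm 28 13 _ s1 _ L 3 [:: x; 28] [::] (fun i s' => hr s' x = iter i (par st) v)) => //.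
- by rewrite !inE orbT.
- by rewrite !inE negb_or eq_sym x13.
- by apply: lim_L; lia.
- by rewrite (frR F1) // !inE eq_sym x13.
- by rewrite hr_upr (negbTE x28).
- move=> i s2 iL F2 xi I2; apply: wp_asg => //.
  split; [by fr|by rewrite hr_tick hr_upr eq_sym (negbTE x28)|by rewrite /=; lia|].
  rewrite hr_upr (negbTE x28) hr_tick hr_upr eqxx /= I2.
  rewrite (frM F2) // (frM F1) // Ap //; apply: iter_lt vn; exact: (ufP UI).
- move=> s2 F2 x2 T2 I2; apply: HQ => //; first by fr.
  by lia.
Qed.

Lemma step_wp k s (Q : hst -> Prop) :
  hr s 13 = L -> hr s 23 = k -> hm s 10 k = Ue m u0 k -> hm s 11 k = Ve n m v0 k ->
  agree n k (FO k) s ->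
  (forall s', frame [:: 24; 25; 26; 27; 28; 29; 30; 31; 32; 33] [:: 4; 5; 6; 7; 8; 9] s s' ->
    hk s' <= hk s + 40 * L + 140 -> agree n k.+1 (FO k.+1) s' -> Q s') ->
  wp step_prog s Q.
Proof.
move=> e13 e23 eU eV AG HQ.
have [UI CI] : uf_inv n L (FO k) /\ cyc_inv n L (Ue m u0) (Ve n m v0) k (FO k) := inv k.
rewrite /step_prog; apply: wp_seq; apply: wp_asg => //=.
apply: wp_seq; apply: wp_asg => //=.
set s1 := tick _ (upr _ 25 _).
have F1 : frame [:: 24; 25] [::] s s1 by rewrite /s1; fr.
have [f24 f25] : hr s1 24 = Ue m u0 k /\ hr s1 25 = Ve n m v0 k by rewrite /s1 /= e23 eU eV.
have T1 : hk s1 = hk s + 6 by rewrite /s1 /=; lia.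
have A1 : agree n k (FO k) s1 by case: AG => *; split; rewrite ?(frM F1).
have g13 : hr s1 13 = L by rewrite (frR F1).
clearbody s1.
apply: wp_seq; apply: (@find_wp 26 24 s1 _ (FO k) k (Ue m u0 k)) => //.
move=> s2 F2 x2 T2.
have A2 : agree n k (FO k) s2 by case: A1 => *; split; rewrite ?(frM F2).
apply: wp_seq; apply: (@find_wp 27 25 s2 _ (FO k) k (Ve n m v0 k)) => //; try by rewrite (frR F2).
move=> s3 F3 x3 T3.
have A3 : agree n k (FO k) s3 by case: A2 => *; split; rewrite ?(frM F3).
have x2' : hr s3 26 = ufroot L (par (FO k)) (Ue m u0 k) by rewrite (frR F3).
have [h24 h25 h23] : [/\ hr s3 24 = Ue m u0 k, hr s3 25 = Ve n m v0 k & hr s3 23 = k].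
  by rewrite !(frR F3) // !(frR F2) // f24 f25 (frR F1).
have F03 : frame [:: 24; 25; 26; 27; 28] [::] s s3 by fr.
have T03 : hk s3 <= hk s + 40 * L + 50 by lia.
have est : FO k.+1 = fstep L (FO k) k (Ue m u0 k) (Ve n m v0 k) by [].
rewrite {}est in HQ.
set u := Ue m u0 k in HQ x2' h24; set v := Ve n m v0 k in HQ x3 h25.
have un : u < n by apply: Un.
have vn : v < n by apply: Vn.
have run := root_lt UI un; have rvn := root_lt UI vn.
set st := FO k in HQ UI CI A3 x2' x3 run rvn.
clearbody st.
have [Ap Ar An Ai] := A3.
have lim1 : 1 < lim w by apply: lim_small; lia.
apply: wp_if => /=; first by [].
  rewrite x2' x3 eqb0 negbK => /eqP e.
  apply: wp_seq; apply: wp_sto => //=.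
  apply: wp_seq; apply: wp_sto => //=.
  apply: wp_sto => //=.
  apply: HQ; first by fr.
    by move: T03 => /=; lia.
  rewrite fstep_same //; split=> //= i ik; rewrite h23 h24 /upd.
  by case: eqP => // ne; apply: Ai; lia.
rewrite x2' x3 => /eqP; rewrite eqb0 => ne.
rewrite /fstep (negbTE ne) in HQ.
do 2 (apply: wp_seq; apply: wp_asg; first exact: I).
do 5 (apply: wp_seq; apply: wp_sto; [exact: I|first [exact: I|exact: lim_gt0]|]).
do 2 (apply: wp_seq; apply: wp_asg; first exact: I).
rewrite /=.
set s4 := tick _ (upr _ 33 _).
have F4 : frame [:: 24; 25; 26; 27; 28; 29; 30; 32; 33] [:: 6; 7; 8; 9] s s4 by rewrite /s4; fr.
have T4 : hk s4 <= hk s + 40 * L + 80 by rewrite /s4 /=; lia.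
have [k26 k27 k32 k33] : [/\ hr s4 26 = ufroot L (par st) u, hr s4 27 = ufroot L (par st) v,
    hr s4 32 = rnk st (ufroot L (par st) u) & hr s4 33 = rnk st (ufroot L (par st) v)].
  by rewrite /s4 /= x2' x3 (Ar _ run) (Ar _ rvn).
have m4 x : x < n -> hm s4 4 x = par st x by move=> xn; rewrite /s4 /= Ap.
have m5 x : x < n -> hm s4 5 x = rnk st x by move=> xn; rewrite /s4 /= Ar.
have m6 x : x < n -> hm s4 6 x = upd (upd (nxt st) u (nxt st v)) v (nxt st u) x.
  by move=> xn; rewrite /s4 /= h24 h25 !An // /upd.
have m789 i : i < k.+1 -> [/\ hm s4 7 i = upd (xa st) k (nxt st u) i,
    hm s4 8 i = upd (ya st) k (nxt st v) i & hm s4 9 i = upd (nt st) k 0 i].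
  move=> ik; rewrite /s4 /= h23 h24 h25 !An // /upd; case: eqP => // nek.
  by apply: Ai; lia.
clearbody s4.
have rl x : x < n -> rnk st x + 1 < lim w.
  by move=> xn; apply: lim_L; have := ufL UI xn; lia.
have fin s5 : frame [::] [:: 4] s4 s5 -> hk s5 <= hk s4 + 10 ->
    (forall x, x < n -> hm s5 4 x = (if rnk st (ufroot L (par st) u) < rnk st (ufroot L (par st) v)
      then upd (par st) (ufroot L (par st) u) (ufroot L (par st) v)
      else upd (par st) (ufroot L (par st) v) (ufroot L (par st) u)) x) ->
    wp (PIf (V 32 ==! V 33) (PSto 5 (V 26) (V 32 +! N 1)) (31 ::= N 0)) s5 Q.
  move=> F5 T5 m54.
  have [z26 z27 z32 z33] : [/\ hr s5 26 = ufroot L (par st) u, hr s5 27 = ufroot L (par st) v,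
    hr s5 32 = rnk st (ufroot L (par st) u) & hr s5 33 = rnk st (ufroot L (par st) v)].
    by rewrite !(frR F5).
  apply: wp_if => /=; first by [].
    rewrite z32 z33 eqb0 negbK => re.
    apply: wp_sto => //=; first by sp; rewrite //= z32; apply: rl.
    apply: HQ; first by fr.
      by rewrite /=; lia.
    rewrite /= re; split=> //=.
    - by move=> x xn; rewrite z26 z32 (frM F5) // /upd addn1; case: eqP => // _; apply: m5.
    - by move=> x xn; rewrite (frM F5) // m6.
    - by move=> i ik; rewrite !(frM F5) //; apply: m789.
  rewrite z32 z33 => /eqP; rewrite eqb0 => re.
  apply: wp_asg => /=; first exact: lim_gt0.
  apply: HQ; first by fr.
    by rewrite /=; lia.
  rewrite /= (negbTE re); split=> //=.
  - by move=> x xn; rewrite (frM F5) //; apply: m5.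
  - by move=> x xn; rewrite (frM F5) // m6.
  - by move=> i ik; rewrite !(frM F5) //; apply: m789.
apply: wp_seq; apply: wp_if => /=; first by [].
  rewrite k32 k33 eqb0 negbK => h; apply: wp_sto => //=; apply: fin; [by fr|by rewrite /=; lia|].
  by move=> x xn /=; rewrite h k26 k27 /upd; case: eqP => // _; apply: m4.
rewrite k32 k33 => /eqP; rewrite eqb0 => h; apply: wp_sto => //=; apply: fin; [by fr|by rewrite /=; lia|].
by move=> x xn /=; rewrite (negbTE h) k26 k27 /upd; case: eqP => // _; apply: m4.
Qed.

(** Component names are saved before the virtual edges merge everything. Array 12 interleaves the
    names with the positions found by walking the final cycle from 0. *)
Definition join_prog : prog :=
  PFor 21 12 (23 ::= V 21 ;; step_prog) ;;
  PFor 21 10 (find_prog 26 21 ;; PSto 12 (V 21 +! V 21) (V 26)) ;;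
  PFor 21 10 (23 ::= V 12 +! V 21 ;; step_prog) ;;
  26 ::= N 0 ;;
  PFor 21 10 (PSto 12 (V 26 +! V 26 +! N 1) (V 21) ;; 26 ::= A 6 (V 26)).

Definition Xs := [:: 21; 23; 24; 25; 26; 27; 28; 29; 30; 31; 32; 33].

Definition edges_in (s : hst) := forall i, i < m + n ->
  hm s 10 i = Ue m u0 i /\ hm s 11 i = Ve n m v0 i.

Notation CO := (vcomp n m L u0 v0).
Notation PO := (pos n m L u0 v0).
Notation CY := (cyc n m L u0 v0).

Lemma join_wp s (Q : hst -> Prop) :
  hr s 10 = n -> hr s 12 = m -> hr s 13 = L -> edges_in s -> agree n 0 finit s ->
  (forall s', frame Xs [:: 4; 5; 6; 7; 8; 9; 12] s s' ->
    hk s' <= hk s + (m + n + n + n + 1) * (40 * L + 200) ->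
    agree n (m + n) (FO (m + n)) s' ->
    (forall x, x < n -> hm s' 12 (x + x) = CO x /\ hm s' 12 (x + x + 1) = PO x) -> Q s') ->
  wp join_prog s Q.
Proof.
move=> e10 e12 e13 EI A0 HQ.
have l1 : 1 < lim w by apply: lim_small; lia.
apply: wp_seq.
apply: (@wp_forF w _ cm 21 12 _ s _ m (40 * L + 150)  Xs [:: 4; 5; 6; 7; 8; 9]
  (fun i s' => agree n i (FO i) s')) => //.
- by apply: lim_small; lia.
- move=> i s1 im F1 xi A1; apply: wp_seq; apply: wp_asg => //=.
  have im' : i < m + n by lia.
  apply: (@step_wp i) => //=.
  + by rewrite (frR F1).
  + by rewrite (frM F1) //; case: (EI i im').
  + by rewrite (frM F1) //; case: (EI i im').
  move=> s2 F2 T2 A2; split; [by fr|by rewrite (frR F2)|by move: T2 => /=; lia|exact: A2].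
move=> s1 F1 x1 T1 A1.
apply: wp_seq.
have [f10 f12 f13] : [/\ hr s1 10 = n, hr s1 12 = m & hr s1 13 = L] by rewrite !(frR F1).
have [UIm CIm] : uf_inv n L (FO m) /\ cyc_inv n L (Ue m u0) (Ve n m v0) m (FO m) := inv m.
apply: (@wp_forF w _ cm 21 10 _ s1 _ n (20 * L + 40)  [:: 21; 26; 28] [:: 12]
  (fun i s' => forall x, x < i -> hm s' 12 (x + x) = CO x)) => //.
- by apply: lim_small; lia.
- move=> i s2 im F2 xi I2.
  apply: wp_seq; apply: (@find_wp 26 21 s2 _ (FO m) m i) => //.
  + by rewrite (frR F2).
  + by case: A1 => *; split; rewrite ?(frM F2).
  move=> s3 F3 x3 T3; have g21 : hr s3 21 = i by rewrite (frR F3).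
  apply: wp_sto => /=; [by sp; rewrite /= g21; apply: lim_small; lia|by []|].
  split=> /=; [by fr|exact: g21|by lia|].
  move=> x xi'; rewrite g21 eq_dbl; case: (eqVneq x i) => [->//|nx].
  by rewrite (frM F3) // I2 //; lia.
move=> s2 F2 x2 T2 I2.
apply: wp_seq.
have [g10 g12 g13] : [/\ hr s2 10 = n, hr s2 12 = m & hr s2 13 = L] by rewrite !(frR F2).
have F02 : frame Xs [:: 4; 5; 6; 7; 8; 9; 12] s s2 by fr.
have A2 : agree n m (FO m) s2 by case: A1 => *; split; rewrite ?(frM F2).
apply: (@wp_forF w _ cm 21 10 _ s2 _ n (40 * L + 150)  Xs [:: 4; 5; 6; 7; 8; 9]
  (fun i s' => agree n (m + i) (FO (m + i)) s')) => //.
- by apply: lim_small; lia.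
- by rewrite addn0.
- move=> i s3 im F3 xi A3; apply: wp_seq; apply: wp_asg => /=.
    by sp; rewrite /= (frR F3) // g12 xi; apply: lim_small; lia.
  have im' : m + i < m + n by lia.
  apply: (@step_wp (m + i)) => //=.
  + by rewrite (frR F3).
  + by rewrite (frR F3) // g12 xi.
  + by rewrite (frM F3) // (frM F02) //; case: (EI _ im').
  + by rewrite (frM F3) // (frM F02) //; case: (EI _ im').
  move=> s4 F4 T4 A4; split; [by fr|by rewrite (frR F4)|by move: T4 => /=; lia|].
  by rewrite addnS; exact: A4.
move=> s3 F3 x3 T3 A3.
have An : (forall x, x < n -> hm s3 6 x = CY x) by case: A3.
have cyl x : x < n -> CY x < n by move=> xn; apply: (cN (proj2 (inv (m + n)))).
apply: wp_seq; apply: wp_asg => /=; first exact: lim_gt0.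
set s4 := tick _ _.
have F4 : frame [:: 26] [::] s3 s4 by rewrite /s4; fr.
have T4 : hk s4 = hk s3 + 2 by [].
have x26 : hr s4 26 = 0 by [].
clearbody s4.
apply: (@wp_forF w _ cm 21 10 _ s4 _ n 10 [:: 21; 26] [:: 12]
  (fun i s' => [/\ hr s' 26 = iter i CY 0,
     forall x, hm s' 12 (x + x) = hm s4 12 (x + x) &
     forall x, x < n -> PO x < i -> hm s' 12 (x + x + 1) = PO x])) => //.
- by apply: lim_small; lia.
- by rewrite (frR F4) // (frR F3).
- move=> i s5 im F5 xi [I5 E5 P5].
  have ci : iter i CY 0 < n by apply: iter_lt.
  have m6 : hm s5 6 = hm s3 6 by rewrite (frM F5) // (frM F4).
  apply: wp_seq; apply: wp_sto => /=; [by sp; rewrite /= ?I5 //; apply: lim_small; lia|by []|].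
  apply: wp_asg => //=; split=> /=; [by fr|by []|by lia|].
  split=> /=.
  + by rewrite I5 m6 An.
  + move=> x; rewrite I5 -E5; case: eqP => // h; exfalso; lia.
  + move=> x xn; rewrite I5 xi eqn_add2r eq_dbl ltnS leq_eqVlt.
    rewrite -{1}(pos_iter n0 nL u0n v0n im) (pos_inj n0 nL u0n v0n) //.
    case: (eqVneq x (iter i CY 0)) => [->|nx] /=; first by rewrite (pos_iter n0 nL u0n v0n).
    exact: P5.
move=> s5 F5 x5 T5 [I5 E5 P5]; apply: HQ.
- by fr.
- have : L <= L by []. 
  move: T1 T2 T3 T4 T5; move: (L) => l; clear; nia.
- by case: A3 => *; split; rewrite ?(frM F5) // ?(frM F4).
- move=> x xn; split; last by apply: P5 => //; apply: (pos_lt n0 nL u0n v0n).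
  by rewrite E5 (frM F4) // (frM F3) // I2.
Qed.
End Enc.

Definition init_prog (C : nat) : prog :=
  10 ::= A 0 (N 0) ;; 11 ::= A 0 (N 1) ;; 12 ::= V 1 ;;
  13 ::= N 1 ;; 20 ::= N 2 ;;
  PWhile ((V 10 <! V 20) ==! N 0) (20 ::= V 20 +! V 20 ;; 13 ::= V 13 +! N 1) ;;
  14 ::= V 11 +! N C *! V 13 ;;
  16 ::= V 13 +! V 13 ;; 17 ::= V 16 +! V 14 ;;
  PFor 21 12 (PSto 10 (V 21) (A 1 (V 21)) ;; PSto 11 (V 21) (A 2 (V 21))) ;;
  PFor 21 10 (PSto 10 (V 12 +! V 21) (N 0) ;; PSto 11 (V 12 +! V 21) (V 21) ;;
    PSto 4 (V 21) (V 21) ;; PSto 5 (V 21) (N 0) ;; PSto 6 (V 21) (V 21)).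

(** Name and position are adjacent in array 12 and both have [L] bits, so output bit [q] is bit
    [q %% L] of entry [q %/ L]. *)
Definition vemit_prog : prog :=
  PFor 21 10 (PSto 0 (V 21) (V 16)) ;;
  18 ::= V 10 *! V 16 ;;
  PFor 21 18 (PSto 1 (V 21) (B Shr (A 12 (V 21 /! V 13)) (V 21 %! V 13) %! N 2)).

(** The stride is the full label length: the last [b] cells of each label are left for
    [phi_prog]. *)
Definition eemit_prog : prog :=
  PFor 21 12 (
    PSto 15 (V 21 +! V 21) (A 12 (A 7 (V 21) +! A 7 (V 21) +! N 1)) ;;
    PSto 15 (V 21 +! V 21 +! N 1) (A 12 (A 8 (V 21) +! A 8 (V 21) +! N 1)) ;;
    PSto 2 (V 21) (V 17)) ;;
  18 ::= V 12 *! V 16 ;;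
  PFor 21 18 (PSto 3 (V 21 /! V 16 *! V 17 +! V 21 %! V 16)
    (B Shr (A 15 (V 21 /! V 13)) (V 21 %! V 13) %! N 2)).

Section Enc2.
Variables (w n m f C : nat) (u0 v0 : nat -> nat).
Notation wp := (wp w nocall).
Let cm := @nocall_mono.
Let L := lg n.
Let b := f + C * L.
Hypothesis n0 : 0 < n.
Hypothesis f0 : 0 < f.
Hypothesis u0n : forall i, i < m -> u0 i < n.
Hypothesis v0n : forall i, i < m -> v0 i < n.
Hypothesis big : (m + n + 2) * (L + L + b + 4) < lim w.
Hypothesis Cl : C < lim w.

Lemma lg_bounds : n < 2 ^ L /\ 2 ^ L <= n + n.
Proof.
split; first exact: trunc_log_ltn.
by rewrite /L /lg expnS mul2n -addnn; apply: leq_add; apply: trunc_logP.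
Qed.

Let L0 : 0 < L. Proof. by []. Qed.
Let b0 : 0 < b. Proof. by rewrite /b; lia. Qed.
Let nL : n < 2 ^ L := proj1 lg_bounds.
Let Ln : 2 ^ L <= n + n := proj2 lg_bounds.
Let ls := @lim_small w n m L b big.
Let lL := @lim_L w n m L b big.

Definition edims (s : hst) := [/\ hr s 10 = n, hr s 12 = m, hr s 13 = L, hr s 14 = b &
  hr s 16 = L + L /\ hr s 17 = L + L + b].

Lemma edims_frame X Y s s' : frame X Y s s' ->
  all (fun y => y \notin X) [:: 10; 12; 13; 14; 16; 17] -> edims s -> edims s'.
Proof.
move=> F /allP ne [h1 h2 h3 h4 [h5 h6]].
by rewrite /edims !(frR F) //; apply: ne.
Qed.

Lemma init_wp s (Q : hst -> Prop) :
  hm s 0 0 = n -> hm s 0 1 = f -> hr s 1 = m ->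
  (forall i, i < m -> hm s 1 i = u0 i /\ hm s 2 i = v0 i) ->
  (forall s', edims s' -> hc s' = hc s -> hk s' <= hk s + 100 + 20 * L + 60 * (m + n) ->
     edges_in n m u0 v0 s' -> agree n 0 finit s' -> Q s') ->
  wp (init_prog C) s Q.
Proof.
move=> e00 e01 e1 ein HQ.
have l1 : 1 < lim w by apply: ls; lia.
rewrite /init_prog; do 3 (apply: wp_seq; apply: wp_asg => //=; try exact: lim_gt0).
do 2 (apply: wp_seq; apply: wp_asg => //=); first by apply: ls; lia.
set s1 := tick _ (upr _ 20 _).
have F1 : frame [:: 10; 11; 12; 13; 20] [::] s s1 by rewrite /s1; fr.
have [f10 f11 f12] : [/\ hr s1 10 = n, hr s1 11 = f & hr s1 12 = m] by rewrite /s1 /= e00 e01 e1.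
have [f13 f20] : hr s1 13 = 1 /\ hr s1 20 = 2 by [].
have T1 : hk s1 <= hk s + 20 by rewrite /s1 /=; lia.
clearbody s1.
apply: wp_seq; exists L.-1, (fun i s' => [/\ frame [:: 13; 20] [::] s1 s', hr s' 13 = i.+1,
  hr s' 20 = 2 ^ i.+1 & hk s' <= hk s1 + i * 20]).
split.
- by split=> //; rewrite addn0.
- move=> i s2 iL [F2 x13 x20 T2].
  have pn : 2 ^ i.+1 <= n.
    by apply: leq_trans (trunc_logP (isT : 1 < 2) n0); rewrite leq_exp2l.
  split=> /=; first by sp; rewrite //= ?lim_gt0.
    by rewrite (frR F2) // f10 x20 ltnNge pn.
  apply: wp_seq; apply: wp_asg => /=; first by sp; rewrite /= x20; apply: ls; lia.
  apply: wp_asg => /=; first by sp; rewrite //= x13; apply: lL; move: iL; rewrite /L; lia.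
  split=> /=; [by fr|by rewrite x13 addn1|by rewrite x20 addnn -mul2n -expnS|by lia].
- move=> s2 [F2 x13 x20 T2].
  have e13 : hr s2 13 = L by rewrite x13 prednK.
  have [g10 g11 g12] : [/\ hr s2 10 = n, hr s2 11 = f & hr s2 12 = m] by rewrite !(frR F2).
  split=> /=; first by sp; rewrite //= ?lim_gt0.
    by rewrite g10 x20 prednK // nL.
  apply: wp_seq; apply: wp_asg => /=.
    by sp; rewrite /= ?e13 ?g11 //; apply: lL; rewrite -?/b /b; lia.
  apply: wp_seq; apply: wp_asg => /=; first by sp; rewrite /= e13; apply: lL; lia.
  apply: wp_seq; apply: wp_asg => /=.
    by sp; rewrite /= ?e13 ?g11 -/b; apply: lL; lia.
  set s3 := tick _ (upr _ 17 _).
  have F3 : frame [:: 14; 16; 17] [::] s2 s3 by rewrite /s3; fr.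
  have D3 : edims s3 by rewrite /s3 /edims /= e13 g10 g11 g12.
  have T3 : hk s3 <= hk s2 + 30 by rewrite /s3 /=; lia.
  have F03 : frame [:: 10; 11; 12; 13; 14; 16; 17; 20] [::] s s3 by fr.
  clearbody s3.
  have [h10 h12 _ _ _] := D3.
  apply: wp_seq.
  apply: (@wp_forF w _ cm 21 12 _ s3 _ m 20 [:: 21] [:: 10; 11] (fun i s' =>
    forall j, j < i -> hm s' 10 j = u0 j /\ hm s' 11 j = v0 j)) => //.
    by apply: ls; lia.
    move=> i s4 im F4 xi I4; apply: wp_seq; apply: wp_sto => //=; apply: wp_sto => //=.
    split=> /=; [by fr|by []|by lia|].
    have [eu ev] := ein i im.
    have [m1 m2] : hm s4 1 = hm s 1 /\ hm s4 2 = hm s 2 by rewrite !(frM F4) // !(frM F03).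
    move=> j ji; rewrite xi m1 m2.
    by case: eqP => [->//|ne]; apply: I4; lia.
  move=> s4 F4 x4 T4 I4.
  apply: (@wp_forF w _ cm 21 10 _ s4 _ n 30 [:: 21] [:: 4; 5; 6; 10; 11] (fun i s' =>
    (forall j, j < m + i -> hm s' 10 j = Ue m u0 j /\ hm s' 11 j = Ve n m v0 j) /\
    (forall j, j < i -> [/\ hm s' 4 j = j, hm s' 5 j = 0 & hm s' 6 j = j]))) => //.
  + by apply: ls; lia.
  + by rewrite (frR F4).
  + split=> //= j; rewrite addn0 => jm; rewrite /Ue /Ve jm; exact: I4.
  + move=> i s5 im F5 xi [I5 J5].
    have k12 : hr s5 12 = m by rewrite (frR F5) // (frR F4).
    have mi : m + i < lim w by apply: ls; lia.
    apply: wp_seq; apply: wp_sto => /=; [by sp; rewrite /= k12 xi|exact: lim_gt0|].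
    apply: wp_seq; apply: wp_sto => /=; [by sp; rewrite /= k12 xi|by []|].
    apply: wp_seq; apply: wp_sto => //=; apply: wp_seq; apply: wp_sto => //=; first exact: lim_gt0.
    apply: wp_sto => //=.
    split=> /=; [by fr|by []|by lia|].
    split=> j jm; rewrite xi ?k12.
      case: eqP => [->|ne]; last by apply: I5; lia.
      have mm : (m + i < m) = false by apply/negbTE; rewrite -leqNgt leq_addr.
      by rewrite /Ue /Ve mm addKn im.
    by case: eqP => [->//|ne]; apply: J5; lia.
  + move=> s5 F5 x5 T5 [I5 J5]; apply: HQ => //.
    * by apply: (edims_frame F5) => //; apply: (edims_frame F4).
    * by rewrite (frC F5) (frC F4) (frC F03).
    * by move: T5 T4 T3 T2 T1; rewrite /L; lia.
    * by split; move=> // v vn; case: (J5 v vn).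
Qed.

Lemma vemit_wp s (Q : hst -> Prop) : edims s ->
  (forall s', frame [:: 18; 21] [:: 0; 1] s s' -> hk s' <= hk s + 30 + (n * (L + L) + n) * 30 ->
    (forall v, v < n -> hm s' 0 v = L + L) ->
    (forall q, q < n * (L + L) -> hm s' 1 q = bitn (hm s 12 (q %/ L)) (q %% L)) -> Q s') ->
  wp vemit_prog s Q.
Proof.
move=> D HQ; have [e10 e12 e13 e14 [e16 e17]] := D.
have nl : n * (L + L) < lim w.
  by apply: leq_ltn_trans big; apply: leq_mul; clear; lia.
have l2 : 2 < lim w by apply: ls; lia.
apply: wp_seq.
apply: (@wp_forF w _ cm 21 10 _ s _ n 10 [:: 21] [:: 0] (fun i s' =>
  forall v, v < i -> hm s' 0 v = L + L)) => //.
- by apply: ls; lia.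
- move=> i s1 im F1 xi I1; apply: wp_sto => //=; split=> /=; [by fr|by []|by lia|].
  by move=> v vi; rewrite xi (frR F1) // e16; case: eqP => // ne; apply: I1; lia.
move=> s1 F1 x1 T1 I1.
have [f10 f16 f13] : [/\ hr s1 10 = n, hr s1 16 = L + L & hr s1 13 = L] by rewrite !(frR F1).
apply: wp_seq; apply: wp_asg => /=; first by sp; rewrite /= f10 f16.
apply: (@wp_forF w _ cm 21 18 _ _ _ (n * (L + L)) 20 [:: 21] [:: 1] (fun i s' =>
  forall q, q < i -> hm s' 1 q = bitn (hm s 12 (q %/ L)) (q %% L))) => //.
- by rewrite /= f10 f16.
- move=> q s2 qK F2 xq I2.
  have g13 : hr s2 13 = L by rewrite (frR F2).
  have g12 : hm s2 12 = hm s 12 by rewrite (frM F2) // (frM F1).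
  apply: wp_sto => /=; [by []|by sp|].
  split=> /=; [by fr|by []|by lia|].
  move=> p pq; rewrite xq g13 g12; case: eqP => [->|ne]; last by apply: I2; lia.
  by rewrite /bitn modn2.
- move=> s2 F2 x2 T2 I2; apply: HQ => //.
  + by fr.
  + by move: T2 T1 => /=; move: (n * (L + L)) => x; lia.
  + by move=> v vn; rewrite (frM F2) //= I1.
Qed.

Lemma eemit_wp s (Q : hst -> Prop) : edims s ->
  (forall i, i < m -> hm s 7 i < n /\ hm s 8 i < n) ->
  (forall s', frame [:: 18; 21] [:: 2; 3; 15] s s' ->
    hk s' <= hk s + 30 + (m * (L + L) + m) * 60 ->
    (forall i, i < m -> hm s' 2 i = L + L + b) ->
    (forall i, i < m -> hm s' 15 (i + i) = hm s 12 (hm s 7 i + hm s 7 i + 1) /\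
       hm s' 15 (i + i + 1) = hm s 12 (hm s 8 i + hm s 8 i + 1)) ->
    (forall i j, i < m -> j < L + L -> hm s' 3 (i * (L + L + b) + j) =
       bitn (hm s' 15 (i + i + j %/ L)) (j %% L)) -> Q s') ->
  wp eemit_prog s Q.
Proof.
move=> D xy HQ; have [e10 e12 e13 e14 [e16 e17]] := D.
have nl : m * (L + L) < lim w.
  by apply: leq_ltn_trans big; apply: leq_mul; clear; lia.
have nl' : m * (L + L + b) < lim w.
  by apply: leq_ltn_trans big; apply: leq_mul; clear; lia.
have l2 : 2 < lim w by apply: ls; lia.
apply: wp_seq.
apply: (@wp_forF w _ cm 21 12 _ s _ m 50 [:: 21] [:: 2; 15] (fun i s' =>
  (forall v, v < i -> hm s' 2 v = L + L + b) /\
  (forall v, v < i -> hm s' 15 (v + v) = hm s 12 (hm s 7 v + hm s 7 v + 1) /\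
       hm s' 15 (v + v + 1) = hm s 12 (hm s 8 v + hm s 8 v + 1)))) => //.
- by apply: ls; lia.
- move=> i s1 im F1 xi [I1 J1].
  have g12 : hm s1 12 = hm s 12 by rewrite (frM F1).
  have g7 : hm s1 7 = hm s 7 by rewrite (frM F1).
  have g8 : hm s1 8 = hm s 8 by rewrite (frM F1).
  have [x7 x8] := xy i im.
  have [i1 i2] : i + i < lim w /\ i + i + 1 < lim w by split; apply: ls; lia.
  have [y1 y2] : hm s 7 i + hm s 7 i < lim w /\ hm s 7 i + hm s 7 i + 1 < lim w by split; apply: ls; lia.
  have [y3 y4] : hm s 8 i + hm s 8 i < lim w /\ hm s 8 i + hm s 8 i + 1 < lim w by split; apply: ls; lia.
  have l1 : 1 < lim w by lia.
  apply: wp_seq; apply: wp_sto => /=; [by sp; rewrite /= xi|by sp; rewrite /= ?xi ?g7|].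
  apply: wp_seq; apply: wp_sto => /=; [by sp; rewrite /= ?xi|by sp; rewrite /= ?xi ?g8|].
  apply: wp_sto => //=; split=> /=; [by fr|by []|by lia|].
  rewrite xi g7 g8 g12; split=> v vi.
    by rewrite (frR F1) // e17; case: eqP => // ne; apply: I1; lia.
  case: (eqVneq v i) => [->|ne].
    by rewrite !eqxx; case: eqP => // h; exfalso; lia.
  do 4 (case: eqP => [h|_]; first by exfalso; lia).
  by apply: J1; lia.
move=> s1 F1 x1 T1 [I1 J1].
have [f12 f16 f13] : [/\ hr s1 12 = m, hr s1 16 = L + L & hr s1 13 = L] by rewrite !(frR F1).
apply: wp_seq; apply: wp_asg => /=; first by sp; rewrite /= f12 f16.
have L20 : 0 < L + L by lia.
apply: (@wp_forF w _ cm 21 18 _ _ _ (m * (L + L)) 40 [:: 21] [:: 3] (fun q s' =>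
  forall i j, i < m -> j < L + L -> i * (L + L) + j < q -> hm s' 3 (i * (L + L + b) + j) =
       bitn (hm s1 15 (i + i + j %/ L)) (j %% L))) => //.
- by rewrite /= f12 f16.
- move=> q s2 qK F2 xq I2.
  have [g13 g16 g17] : [/\ hr s2 13 = L, hr s2 16 = L + L & hr s2 17 = L + L + b].
    by rewrite !(frR F2) //= !(frR F1).
  have g15 : hm s2 15 = hm s1 15 by rewrite (frM F2).
  have q1 : q %/ (L + L) < m by rewrite ltn_divLR.
  have q2 : q %% (L + L) < L + L by rewrite ltn_mod.
  have q3 : q %% (L + L) < L + L + b by apply: leq_trans q2 (leq_addr _ _).
  have cl : q %/ (L + L) * (L + L + b) + q %% (L + L) < lim w.
    by apply: ltn_trans nl'; apply: ltn_flat.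
  have cl' : q %/ (L + L) * (L + L + b) < lim w by apply: leq_ltn_trans cl; apply: leq_addr.
  apply: wp_sto => /=; [by sp; rewrite /= xq g16 g17|by sp|].
  split=> /=; [by fr|by []|by lia|].
  move=> i j im jL; rewrite ltnS leq_eqVlt xq g13 g15 g16 g17 flat_inj //; last first.
    by apply: leq_trans jL (leq_addr _ _).
  case: (eqVneq (i * (L + L) + j) q) => [e _|ne /= lt].
    rewrite -e flat_div // flat_mod // !eqxx /= modn2 /bitn.
    have e2 : i * (L + L) + j = (i + i) * L + j by rewrite mulnDr mulnDl.
    by rewrite e2 divnMDl // modnMDl.
  case: andP => [[/eqP ei /eqP ej]|_]; last exact: I2.
  by case/eqP: ne; rewrite ei ej -divn_eq.
- move=> s2 F2 x2 T2 I2; apply: HQ => //.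
  + by fr.
  + by move: T2 T1 => /=; move: (m * (L + L)) => x; lia.
  + by move=> i im; rewrite (frM F2) //= I1.
  + by move=> i im; rewrite (frM F2 (a := 15)) //=; apply: J1.
  + by move=> i j im jL; rewrite (frM F2 (a := 15)) //=; apply: I2 => //; apply: ltn_flat.
Qed.
End Enc2.

(** * Inner products with random vectors, by prefix sums *)

Definition flip_prog : prog :=
  PFor 21 12 (
    PFlip 35 ;; 36 ::= V 35 *! A 9 (V 21) ;; PSto 17 (V 21) (V 36) ;;
    37 ::= A 12 (A 10 (V 21) +! A 10 (V 21) +! N 1) ;;
    PSto 16 (V 37) ((A 16 (V 37) +! V 36) %! N 2) ;;
    37 ::= A 12 (A 11 (V 21) +! A 11 (V 21) +! N 1) ;;
    PSto 16 (V 37) ((A 16 (V 37) +! V 36) %! N 2)).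

Definition prefix_prog : prog :=
  38 ::= N 0 ;;
  PFor 21 10 (39 ::= A 16 (V 21) ;; PSto 16 (V 21) (V 38) ;; 38 ::= (V 38 +! V 39) %! N 2).

(** A sampled nontree edge adds 1 modulo 2 at the positions of both ends, and prefix sums then count
    sampled ends before a position. The number of ends in an interval has the parity of the number
    of sampled edges leaving it, an inner edge being counted twice. One random vector thus costs
    time linear in [m + n]. *)
Definition phi_prog : prog :=
  PFor 34 14 (
    PFor 21 10 (PSto 16 (V 21) (N 0)) ;;
    flip_prog ;;
    prefix_prog ;;
    PFor 21 12 (PSto 3 (V 21 *! V 17 +! (V 16 +! V 34))
      ((A 17 (V 21) +! A 16 (A 15 (V 21 +! V 21)) +! A 16 (A 15 (V 21 +! V 21 +! N 1)))
       %! N 2))).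

Lemma frame_upc X Y s s' c : frame X Y s s' -> frame X Y (upc s c) (upc s' c).
Proof. by case=> H1 H2 H3; split. Qed.

Section Phi.
Variables (w n m L b : nat) (u v p t la hb : nat -> nat).
Notation wp := (wp w nocall).
Let cm := @nocall_mono.
Hypothesis big : (m + n + 2) * (L + L + b + 4) < lim w.
Hypothesis un : forall i, i < m -> u i < n.
Hypothesis vn : forall i, i < m -> v i < n.
Hypothesis pn : forall x, x < n -> p x < n.
Hypothesis tn : forall i, i < m -> t i < 2.
Hypothesis lan : forall i, i < m -> la i < n.
Hypothesis hbn : forall i, i < m -> hb i < n.
Let ls := @lim_small w n m L b big.
Let lL := @lim_L w n m L b big.

Definition coinv (r : seq bool) (g : nat) : nat := nth false r g * t g.

Definition endp (q g : nat) : 'F_2 := ((p (u g) == q)%:R + (p (v g) == q)%:R)%R.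
Definition endlt (q g : nat) : 'F_2 := ((p (u g) < q)%N%:R + (p (v g) < q)%N%:R)%R.

Record penv (s : hst) : Prop := Penv {
  pe10 : hr s 10 = n; pe12 : hr s 12 = m; pe14 : hr s 14 = b;
  pe16 : hr s 16 = L + L; pe17 : hr s 17 = L + L + b;
  pm9 : forall i, i < m -> hm s 9 i = t i;
  pm10 : forall i, i < m -> hm s 10 i = u i;
  pm11 : forall i, i < m -> hm s 11 i = v i;
  pm12 : forall x, x < n -> hm s 12 (x + x + 1) = p x;
  pm15 : forall i, i < m -> hm s 15 (i + i) = la i /\ hm s 15 (i + i + 1) = hb i
}.

Lemma penv_frame X Y s s' : frame X Y s s' ->
  all (fun y => y \notin X) [:: 10; 12; 14; 16; 17] ->
  all (fun y => (y \notin Y) && ((y < 20) || (20 \notin Y))) [:: 9; 10; 11; 12; 15] ->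
  penv s -> penv s'.
Proof.
move=> F /allP rX /allP mY [h1 h2 h3 h4 h5 h6 h7 h8 h9 h10].
have fm a : a \in [:: 9; 10; 11; 12; 15] -> hm s' a = hm s a.
  by move=> /mY/andP[a1 a2]; apply: (frM F).
by split; rewrite ?fm ?(frR F) //; apply: rX.
Qed.

Lemma penv_upc s c : penv s -> penv (upc s c).
Proof. by case=> *; split. Qed.

Lemma addbit (D : nat -> nat) a c q : D q < 2 ->
  (if q == a then (D a + c) %% 2 else D q) < 2 /\
  (((if q == a then (D a + c) %% 2 else D q)%N)%:R = (D q)%:R + c%:R * (a == q)%:R :> 'F_2)%R.
Proof.
move=> Dq; rewrite [a == q]eq_sym; case: eqP => [->|_]; last by rewrite mulr0 addr0.
by rewrite ltn_mod F2mod natrD mulr1.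
Qed.

Lemma flip_wp s (Q : hst -> Prop) : penv s -> m <= size (hc s) ->
  (forall q, q < n -> hm s 16 q = 0) ->
  (forall s', frame [:: 21; 35; 36; 37] [:: 16; 17] (upc s (drop m (hc s))) s' ->
    hk s' <= hk s + 6 + m * 70 ->
    (forall i, i < m -> hm s' 17 i = coinv (hc s) i) ->
    (forall q, q < n -> hm s' 16 q < 2 /\
      ((hm s' 16 q)%:R = \sum_(g < m) (coinv (hc s) g)%:R * endp q g :> 'F_2)%R) -> Q s') ->
  wp flip_prog s Q.
Proof.
move=> P cs Z HQ.
have l2 : 3 < lim w by apply: lL; lia.
(* [wp_for] is used directly here, because the frame in [wp_forF] would forbid the consumption of
   coins. *)
apply: (@wp_for w _ cm 21 12 _ s _ m (fun i s' =>
  [/\ frame [:: 21; 35; 36; 37] [:: 16; 17] (upc s (drop i (hc s))) s',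
    hk s' <= hk s + 2 + i * 70,
    forall g, g < i -> hm s' 17 g = coinv (hc s) g &
    forall q, q < n -> hm s' 16 q < 2 /\
      ((hm s' 16 q)%:R = \sum_(g < i) (coinv (hc s) g)%:R * endp q g :> 'F_2)%R])) => //.
- by apply: ls; lia.
- exact: (pe12 P).
- split=> //=.
  + by rewrite drop0; apply: frame_tick; apply: frame_upr => //; case: (s).
  + by lia.
  + by move=> q qn; rewrite Z // big_ord0.
- move=> i s1 im xi x12 [F1 T1 I1 J1].
  have P1 : penv s1 by apply: (penv_frame F1) => //; apply: penv_upc.
  have C1 : hc s1 = nth false (hc s) i :: drop i.+1 (hc s).
    by rewrite (frC F1) /= (drop_nth false) //; apply: leq_trans cs.
  apply: wp_seq; split; first by rewrite /= C1.
  rewrite /= C1 /=.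
  set s2 := tick 1 _.
  have F2 : frame [:: 21; 35; 36; 37] [:: 16; 17] (upc s (drop i.+1 (hc s))) s2.
    rewrite /s2; apply: frame_tick; apply: frame_upr => //.
    exact: (frame_upc (drop i.+1 (hc s)) F1).
  have [g35 g21] : hr s2 35 = nth false (hc s) i /\ hr s2 21 = i by rewrite /s2 /=.
  have T2 : hk s2 = hk s1 + 5 by rewrite /s2 /=; lia.
  have M2 : hm s2 = hm s1 by [].
  have P2 : penv s2 by apply: (penv_frame F2) => //; apply: penv_upc.
  clearbody s2.
  have ti := tn im.
  have cv : coinv (hc s) i < 2 by rewrite /coinv; case: (nth _ _ _); rewrite ?mul0n ?mul1n.
  have m9 : hm s2 9 i = t i by apply: (pm9 P2).
  have m10 : hm s2 10 i = u i by apply: (pm10 P2).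
  have m11 : hm s2 11 i = v i by apply: (pm11 P2).
  have ui := un im; have vi := vn im.
  have pu := pn ui; have pv := pn vi.
  have mu : hm s2 12 (u i + u i + 1) = p (u i) by apply: (pm12 P2).
  have mv : hm s2 12 (v i + v i + 1) = p (v i) by apply: (pm12 P2).
  have [y1 y2] : u i + u i < lim w /\ u i + u i + 1 < lim w by split; apply: ls; lia.
  have [y3 y4] : v i + v i < lim w /\ v i + v i + 1 < lim w by split; apply: ls; lia.
  have [z1 z2] : 1 < lim w /\ 2 < lim w by split; lia.
  have [Ju1 Ju2] := J1 _ pu; have [Jv1 Jv2] := J1 _ pv.
  rewrite -M2 in Ju1 Ju2 Jv1 Jv2.
  have cvE : nth false (hc s) i * t i = coinv (hc s) i by [].
  apply: wp_seq; apply: wp_asg => /=; first by sp; rewrite /= g35 g21 m9 cvE; lia.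
  apply: wp_seq; apply: wp_sto => //=.
  apply: wp_seq; apply: wp_asg => /=; first by sp; rewrite /= ?g21 ?m10.
  rewrite g21 g35 m9 m10 mu cvE.
  apply: wp_seq; apply: wp_sto => /=; [by []|by sp; rewrite /= ; lia|].
  apply: wp_seq; apply: wp_asg => /=; first by sp; rewrite /= ?g21 ?m11.
  rewrite g21 m11 mv.
  set dv := (hm s2 16 (p (u i)) + coinv (hc s) i) %% 2.
  have dv2 : dv < 2 by rewrite ltn_mod.
  apply: wp_sto => /=; [by []| |].
    by sp; rewrite //=; case: eqP => _; lia.
  split=> /=; [by rewrite g21|by rewrite (pe12 P2)|].
  split=> /=.
  + by fr.
  + by lia.
  + move=> g; rewrite ltnS leq_eqVlt => /orP[/eqP->|gi]; first by rewrite eqxx.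
    have -> : (g == i) = false by apply/eqP; lia.
    by rewrite M2; apply: I1.
  + move=> q qn; rewrite big_ord_recr /=.
    have [Jq1 Jq2] := J1 _ qn; rewrite -M2 in Jq1 Jq2.
    pose D1 x := if x == p (u i) then dv else hm s2 16 x.
    have [b1 e1] := @addbit (hm s2 16) (p (u i)) (coinv (hc s) i) q Jq1.
    have [b2 e2] := @addbit D1 (p (v i)) (coinv (hc s) i) q b1.
    split; first exact: b2.
    rewrite /endp mulrDr addrA -Jq2 -e1; exact: e2.
- move=> s1 x21 x12 [F1 T1 I1 J1]; apply: HQ => //.
  by rewrite /=; lia.
Qed.

Lemma prefix_wp s (Q : hst -> Prop) : hr s 10 = n -> (forall q, q < n -> hm s 16 q < 2) ->
  (forall s', frame [:: 21; 38; 39] [:: 16] s s' -> hk s' <= hk s + 10 + n * 30 ->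
    (forall q, q < n -> hm s' 16 q < 2 /\
      ((hm s' 16 q)%:R = \sum_(x < q) (hm s 16 x)%:R :> 'F_2)%R) -> Q s') ->
  wp prefix_prog s Q.
Proof.
move=> e10 Db HQ.
have l2 : 3 < lim w by apply: lL; lia.
apply: wp_seq; apply: wp_asg => /=; first exact: lim_gt0.
apply: (@wp_forF w _ cm 21 10 _ _ _ n 20 [:: 21; 38; 39] [:: 16] (fun i s' =>
  [/\ hr s' 38 < 2, ((hr s' 38)%:R = \sum_(x < i) (hm s 16 x)%:R :> 'F_2)%R,
    forall q, i <= q -> hm s' 16 q = hm s 16 q &
    forall q, q < i -> hm s' 16 q < 2 /\
      ((hm s' 16 q)%:R = \sum_(x < q) (hm s 16 x)%:R :> 'F_2)%R])) => //.
- by apply: ls; lia.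
- by split=> //=; rewrite big_ord0.
- move=> i s1 im F1 xi [I1 I2 I3 I4].
  have Di := Db i im; have E := I3 i (leqnn i).
  apply: wp_seq; apply: wp_asg => //=.
  apply: wp_seq; apply: wp_sto => //=.
  apply: wp_asg => /=; first by sp; rewrite /= ?xi ?E; lia.
  split=> /=; [by fr|by []|by lia|].
  rewrite xi E; split=> /=.
  + by rewrite ltn_mod.
  + by rewrite F2mod natrD I2 big_ord_recr.
  + by move=> q iq; case: eqP => [?|_]; [lia|apply: I3; lia].
  + by move=> q; rewrite ltnS leq_eqVlt => /orP[/eqP->|qi]; [rewrite eqxx|
      have -> : (q == i) = false by [apply/eqP; lia]; apply: I4].
- move=> s1 F1 x1 T1 [_ _ _ I4]; apply: HQ => //.
  by fr.
  by move: T1 => /=; lia.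
Qed.

Lemma sum_endp q g : (\sum_(x < q) endp x g = endlt q g)%R.
Proof.
have H y : (\sum_(x < q) (y == x :> nat)%:R = (y < q)%N%:R :> 'F_2)%R.
  case: (ltnP y q) => yq.
    rewrite (bigD1 (Ordinal yq)) //= eqxx big1 ?addr0 // => x; rewrite -val_eqE /= eq_sym.
    by move=> /negbTE->.
  by rewrite big1 // => x _; case: eqP => // e; have := ltn_ord x; lia.
by rewrite /endp /endlt big_split /= !H.
Qed.

(** One formula for both kinds of edges: a tree edge has value 0 in front and keeps the count for
    its interval; a nontree edge has equal end points, so the counts cancel and its own coin
    remains. *)
Definition phiF (r : seq bool) (i : nat) : 'F_2 :=
  ((coinv r i)%:R + \sum_(g < m) (coinv r g)%:R * (endlt (la i) g + endlt (hb i) g))%R.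

Lemma phi_wp s (Q : hst -> Prop) : penv s -> b * m <= size (hc s) ->
  (forall s', frame [:: 21; 34; 35; 36; 37; 38; 39] [:: 3; 16; 17] (upc s (drop (b * m) (hc s))) s' ->
    hk s' <= hk s + 6 + b * ((m + n) * 200 + 200) ->
    (forall i j, i < m -> j < b -> hm s' 3 (i * (L + L + b) + (L + L + j)) < 2 /\
      ((hm s' 3 (i * (L + L + b) + (L + L + j)))%:R = phiF (drop (j * m) (hc s)) i :> 'F_2)%R) ->
    (forall i j, i < m -> j < L + L ->
      hm s' 3 (i * (L + L + b) + j) = hm s 3 (i * (L + L + b) + j)) -> Q s') ->
  wp phi_prog s Q.
Proof.
move=> P cs HQ.
have l2 : 3 < lim w by apply: lL; lia.
have nl' : m * (L + L + b) < lim w.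
  by apply: leq_ltn_trans big; apply: leq_mul; clear; lia.
apply: (@wp_for w _ cm 34 14 _ s _ b (fun j s' =>
  [/\ frame [:: 21; 34; 35; 36; 37; 38; 39] [:: 3; 16; 17] (upc s (drop (j * m) (hc s))) s',
    hk s' <= hk s + 2 + j * ((m + n) * 200 + 200),
    forall i jj, i < m -> jj < j -> hm s' 3 (i * (L + L + b) + (L + L + jj)) < 2 /\
      ((hm s' 3 (i * (L + L + b) + (L + L + jj)))%:R = phiF (drop (jj * m) (hc s)) i :> 'F_2)%R &
    forall i j, i < m -> j < L + L ->
      hm s' 3 (i * (L + L + b) + j) = hm s 3 (i * (L + L + b) + j)])) => //.
- by apply: lL; lia.
- exact: (pe14 P).
- split=> //=.
  + by rewrite mul0n drop0; apply: frame_tick; apply: frame_upr => //; case: (s).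
  + by lia.
- move=> j s1 jb x34 x14 [F1 T1 I1 J1].
  have P1 : penv (tick 4 s1) by apply: (penv_frame (frame_tick 4 F1)) => //; apply: penv_upc.
  have C1 : hc s1 = drop (j * m) (hc s) by rewrite (frC F1).
  have cs1 : m <= size (hc s1).
    rewrite C1 size_drop leq_subRL; last by apply: leq_trans cs; rewrite leq_mul2r ltnW ?orbT.
    by apply: leq_trans cs; rewrite addnC -mulSn leq_mul2r jb orbT.
  apply: wp_seq.
  apply: (@wp_forF w _ cm 21 10 _ _ _ n 3 [:: 21] [:: 16] (fun i s' =>
    forall q, q < i -> hm s' 16 q = 0)) => //.
    by apply: ls; lia.
    by rewrite (pe10 P1).
    move=> i s2 iK F2 xi I2; apply: wp_sto => //=; first exact: lim_gt0.
    split; [by fr|by []|by rewrite /=; lia|].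
    move=> q /=; rewrite ltnS leq_eqVlt xi => /orP[/eqP->|qi]; first by rewrite eqxx.
    by rewrite I2 //; case: eqP.
  move=> s2 F2 x2 T2 I2.
  have P2 : penv s2 by apply: (penv_frame F2).
  have C2 : hc s2 = hc s1 by rewrite (frC F2).
  apply: wp_seq; apply: flip_wp => //; first by rewrite C2.
  rewrite C2 => s3 F3 T3 I3 J3.
  have P3 : penv s3 by apply: (penv_frame F3) => //; apply: penv_upc.
  apply: wp_seq; apply: prefix_wp; [exact: (pe10 P3)|by move=> q qn; case: (J3 q qn)|].
  move=> s4 F4 T4 I4.
  have P4 : penv s4 by apply: (penv_frame F4).
  have F14 : frame [:: 21; 35; 36; 37; 38; 39] [:: 16; 17] (upc s1 (drop m (hc s1))) s4.
    have F12 : frame [:: 21] [:: 16] (upc s1 (drop m (hc s1))) (upc s2 (drop m (hc s1))).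
      exact: (frame_upc (drop m (hc s1)) F2).
    by apply: (frame_step _ F4) => //; apply: (frame_step _ F3) => //; apply: (frame_step _ F12).
  have D4 q : q < n -> hm s4 16 q < 2 /\
      ((hm s4 16 q)%:R = \sum_(g < m) (coinv (hc s1) g)%:R * endlt q g :> 'F_2)%R.
    move=> qn; have [b4 e4] := I4 _ qn; split=> //; rewrite e4.
    rewrite (eq_bigr (fun x : 'I_q => \sum_(g < m) (coinv (hc s1) g)%:R * endp x g))%R; last first.
      by move=> x _; have [] := J3 x (ltn_trans (ltn_ord x) qn).
    by rewrite exchange_big; apply: eq_bigr => g _; rewrite -mulr_sumr sum_endp.
  have m17 i : i < m -> hm s4 17 i = coinv (hc s1) i by move=> im; rewrite (frM F4) // I3.
  have h34 : hr s4 34 = j by rewrite (frR F14).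
  have m3 : hm s4 3 = hm s1 3 by rewrite (frM F14).
  have jW : L + L + j < L + L + b by rewrite ltn_add2l.
  apply: (@wp_forF w _ cm 21 12 _ s4 _ m 60 [:: 21] [:: 3] (fun i s' =>
     [/\ forall i', i' < i -> hm s' 3 (i' * (L + L + b) + (L + L + j)) < 2 /\
      ((hm s' 3 (i' * (L + L + b) + (L + L + j)))%:R = phiF (hc s1) i' :> 'F_2)%R &
      forall i' jj, i' < m -> jj < L + L + b -> jj != L + L + j ->
       hm s' 3 (i' * (L + L + b) + jj) = hm s1 3 (i' * (L + L + b) + jj)])) => //.
  + by apply: ls; lia.
  + exact: (pe12 P4).
  + by split=> // i' jj _ _ _; rewrite /= m3.
  + move=> i s5 im F5 xi [I5 J5].
    have P5 : penv s5 by apply: (penv_frame F5).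
    have g34 : hr s5 34 = j by rewrite (frR F5).
    have [g16 g17] : hr s5 16 = L + L /\ hr s5 17 = L + L + b by rewrite (pe16 P5) (pe17 P5).
    have [g15a g15b] := pm15 P5 im.
    have k16 : hm s5 16 = hm s4 16 by rewrite (frM F5).
    have k17 : hm s5 17 = hm s4 17 by rewrite (frM F5).
    have cl : i * (L + L + b) + (L + L + j) < lim w.
      by apply: ltn_trans nl'; apply: ltn_flat.
    have cl2 : i * (L + L + b) < lim w by apply: leq_ltn_trans cl; apply: leq_addr.
    have cl3 : L + L + j < lim w by apply: lL; lia.
    have [y1 y2] : i + i < lim w /\ i + i + 1 < lim w by split; apply: ls; lia.
    have [la1 la2] := D4 _ (lan im); have [hb1 hb2] := D4 _ (hbn im).
    have cv : coinv (hc s1) i < 2.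
      by rewrite /coinv; case: (nth _ _ _); rewrite ?mul0n ?mul1n // tn.
    have z1 : 1 < lim w by lia.
    apply: wp_sto => /=.
    * by sp; rewrite /= ?xi ?g16 ?g17 ?g34.
    * by sp; rewrite /= ?xi ?g15a ?g15b ?k16 ?k17 ?m17 //; clear -l2 la1 hb1 cv; lia.
    split=> /=; [by fr|by []|by lia|].
    rewrite xi g16 g17 g34 g15a g15b k16 k17 m17 //; split.
      move=> i'; rewrite ltnS leq_eqVlt => /orP[/eqP->|ii].
        rewrite eqxx ltn_mod; split=> //; rewrite F2mod !natrD la2 hb2 /phiF -addrA -big_split /=.
        by under [in RHS]eq_bigr => g _ do rewrite mulrDr.
      rewrite flat_inj //; have -> /= : (i' == i) = false by apply/eqP; lia.
      exact: I5.
    move=> i' jj im' jjb ne; rewrite flat_inj // (negbTE ne) andbF; exact: J5.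
  + move=> s5 F5 x5 T5 [I5 J5].
    have F15 : frame [:: 21; 35; 36; 37; 38; 39] [:: 3; 16; 17] (upc s1 (drop m (hc s1))) s5.
      by apply: (frame_step _ F5) => //; apply: (frame_step _ F14).
    split.
    * by rewrite (frR F15).
    * by rewrite (pe14 (penv_frame F5 _ _ P4)).
    split=> /=.
    * apply: frame_tick; apply: frame_upr => //; apply: (frame_step _ F15) => //.
      have -> : drop (j.+1 * m) (hc s) = drop m (hc s1).
        by rewrite C1 drop_drop mulSn.
      exact: (frame_upc (drop m (hc s1)) F1).
    * move: T1 T2 T3 T4 T5 => /=; clear; lia.
    * move=> i jj im; rewrite ltnS leq_eqVlt => /orP[/eqP->|jjj].
        by rewrite -C1; apply: I5.
      rewrite J5 ?ltn_add2l //; [exact: I1|exact: ltn_trans jb|by apply/eqP; lia].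
    * move=> i jj im jl; rewrite J5 // ?J1 //; first by apply: leq_trans jl (leq_addr _ _).
      by apply/eqP; lia.
- move=> s1 x34 x14 [F1 T1 I1 J1]; apply: HQ => //=.
  by clear -T1; lia.
Qed.
End Phi.

Definition enc_prog (C : nat) : prog :=
  init_prog C ;; join_prog ;; vemit_prog ;; eemit_prog ;; phi_prog.

Section EncAll.
Variables (w n m f C : nat) (u0 v0 : nat -> nat).
Notation wp := (wp w nocall).
Let L := lg n.
Let b := f + C * L.
Hypothesis n0 : 0 < n.
Hypothesis f0 : 0 < f.
Hypothesis u0n : forall i, i < m -> u0 i < n.
Hypothesis v0n : forall i, i < m -> v0 i < n.
Hypothesis big : (m + n + 2) * (L + L + b + 4) < lim w.
Hypothesis Cl : C < lim w.

Notation CO := (vcomp n m L u0 v0).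
Notation PO := (pos n m L u0 v0).
Notation LO := (lowp n m L u0 v0).
Notation HI := (highp n m L u0 v0).
Notation NT := (nontree n m L u0 v0).

Definition edge_phi (r : seq bool) (i j : nat) : bool :=
  phiF m u0 v0 PO NT LO HI (drop (j * m) r) i != 0%R.

Lemma enc_wp s (Q : hst -> Prop) :
  hm s 0 0 = n -> hm s 0 1 = f -> hr s 1 = m ->
  (forall i, i < m -> hm s 1 i = u0 i /\ hm s 2 i = v0 i) ->
  b * m <= size (hc s) ->
  (forall s', hk s' <= hk s + 2000 * ((m + n) * (L + b)) ->
    (forall x, x < n -> hm s' 0 x = L + L) ->
    (forall x j, x < n -> j < L -> hm s' 1 (x * (L + L) + j) = bitn (CO x) j /\
       hm s' 1 (x * (L + L) + (L + j)) = bitn (PO x) j) ->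
    (forall i, i < m -> hm s' 2 i = L + L + b) ->
    (forall i j, i < m -> j < L -> hm s' 3 (i * (L + L + b) + j) = bitn (LO i) j /\
       hm s' 3 (i * (L + L + b) + (L + j)) = bitn (HI i) j) ->
    (forall i j, i < m -> j < b ->
       (hm s' 3 (i * (L + L + b) + (L + L + j)) != 0) = edge_phi (hc s) i j) -> Q s') ->
  wp (enc_prog C) s Q.
Proof.
move=> e00 e01 e1 ein cs HQ.
have [nL Ln] := lg_bounds n0; rewrite -/L in nL Ln.
have L0 : 0 < L by [].
have b0 : 0 < b by rewrite /b; lia.
apply: wp_seq; apply: (@init_wp w n m f C u0 v0) => // s1 D1 C1 T1 EI A1.
have [g10 g12 g13 g14 [g16 g17]] := D1.
apply: wp_seq; apply: (@join_wp w n m L b u0 v0) => // s2 F2 T2 A2 V2.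
have D2 := edims_frame F2 isT D1.
apply: wp_seq; apply: (@vemit_wp w n m f C) => // s3 F3 T3 S3 B3.
have D3 := edims_frame F3 isT D2.
have low i : i < m -> LO i < n /\ HI i < n by move=> im; apply: low_lt.
have mn i : i < m -> i < m + n by move=> im; apply: ltn_addr.
have [_ _ _ A2'] := A2.
have xy i : i < m -> hm s3 7 i < n /\ hm s3 8 i < n.
  move=> im; rewrite !(frM F3) //; have [-> -> _] := A2' i (mn _ im).
  by apply: (@xa_lt n m L u0 v0) => //; apply: mn.
apply: wp_seq; apply: (@eemit_wp w n m f C) => // s4 F4 T4 S4 X4 B4.
have D4 := edims_frame F4 isT D3.
have [h10 h12 h13 h14 [h16 h17]] := D4.
have v12 x : x < n -> hm s4 12 (x + x + 1) = PO x.
  by move=> xn; rewrite (frM F4) // (frM F3) //; case: (V2 x xn).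
have m15 i : i < m -> hm s4 15 (i + i) = LO i /\ hm s4 15 (i + i + 1) = HI i.
  move=> im; have [x7 x8] := xy i im.
  have [-> ->] := X4 i im; rewrite - !(frM F4 (a := 12)) // !v12 // !(frM F3) //.
  by have [-> -> _] := A2' i (mn _ im).
have P4 : penv n m L b u0 v0 PO NT LO HI s4.
  split=> //.
  - by move=> i im; rewrite (frM F4) // (frM F3) //; have [_ _ ->] := A2' i (mn _ im).
  - move=> i im; rewrite (frM F4) // (frM F3) // (frM F2) //.
    by have [-> _] := EI i (mn _ im); rewrite /Ue im.
  - move=> i im; rewrite (frM F4) // (frM F3) // (frM F2) //.
    by have [_ ->] := EI i (mn _ im); rewrite /Ve im.
have C4 : hc s4 = hc s by rewrite (frC F4) (frC F3) (frC F2) C1.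
apply: (@phi_wp w n m L b u0 v0 PO NT LO HI) => //; rewrite ?C4 //.
- by move=> x xn; apply: pos_lt.
- by move=> i im; apply: nontree_lt.
- by move=> i im; case: (low i im).
- by move=> i im; case: (low i im).
move=> s5 F5 T5 P5 B5; apply: HQ.
- move: T1 T2 T3 T4 T5; clear - L0 b0 n0.
  move: (hk s) (hk s1) (hk s2) (hk s3) (hk s4) (hk s5) => k0 k1 k2 k3 k4 k5.
  rewrite -?/L; move: (L) L0 (b) b0 => l l0 c c0.
  have y1 : m <= m * l by rewrite leq_pmulr.
  have y2 : n <= n * l by rewrite leq_pmulr.
  have y3 : l <= n * l by rewrite leq_pmull.
  have y4 : c <= n * c by rewrite leq_pmull.
  have y5 : m <= m * c by rewrite leq_pmulr.
  by move=> T1 T2 T3 T4 T5; lia.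
- by move=> x xn; rewrite (frM F5) // (frM F4) // S3.
- move=> x j xn jL; rewrite (frM F5) //= (frM F4) //.
  have jj : j < L + L by apply: ltn_addr.
  have jj' : L + j < L + L by rewrite ltn_add2l.
  have e2 y : x * (L + L) + y = (x + x) * L + y by rewrite mulnDr mulnDl.
  rewrite !B3 ?ltn_flat //; rewrite !e2 !divnMDl // !modnMDl divn_small // modn_small // addn0.
  rewrite divnDl // divnn L0 divn_small // addn0 modnDl modn_small //.
  by have [-> ->] := V2 x xn.
- by move=> i im; rewrite (frM F5) //= S4.
- move=> i j im jL.
  have jj : j < L + L by apply: ltn_addr.
  have jj' : L + j < L + L by rewrite ltn_add2l.
  rewrite !B5 // !B4 // divn_small // modn_small // addn0.
  rewrite divnDl // divnn L0 divn_small // addn0 modnDl modn_small //.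
  by have [-> ->] := m15 i im.
- move=> i j im jb; have [h1 h2] := P5 i j im jb.
  by rewrite /edge_phi -h2 -val_eqE /= F2val modn_small.
Qed.
End EncAll.

Lemma read_const st a k M i : (forall i, i < k -> Defs.mem st a i = M) -> i < k ->
  nth [::] (read_strings st a k) i = mkseq (fun j => Defs.mem st a.+1 (i * M + j) != 0) M.
Proof.
move=> H ik; rewrite /read_strings.
have -> : read_array st a k = nseq k M.
  apply: (@eq_from_nth _ 0); rewrite size_mkseq ?size_nseq // => j jk.
  by rewrite nth_mkseq // nth_nseq jk H.
rewrite sumn_nseq nth_reshape nth_nseq ik take_nseq //; last exact: ltnW.
rewrite sumn_nseq.
set bits := map _ _.
have sz : M <= size (drop (M * i) bits).
  by rewrite size_drop size_map size_mkseq -mulnBr leq_pmulr // subn_gt0.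
apply: (@eq_from_nth _ false); first by rewrite size_mkseq size_takel.
move=> j; rewrite size_takel // => jM; rewrite nth_take // nth_drop.
have lt : M * i + j < M * k by rewrite [M * i]mulnC [M * k]mulnC ltn_flat.
rewrite (nth_map 0) ?size_mkseq // nth_mkseq // nth_mkseq // mulnC.
by [].
Qed.

(** * Cuts *)

Lemma F2addb (a c : bool) : ((a (+) c)%:R = a%:R + c%:R :> 'F_2)%R.
Proof. by apply: val_inj; case: a; case: c. Qed.

Lemma F2nz (a : 'F_2) : ((a != 0)%:R = a)%R.
Proof. by apply: val_inj; case: a => [[|[|a]] ia]. Qed.

Lemma F2b_inj (a c : bool) : (a%:R = c%:R :> 'F_2)%R -> a = c.
Proof. by move=> /(congr1 val); case: a; case: c. Qed.

Lemma F2P (a : 'F_2) : exists c : bool, (a = c%:R)%R.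
Proof. by exists (a != 0)%R; rewrite F2nz. Qed.

Lemma F2addxx (a : 'F_2) : (a + a = 0)%R.
Proof. by apply/eqP; rewrite F2add_eq0. Qed.

(** The padding rows and columns of the decoder matrix are zero and drop out; the columns below [b]
    and column [b] give the two conditions. *)
Lemma in_spanP k b ps pt la lb (ph : nat -> nat -> bool) : 0 < k ->
  in_span k b ps pt la lb (fun q j => ph q j) <->
  exists x : {ffun 'I_k -> 'F_2},
    (forall j, j < b -> (\sum_q x q * (ph q j)%:R = 0)%R) /\
    (\sum_q x q * (path_bit ps pt la lb q)%:R = 1)%R.
Proof.
move=> k0; rewrite /in_span; set k2 := 2 ^ _; set W := dec_width b k2.
have k20 : 0 < k2 by rewrite expn_gt0.
have kk2 : k <= k2 by apply: up_logP.
have bW : b < W.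
  by have := ltn_ceil (b + 1) k20; rewrite /W /dec_width addn1 [_ %/ _ + 1]addn1; apply: leq_trans.
have narrow (D : 'rV['F_2]_k2) (M : nat -> nat) :
   (\sum_(r < k2) D 0 r * (if r < k then M r else 0)%N%:R =
    \sum_(q < k) D 0 (widen_ord kk2 q) * (M q)%:R)%R.
  have := @big_ord_narrow _ 0%R +%R _ _ (fun r : 'I_k2 => D 0 r * (M r)%:R)%R kk2; rewrite /= => <-; rewrite [RHS]big_mkcond /=.
  by apply: eq_bigr => r _; case: ifP => //; rewrite mulr0.
have ent (D : 'rV['F_2]_k2) (c : 'I_W) :
   ((D *m mxF W k2 (fun r c => (dec_mx k b ps pt la lb (fun q j => ph q j) r c)%:R)) 0 c =
    \sum_(q < k) D 0 (widen_ord kk2 q) *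
      (if c < b then nat_of_bool (ph q c) else if c == b :> nat then path_bit ps pt la lb q else 0)%N%:R)%R.
  have := narrow D (fun q => if c < b then nat_of_bool (ph q c) else if c == b :> nat then path_bit ps pt la lb q else 0).
  by move=> <-; rewrite mxE; apply: eq_bigr => r _; rewrite mxE /dec_mx.
split.
  case/submxP => D HD; exists [ffun q => D 0%R (widen_ord kk2 q)]; split=> [j jb|].
    have jW := ltn_trans jb bW.
    have := congr1 (fun M : 'rV_W => M 0 (Ordinal jW))%R HD; rewrite ent mxE /= jb (ltn_eqF jb) => /esym e.
    apply: etrans e.
    by apply: eq_bigr => q _; rewrite ffunE.
  have := congr1 (fun M : 'rV_W => M 0 (Ordinal bW))%R HD; rewrite ent mxE /= ltnn eqxx => /esym e.
  apply: etrans e.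
  by apply: eq_bigr => q _; rewrite ffunE.
case=> x [x0 x1].
pose D : 'rV['F_2]_k2 := (\row_r (if insub (r : nat) is Some q then x q else 0))%R.
have DE q : (D 0 (widen_ord kk2 q) = x q)%R.
  by rewrite mxE /= insubT //= => qk; congr (x _); apply: val_inj.
apply/submxP; exists D; apply/rowP => c; rewrite ent mxE.
under eq_bigr => q _ do rewrite DE.
case: ltnP => cb; first by rewrite x0 // (ltn_eqF cb).
by case: eqP => e; rewrite ?x1 // big1 // => q _; rewrite mulr0.
Qed.

Section Cuts.
Variables (n m L : nat) (u0 v0 : nat -> nat).
Hypothesis n0 : 0 < n.
Hypothesis nL : n < 2 ^ L.
Hypothesis u0n : forall i, i < m -> u0 i < n.
Hypothesis v0n : forall i, i < m -> v0 i < n.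
Notation CO := (vcomp n m L u0 v0).
Notation PO := (pos n m L u0 v0).
Notation LO := (lowp n m L u0 v0).
Notation HI := (highp n m L u0 v0).
Notation NT := (nontree n m L u0 v0).
Notation SD := (side n m L u0 v0).
Variables (k : nat) (idx : nat -> nat).
Hypothesis idm : forall q, q < k -> idx q < m.
Hypothesis idi : forall q q', q < k -> q' < k -> idx q = idx q' -> q = q'.
Implicit Type x : {ffun 'I_k -> 'F_2}.

(** The characteristic function of the cut encoded by [x]: the sum of the sides of the chosen tree
    edges, nontree edges contributing nothing. *)
Definition pot_of x (v : nat) : 'F_2 := (\sum_q x q * (SD (idx q) v)%:R)%R.
Definition mem_of x (g : nat) : 'F_2 := (\sum_q x q * (idx q == g)%:R)%R.
(* Nonzero exactly on the nontree edges violating that [x] is the coboundary of [pot_of x]. *)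
Definition defect x (g : nat) : 'F_2 := (mem_of x g + (pot_of x (u0 g) + pot_of x (v0 g)))%R.

Lemma nontree01 i : i < m -> NT i = 0 \/ NT i = 1.
Proof. by move=> im; have := nontree_lt n0 nL u0n v0n im; case: (NT i) => [|[|]]; [left|right|]. Qed.

(** Among tree edges, each side switches across its own edge only. Defects can therefore occur on
    nontree edges alone. *)
Lemma pot_tree x j : j < m -> NT j = 0 -> (pot_of x (u0 j) + pot_of x (v0 j) = mem_of x j)%R.
Proof.
move=> jm tj; rewrite -big_split /=; apply: eq_bigr => q _; rewrite -mulrDr -F2addb.
have im := idm (ltn_ord q); case: (nontree01 im) => ti; first by rewrite side_tree.
rewrite !side_nontree //; case: eqP => // e.
by rewrite e tj in ti.
Qed.

Lemma path_bit_side s t q : s < n -> t < n -> q < k ->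
  ((path_bit (PO s) (PO t) (fun q => LO (idx q)) (fun q => HI (idx q)) q)%:R =
   (SD (idx q) s)%:R + (SD (idx q) t)%:R :> 'F_2)%R.
Proof. by move=> sn tn qk; rewrite /path_bit F2mod !natrD /side !F2addb !addrA. Qed.

Lemma path_sum x s t : s < n -> t < n ->
  (\sum_(q < k) x q * (path_bit (PO s) (PO t) (fun q => LO (idx q)) (fun q => HI (idx q)) q)%:R
   = pot_of x s + pot_of x t)%R.
Proof.
move=> sn tn; rewrite -big_split /=; apply: eq_bigr => q _.
by rewrite path_bit_side // mulrDr.
Qed.

Definition nt_coin (r : seq bool) (g : nat) : 'F_2 := ((nth false r g)%:R * (NT g)%:R)%R.

(** By exchanging sums, a combination of labels becomes the inner product of the random vector with
    the defect; this is what makes a vanishing combination evidence for a cut. *)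
Lemma phi_sum x r :
  (\sum_(q < k) x q * phiF m u0 v0 PO NT LO HI r (idx q) =
   \sum_(g < m) nt_coin r g * defect x g)%R.
Proof.
have cE g : ((coinv NT r g)%:R = nt_coin r g)%R by rewrite /coinv natrM.
rewrite /phiF; under eq_bigr => q _ do rewrite mulrDr.
rewrite big_split /=; under [in RHS]eq_bigr => g _ do rewrite /defect mulrDr.
rewrite big_split /=; congr (_ + _)%R.
  rewrite /mem_of; under [in RHS]eq_bigr => g _ do rewrite mulr_sumr.
  rewrite exchange_big /=; apply: eq_bigr => q _.
  rewrite (bigD1 (Ordinal (idm (ltn_ord q)))) //= eqxx mulr1 big1 ?addr0 ?cE 1?mulrC // => g.
  by rewrite -val_eqE /= eq_sym => /negbTE ->; rewrite mulr0 mulr0.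
under eq_bigr => q _ do rewrite mulr_sumr.
rewrite exchange_big /=; apply: eq_bigr => g _.
rewrite /pot_of -big_split mulr_sumr /=; apply: eq_bigr => q _.
rewrite cE /endlt /side !F2addb; ring.
Qed.

(** The favourable event for the coins. It depends on the faults but not on the two vertices of the
    query. *)
Definition detecting (b : nat) (r : seq bool) :=
  forall x, (forall j, j < b -> (\sum_(g < m) nt_coin (drop (j * m) r) g * defect x g = 0)%R) ->
    forall g, g < m -> NT g = 1 -> defect x g = 0%R.

(** Without defects [pot_of x] changes only across chosen faults, so it is itself the required
    separating function. *)
Lemma cut_of_sum x s t : s < n -> t < n -> (pot_of x s + pot_of x t = 1)%R ->
  (forall g, g < m -> NT g = 1 -> defect x g = 0%R) ->
  exists h : nat -> bool, h s <> h t /\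
   forall g, g < m -> (forall q, q < k -> idx q <> g) -> h (u0 g) = h (v0 g).
Proof.
move=> sn tn p1 H; exists (fun v => (pot_of x v != 0)%R); split.
  move=> e; move: p1; rewrite -(F2nz (pot_of x s)) e F2nz F2addxx => /eqP.
  by rewrite eq_sym oner_eq0.
move=> g gm ng; have m0 : mem_of x g = 0%R.
  by apply: big1 => q _; case: eqP => [/ng|]; [move=> /(_ (ltn_ord q))|rewrite mulr0].
apply: F2b_inj; rewrite !F2nz; apply/eqP; rewrite -F2add_eq0.
case: (nontree01 gm) => tg; first by rewrite pot_tree // m0.
by have := H g gm tg; rewrite /defect m0 add0r => ->.
Qed.

(** [x] selects the faults that [h] crosses. Then [h + pot_of x] is unchanged across tree edges,
    hence constant on components, so [pot_of x] has the same differences as [h] inside each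
    component. *)
Lemma sum_of_cut (h : nat -> bool) s t : s < n -> t < n -> CO s = CO t -> h s <> h t ->
  (forall g, g < m -> (forall q, q < k -> idx q <> g) -> h (u0 g) = h (v0 g)) ->
  exists x, (pot_of x s + pot_of x t = 1)%R /\ (forall g, g < m -> defect x g = 0%R).
Proof.
move=> sn tn cst hst H.
pose x : {ffun 'I_k -> 'F_2} := [ffun q : 'I_k => ((h (u0 (idx q)))%:R + (h (v0 (idx q)))%:R)%R].
have memE g : g < m -> mem_of x g = ((h (u0 g))%:R + (h (v0 g))%:R)%R.
  move=> gm; rewrite /mem_of; case: (pickP (fun q : 'I_k => idx q == g)) => [q /eqP qg|ng].
    rewrite (bigD1 q) //= big1 ?addr0 ?ffunE ?qg ?eqxx ?mulr1 // => q' q'q.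
    case: eqP => [e|]; last by rewrite mulr0.
    by case/eqP: q'q; apply: val_inj; exact: idi (ltn_ord q') (ltn_ord q) (etrans e (esym qg)).
  rewrite big1 => [|q _]; last by rewrite ng mulr0.
  rewrite H ?F2addxx // => q qk /eqP; by rewrite (ng (Ordinal qk)).
pose g v := h v (+) (pot_of x v != 0)%R.
have gc a c : a < n -> c < n -> CO a = CO c -> g a = g c.
  apply: (comp_tree n0 nL u0n v0n) => i im ti; apply: F2b_inj.
  rewrite /g !F2addb !F2nz; apply/eqP; rewrite -F2add_eq0.
  have := pot_tree x im ti; rewrite memE // => e.
  by rewrite addrACA e F2addxx.
have hE a c : a < n -> c < n -> CO a = CO c ->
  (pot_of x a + pot_of x c = (h a)%:R + (h c)%:R)%R.
  move=> an cn ac; have := gc _ _ an cn ac => /(congr1 (fun a : bool => a%:R : 'F_2)%R).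
  rewrite /g !F2addb !F2nz => /eqP; rewrite -F2add_eq0 addrACA F2add_eq0 => /eqP.
  by move=> ->.
exists x; split.
  rewrite hE // -F2addb; move: hst; by case: (h s); case: (h t).
move=> i im; rewrite /defect memE // hE ?F2addxx //; [exact: u0n|exact: v0n|].
exact: comp_edge.
Qed.

End Cuts.

(** * Probability of failure *)

Section Flips.
Variables (T m b : nat) (a : nat -> 'F_2).
Hypothesis bmT : b * m <= T.

Definition block_sum (r : seq bool) (j : nat) : 'F_2 :=
  (\sum_(g < m) (nth false r (j * m + g))%:R * a g)%R.

(* Flipping coin [g0] of block [j] changes the [j]-th sum, so the [2 ^ b] translates of the
   set of coin sequences with zero sums are disjoint. *)
Lemma zero_sums_card g0 : g0 < m -> a g0 <> 0%R ->
  #|[set r : T.-tuple bool | [forall j : 'I_b, block_sum r j == 0%R]]| * 2 ^ b <= 2 ^ T.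
Proof.
move=> gm a0; set Z := [set r | _].
pose msk (y : {ffun 'I_b -> bool}) (i : nat) : bool :=
  (i %% m == g0) && (if insub (i %/ m) is Some j then y j else false).
pose tr (p : T.-tuple bool * {ffun 'I_b -> bool}) : T.-tuple bool :=
  [tuple tnth p.1 i (+) msk p.2 i | i < T].
have a1 : a g0 = 1%R.
  by move: a0; case: (F2P (a g0)) => [[|]] ->.
have tnE p (j : 'I_b) g : g < m ->
   nth false (tr p) (j * m + g) = nth false p.1 (j * m + g) (+) ((g == g0) && p.2 j).
  move=> gm'; have jl : j * m + g < T.
    by apply: leq_trans bmT; apply: ltn_flat.
  rewrite - !(tnth_nth false _ (Ordinal jl)) tnth_mktuple /msk /= flat_mod // flat_div //.
  by rewrite insubT //= => jb; congr (_ (+) (_ && p.2 _)); apply: val_inj.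
have sumE p (j : 'I_b) : (block_sum (tr p) j = block_sum p.1 j + (p.2 j)%:R)%R.
  rewrite /block_sum; under eq_bigr => g _ do rewrite tnE // F2addb mulrDl.
  rewrite big_split /=; congr (_ + _)%R.
  rewrite (bigD1 (Ordinal gm)) //= eqxx a1 mulr1 big1 ?addr0 // => g.
  by rewrite -val_eqE /= => /negbTE ->; rewrite mul0r.
have inj : {in finset.setX Z (finset.setTfor {ffun 'I_b -> bool}) &, injective tr}.
  case=> r1 y1 [r2 y2]; rewrite !inE !andbT /= => /forallP z1 /forallP z2 e.
  have yy : y1 = y2.
    apply/ffunP => j; apply: F2b_inj.
    have := sumE (r1, y1) j; rewrite e sumE /= (eqP (z1 j)) (eqP (z2 j)) !add0r.
    by move=> ->.
  congr (_, _) => //; apply/eq_from_tnth => i.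
  have := congr1 (fun t => tnth t i) e; rewrite !tnth_mktuple /= yy.
  by move=> /(congr1 (addb^~ (msk y2 i))); rewrite !addbK.
have := max_card (tr @: finset.setX Z (finset.setTfor {ffun 'I_b -> bool})).
by rewrite card_in_imset // cardsX finset.cardsT card_ffun card_tuple card_bool card_ord.
Qed.
End Flips.

Section BadCoins.
Variables (n m L : nat) (u0 v0 : nat -> nat) (k b T : nat) (idx : nat -> nat).
Hypothesis bmT : b * m <= T.
Notation gd := (detecting n m L u0 v0 k idx b).

(** A union bound over the combinations whose defect is nonzero on some nontree edge, multiplied out
    so that it stays an inequality between integers. *)
Lemma bad_card :
  #|[set r : T.-tuple bool | ~~ `[< gd r >]]| * 2 ^ b <= 2 ^ k * 2 ^ T.
Proof.
pose df (x : {ffun 'I_k -> 'F_2}) g := defect n m L u0 v0 idx x g.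
(* The flag restricts the defect to nontree edges, the only ones on which the random vectors
   live. *)
pose a (x : {ffun 'I_k -> 'F_2}) g := ((nontree n m L u0 v0 g)%:R * df x g : 'F_2)%R.
pose Z x := [set r : T.-tuple bool | [forall j : 'I_b, block_sum m (a x) r j == 0%R]].
pose X := [set x : {ffun 'I_k -> 'F_2} | [exists g : 'I_m, a x g != 0%R]].
have sub : [set r : T.-tuple bool | ~~ `[< gd r >]] \subset (\bigcup_(x in X) Z x)%SET.
  apply/fintype.subsetP => r; rewrite inE => /asboolPn /existsNP[x] /not_implyP[zx] /existsNP[g].
  move=> /not_implyP[gm] /not_implyP[tg dg].
  apply/finset.bigcupP; exists x.
    rewrite inE; apply/existsP; exists (Ordinal gm).
    by rewrite /a /= tg mul1r; apply/eqP.
  rewrite inE; apply/forallP => j; apply/eqP.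
  rewrite -[RHS](zx j (ltn_ord j)); apply: eq_bigr => i _.
  by rewrite /nt_coin nth_drop mulrA.
have cX : #|X| <= 2 ^ k.
  by apply: leq_trans (max_card _) _; rewrite card_ffun !card_ord.
have cZ x : x \in X -> #|Z x| * 2 ^ b <= 2 ^ T.
  by rewrite inE => /existsP[g /eqP ag]; apply: (zero_sums_card bmT (ltn_ord g) ag).
apply: leq_trans (leq_mul cX (leqnn (2 ^ T))).
apply: leq_trans (leq_mul (subset_leq_card sub) (leqnn (2 ^ b))) _.
have le : #|(\bigcup_(x in X) Z x)%SET| <= \sum_(x in X) #|Z x|.
  elim/big_rec2: _ => [|x c A _ h]; first by rewrite cards0.
  by apply: leq_trans (leq_card_setU _ _) _; rewrite leq_add2l.
apply: leq_trans (leq_mul le (leqnn _)) _; rewrite big_distrl /=.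
apply: (@leq_trans (\sum_(x in X) 2 ^ T)); first exact: leq_sum.
by rewrite sum_nat_const.
Qed.
End BadCoins.

(** Since [b - k >= C * lg n] and [n <= 2 ^ lg n], the failing fraction is at most the inverse of
    [n ^ C], and [C] was chosen above [c]. *)
Lemma coin_prob_ge (R : realType) (T k b n : nat) (c : R) (C : nat) (X G : seq bool -> Prop) :
  0 < n -> (c <= C%:R)%R -> k + C * lg n <= b ->
  (forall r : T.-tuple bool, G r -> X r) ->
  #|[set r : T.-tuple bool | ~~ `[< G r >]]| * 2 ^ b <= 2 ^ k * 2 ^ T ->
  (1 - (powR n%:R c)^-1 <= coin_prob R T X)%R.
Proof.
move=> n0 cC kb GX H; rewrite /coin_prob.
set S := [set r : T.-tuple bool | `[< X r >]].
set B := [set r : T.-tuple bool | ~~ `[< G r >]] in H.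
have cT : #|S| + #|B| >= 2 ^ T.
  rewrite -card_bool -card_tuple -finset.cardsT.
  apply: leq_trans (leq_card_setU _ _); apply: subset_leq_card; apply/fintype.subsetP => r _.
  rewrite !inE; case: asboolP => //= nX; apply/asboolP => h; apply: nX; exact: GX.
have B2 : #|B| * n ^ C <= 2 ^ T.
  rewrite -(leq_pmul2r (m := 2 ^ k)) ?expn_gt0 // [2 ^ T * _]mulnC.
  apply: leq_trans H; rewrite -mulnA leq_mul2l; apply/orP; right.
  apply: leq_trans (leq_pexp2l _ kb) => //; rewrite addnC expnD leq_mul2r; apply/orP; right.
  rewrite mulnC expnM; have [nl _] := lg_bounds n0; clear kb cC.
  case: (C) => [|C0]; rewrite ?expn0 ?expn0 ?leq_exp2r //; last exact: ltnW.
have n1 : (1 <= n%:R :> R)%R by rewrite ler1n.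
have p0 : (0 < powR n%:R c :> R)%R by apply: powR_gt0; rewrite ltr0n.
have pC : (powR n%:R c <= (n ^ C)%:R :> R)%R.
  by rewrite natrX -powR_mulrn ?ler0n //; apply: ler_powR.
have t0 : (0 < (2 ^ T)%:R :> R)%R by rewrite ltr0n expn_gt0.
rewrite ler_pdivlMr // mulrBl mul1r lerBlDr.
have cT' : ((2 ^ T)%:R <= #|S|%:R + #|B|%:R :> R)%R by rewrite -natrD ler_nat.
apply: le_trans cT' _; rewrite lerD2l mulrC ler_pdivlMr //.
apply: le_trans (_ : #|B|%:R * (n ^ C)%:R <= _)%R; first by rewrite ler_wpM2l ?ler0n.
by rewrite -natrM ler_nat.
Qed.

(** * Correctness of the labels *)

Definition end1 n (es : seq ('I_n * 'I_n)) i := nth 0 [seq val e.1 | e <- es] i.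
Definition end2 n (es : seq ('I_n * 'I_n)) i := nth 0 [seq val e.2 | e <- es] i.
Definition eidx n (es : seq ('I_n * 'I_n)) (e : {set 'I_n}) := index e (edges_of es).

Section Queries.
Variables (n m : nat) (E : {set {set 'I_n}}) (es : seq ('I_n * 'I_n)).
Hypothesis n0 : 0 < n.
Hypothesis Em : #|E| = m.
Hypothesis esE : perm_eq (edges_of es) (enum E).
Notation u0 := (end1 es).
Notation v0 := (end2 es).

Lemma size_es : size es = m.
Proof. by rewrite -Em cardE -(perm_size esE) size_map. Qed.

Lemma end1_lt i : i < m -> u0 i < n.
Proof.
rewrite -size_es => im; have /mapP[e _] : u0 i \in [seq val e.1 | e <- es].
  by apply: mem_nth; rewrite size_map.
by move=> ->; apply: ltn_ord.
Qed.

Lemma end2_lt i : i < m -> v0 i < n.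
Proof.
rewrite -size_es => im; have /mapP[e _] : v0 i \in [seq val e.2 | e <- es].
  by apply: mem_nth; rewrite size_map.
by move=> ->; apply: ltn_ord.
Qed.

Lemma edges_uniq : uniq (edges_of es).
Proof. by rewrite (perm_uniq esE) enum_uniq. Qed.

Lemma mem_edges e : (e \in edges_of es) = (e \in E).
Proof. by rewrite (perm_mem esE) mem_enum. Qed.

Lemma eidx_lt e : e \in E -> eidx es e < m.
Proof. by rewrite -mem_edges -size_es -(size_map (fun e => [set e.1; e.2]) es) index_mem. Qed.

Lemma eidx_ends e : e \in E -> exists x y : 'I_n,
  [/\ e = [set x; y], u0 (eidx es e) = x & v0 (eidx es e) = y].
Proof.
move=> eE; have il := eidx_lt eE; rewrite -size_es in il.
have : nth finset.set0 (edges_of es) (eidx es e) = e by rewrite nth_index // mem_edges.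
move: (eidx es e) il => i il {eE}.
have [p0 _] : exists p : 'I_n * 'I_n, true by case: es il => [//|p]; exists p.
rewrite /edges_of (nth_map p0) // => <-.
by exists (nth p0 es i).1, (nth p0 es i).2; rewrite /end1 /end2 !(nth_map p0).
Qed.

Lemma ends_eidx i : i < m -> exists2 e, e \in E & eidx es e = i.
Proof.
move=> im; have sz : i < size (edges_of es) by rewrite size_map size_es.
exists (nth finset.set0 (edges_of es) i); first by rewrite -mem_edges mem_nth.
by rewrite /eidx index_uniq // edges_uniq.
Qed.

Lemma eidx_inj e e' : e \in E -> e' \in E -> eidx es e = eidx es e' -> e = e'.
Proof.
rewrite - !mem_edges => h h' q.
by rewrite -(nth_index finset.set0 h) -[index e _]/(eidx es e) q nth_index.
Qed.

Variables (f : nat) (F : {set {set 'I_n}}) (fs : seq {set 'I_n}).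
Hypothesis FQ : fault_query f E F fs.
Let k := size fs.
Let idx q := eidx es (nth finset.set0 fs q).

Lemma fs_mem e : (e \in fs) = (e \in F).
Proof. by case: FQ => _ _ p; rewrite (perm_mem p) mem_enum. Qed.

Lemma fs_nth q : q < k -> nth finset.set0 fs q \in F /\ nth finset.set0 fs q \in E.
Proof.
move=> qk; have h : nth finset.set0 fs q \in F by rewrite -fs_mem mem_nth.
by split=> //; case: FQ => /fintype.subsetP S _ _; apply: S.
Qed.

Lemma fs_size : k <= f.
Proof. by case: FQ => _ h p; rewrite /k (perm_size p) -cardE. Qed.

Lemma idx_lt q : q < k -> idx q < m.
Proof. by move=> qk; apply: eidx_lt; case: (fs_nth qk). Qed.

Lemma idx_inj q q' : q < k -> q' < k -> idx q = idx q' -> q = q'.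
Proof.
move=> qk qk' e; apply/eqP; rewrite -(nth_uniq finset.set0 qk qk').
  by apply/eqP; apply: eidx_inj e; [case: (fs_nth qk)|case: (fs_nth qk')].
by case: FQ => _ _ p; rewrite (perm_uniq p) enum_uniq.
Qed.

(** Equality across surviving edges propagates along paths. It is applied to component names as well
    as to Boolean cuts, whence the general codomain. *)
Lemma connected_potential (T : eqType) (h : nat -> T) (s t : 'I_n) :
  (forall g, g < m -> (forall q, q < k -> idx q <> g) -> h (u0 g) = h (v0 g)) ->
  connected_in (E :\: F) s t -> h s = h t.
Proof.
move=> H c; apply/eqP.
have := @closed_connect _ _ [pred x : 'I_n | h s == h x] _ s t c; rewrite !inE eqxx => <- // x y.
rewrite /= inE => /andP[nF eE]; rewrite !inE.
have [a [e [xy ua va]]] := eidx_ends eE.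
have hae : h a = h e.
  rewrite -ua -va; apply: H; first exact: eidx_lt.
  move=> q qk eq; have [qF qE] := fs_nth qk.
  by move: nF; rewrite -(eidx_inj qE eE eq) qF.
have : x \in [set a; e] by rewrite -xy !inE eqxx.
have : y \in [set a; e] by rewrite -xy !inE eqxx orbT.
by rewrite !inE => /orP[]/eqP-> /orP[]/eqP->; rewrite ?hae.
Qed.

(** The vertices reachable from [s] form such a cut. *)
Lemma connected_cut (s t : 'I_n) : ~~ connected_in (E :\: F) s t ->
  exists h : nat -> bool, h s <> h t /\
   forall g, g < m -> (forall q, q < k -> idx q <> g) -> h (u0 g) = h (v0 g).
Proof.
move=> nc; exists (fun v => if insub v is Some x then connected_in (E :\: F) s x else false).
have insE (x : 'I_n) : insub (val x) = Some x by rewrite valK.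
rewrite !insE (negbTE nc) {1}/connected_in connect0; split=> // g gm ng.
have [e eE eg] := ends_eidx gm; have [x [y [exy ux vy]]] := eidx_ends eE.
rewrite -eg ux vy !insE.
have eF : e \in E :\: F.
  rewrite inE eE andbT -fs_mem; apply/negP => eF; apply: (ng (index e fs)); rewrite ?index_mem //.
  by rewrite /idx nth_index.
apply/idP/idP => c; apply: (connect_trans c); apply: connect1; rewrite /= ?[[set y; x]]finset.setUC -exy //.
Qed.

Let L := lg n.
Let nL : n < 2 ^ L. Proof. by case: (lg_bounds n0). Qed.
Let un := end1_lt.
Let vn := end2_lt.

Notation CO := (vcomp n m L u0 v0).
Notation PO := (pos n m L u0 v0).

(** Errors are one-sided: a true cut always yields a suitable combination, while a spurious one for
    a connected pair is excluded by [detecting]. *)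
Lemma decode_correct (b : nat) (r : seq bool) (s t : 'I_n) : detecting n m L u0 v0 k idx b r ->
  (CO s == CO t) && ((k == 0) || ~~ in_span k b (PO s) (PO t) (fun q => lowp n m L u0 v0 (idx q))
     (fun q => highp n m L u0 v0 (idx q)) (fun q j => edge_phi n m u0 v0 r (idx q) j)) =
  connected_in (E :\: F) s t.
Proof.
move=> G; case: (boolP (connected_in _ _ _)) => [c|nc].
  have co : CO s = CO t.
    apply: connected_potential c => g gm _; exact: comp_edge.
  rewrite co eqxx /=; case: eqP => //= /eqP; rewrite -lt0n => k0.
  apply/negP => /(in_spanP _ _ _ _ _ _ k0)[x [x0]].
  rewrite path_sum // => x1.
  have [|h [hst H]] := cut_of_sum n0 nL un vn idx_lt (ltn_ord s) (ltn_ord t) x1.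
    apply: G => j jb; rewrite -[RHS](x0 j jb) -phi_sum; last exact: idx_lt.
    by apply: eq_bigr => q _; rewrite F2nz.
  by apply: hst; apply: connected_potential H c.
apply/negP => /andP[/eqP co].
have [h [hst H]] := connected_cut nc.
have [x [x1 x0]] := sum_of_cut n0 nL un vn idx_lt idx_inj (ltn_ord s) (ltn_ord t) co hst H.
case: (posnP k) => k0.
  by move: x1; rewrite /pot_of !big1 ?addr0; [move/eqP; rewrite eq_sym oner_eq0|by case=> q qk; exfalso; rewrite k0 in qk..].
rewrite /= => /negP; apply; apply/(in_spanP _ _ _ _ _ _ k0); exists x; split.
  move=> j jb; under eq_bigr => q _ do rewrite F2nz.
  rewrite phi_sum; last exact: idx_lt.
  by apply: big1 => g _; rewrite x0 // mulr0.
by rewrite path_sum.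
Qed.

End Queries.

(** * Encoder and decoder as machine programs *)

Lemma runs_mono w p st (Q Q' : nat -> state -> Prop) :
  (forall t st', Q t st' -> Q' t st') -> runs w p st Q -> runs w p st Q'.
Proof. by move=> H [t [st' [e q]]]; exists t, st'; split=> //; apply: H. Qed.

Lemma loaded_wf w inp st r : loaded w inp st -> wf w (set_coins st r).
Proof. by case. Qed.

Lemma mkseq_cat (T : Type) (g : nat -> T) a b :
  mkseq g (a + b) = mkseq g a ++ mkseq (fun j => g (a + j)) b.
Proof. by rewrite /mkseq iotaD map_cat add0n -{2}(addn0 a) iotaDl -map_comp. Qed.

Lemma nth_map_iota (T1 T2 : Type) (x0 : T1) (g : T1 -> T2) s :
  [seq g (nth x0 s q) | q <- iota 0 (size s)] = map g s.
Proof. by rewrite -[in RHS](mkseq_nth x0 s) -map_comp. Qed.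

Section EncRuns.
Variables (n m f C w : nat) (E : {set {set 'I_n}}) (es : seq ('I_n * 'I_n)) (st : state).
Let L := lg n.
Let b := f + C * L.
Hypothesis n0 : 0 < n.
Hypothesis f0 : 0 < f.
Hypothesis Em : #|E| = m.
Hypothesis esE : perm_eq (edges_of es) (enum E).
Hypothesis ld : loaded w (graph_input es f) st.
Hypothesis w0 : 0 < w.
Hypothesis big : (m + n + 2) * (L + L + b + 4) < lim w.
Hypothesis Cl : C < lim w.
Notation u0 := (end1 es).
Notation v0 := (end2 es).

Definition labels_ok (r : seq bool) (st' : state) : Prop :=
  (forall v : 'I_n, vlabel st' v = vlab L (vcomp n m L u0 v0 v) (pos n m L u0 v0 v)) /\
  (forall e, e \in E -> elabel es st' e =
     elab L (lowp n m L u0 v0 (eidx es e)) (highp n m L u0 v0 (eidx es e)) b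
          (edge_phi n m u0 v0 r (eidx es e))).

Lemma enc_runs r : b * m <= size r ->
  runs w (cp Skip (enc_prog C)) (set_coins st r) (fun t st' =>
    t <= 2000 * ((m + n) * (L + b)) /\ labels_ok r st').
Proof.
move=> br; have [_ _ l3 l4] := ld.
have szm := size_es Em esE.
have [e00 e01] : Defs.mem st 0 0 = n /\ Defs.mem st 0 1 = f by rewrite !l4.
have e1 : reg st 1 = m by rewrite l3 //= size_map szm.
have e2 i : i < m -> Defs.mem st 1 i = u0 i /\ Defs.mem st 2 i = v0 i.
  by move=> im; rewrite !l4 ?size_map ?szm.
have H : wp w nocall (enc_prog C) (hst_of (set_coins st r)) (fun s' =>
  hk s' <= 2000 * ((m + n) * (L + b)) /\ forall st', sim w st' s' -> labels_ok r st').
  apply: (@enc_wp w n m f C u0 v0 n0 f0 (end1_lt Em esE) (end2_lt Em esE)) => //.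
  move=> s' T A0 A1 A2 A3 A4; split; first by rewrite add0n in T.
  move=> st' [_ _ M _]; split=> [v|e eE].
    have A0' i : i < n -> Defs.mem st' 0 i = L + L by rewrite M; apply: A0.
    rewrite /vlabel (read_const A0') // mkseq_cat; congr (_ ++ _).
      apply/eq_in_map => j; rewrite mem_iota => /andP[_ jL].
      by have [q _] := A1 v j (ltn_ord v) jL; rewrite M q /bitn eqb0 negbK.
    apply/eq_in_map => j; rewrite mem_iota => /andP[_ jL].
    by have [_ q] := A1 v j (ltn_ord v) jL; rewrite M q /bitn eqb0 negbK.
  have im := eidx_lt Em esE eE.
  have A2' i : i < m -> Defs.mem st' 2 i = L + L + b by rewrite M; apply: A2.
  rewrite /elabel szm (read_const A2') // (mkseq_cat _ (L + L) b) (mkseq_cat _ L L) -catA.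
  congr (_ ++ (_ ++ _)); apply/eq_in_map => j; rewrite mem_iota => /andP[_ jL]; rewrite M.
  - by have [q _] := A3 _ _ im jL; rewrite q /bitn eqb0 negbK.
  - by have [_ q] := A3 _ _ im jL; rewrite q /bitn eqb0 negbK.
  - by rewrite A4.
apply: runs_mono (nocall_sound w0 _ (loaded_wf r ld) H) => // t st' [s' [S [T R]] tk].
split; [exact: leq_trans tk T|exact: R].
Qed.
End EncRuns.

Section DecRuns.
Variables (n m f C w K0 : nat) (tm : nat -> nat) (P : cmd).
Variables (E : {set {set 'I_n}}) (es : seq ('I_n * 'I_n)).
Let L := lg n.
Let b := f + C * L.
Hypothesis n0 : 0 < n.
Hypothesis Em : #|E| = m.
Hypothesis esE : perm_eq (edges_of es) (enum E).
Hypothesis w0 : 0 < w.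
Hypothesis MM : mm_spec w K0 tm P.
Hypothesis w7 : 7 < lim w.
Hypothesis Ll : 2 ^ L <= lim w.
Variables (s t : 'I_n) (F : {set {set 'I_n}}) (fs : seq {set 'I_n}).
Hypothesis FQ : fault_query f E F fs.
Let k := size fs.
Hypothesis RWl : 0 < k ->
  (2 ^ up_log 2 k + 2 ^ up_log 2 k) * dec_width b (2 ^ up_log 2 k) < lim w.
Hypothesis Kw : K0 * lg (2 ^ up_log 2 k) <= w.
Let idx q := eidx es (nth finset.set0 fs q).

Lemma dec_runs r st' d : labels_ok m f C E es r st' ->
  loaded w (query_input es st' s t fs) d ->
  runs w (cp (mm_call P) dec_prog) (set_coins d [::]) (fun time d' =>
    time <= 400 + 200 * L + (if k == 0 then 0 else dec_time tm L k b) /\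
    (detecting n m L (end1 es) (end2 es) k idx b r -> answer d' = connected_in (E :\: F) s t)).
Proof.
set u0 := end1 es; set v0 := end2 es.
case=> LV LE ld; have nL : n < 2 ^ L by case: (lg_bounds n0).
have un := end1_lt Em esE; have vn := end2_lt Em esE.
pose la q := lowp n m L u0 v0 (idx q); pose lb q := highp n m L u0 v0 (idx q).
have QL : query_input es st' s t fs = strings_input (query_labels L k b
   (vcomp n m L u0 v0 s) (vcomp n m L u0 v0 t) (pos n m L u0 v0 s) (pos n m L u0 v0 t)
   la lb (fun q => edge_phi n m u0 v0 r (idx q))).
  rewrite /query_input !LV /query_labels -(nth_map_iota finset.set0).
  congr (strings_input [:: _, _ & _]); apply/eq_in_map => q; rewrite mem_iota => /andP[_ qk].
  by rewrite LE //; case: (fs_nth FQ qk).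
rewrite QL in ld.
have low q : q < k -> la q < 2 ^ L /\ lb q < 2 ^ L.
  move=> qk; have [h1 h2] := low_lt n0 nL un vn (idx_lt Em esE FQ qk).
  by split; apply: ltn_trans nL.
have cl (v : 'I_n) : vcomp n m L u0 v0 v < 2 ^ L.
  by apply: ltn_trans (comp_lt n0 nL un vn _) nL.
have pl (v : 'I_n) : pos n m L u0 v0 v < 2 ^ L.
  by apply: ltn_trans (pos_lt n0 nL un vn _) nL.
pose Q (s' : hst) := hk s' <= 400 + 200 * L + (if k == 0 then 0 else dec_time tm L k b) /\
    (detecting n m L u0 v0 k idx b r -> (hr s' 0 != 0) = connected_in (E :\: F) s t).
have H : wp w (mmcs w K0 tm) dec_prog (hst_of (set_coins d [::])) Q.
  apply: (dec_prog_wp _ w7 RWl Kw _ _ Ll _ _ _ _ ld) => //.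
  - by move=> q /low[].
  - by move=> q /low[].
  move=> s' T A; split=> // G; rewrite A; exact: (decode_correct n0 Em esE FQ).
have S : sim w (set_coins d [::]) (hst_of (set_coins d [::])) by split=> //; exact: loaded_wf ld.
have [tt [d' [s' [Ex [_ R _ _] [Q1 Q2] T]]]] := wp_sound w0 (mm_call_ok w0 MM) (erefl : okp dec_prog) S H.
exists tt, d'; split=> //; split; first by apply: leq_trans Q1; rewrite addn0 in T.
by move=> G; rewrite /answer R // Q2.
Qed.
End DecRuns.

(** * Time and word size *)

Lemma pow_up_log_le k : 0 < k -> 2 ^ up_log 2 k <= k + k.
Proof.
case: (ltnP 1 k) => [k1 _|]; last by case: k => [|[|?]].
have := up_log_bounds (isT : 1 < 2) k1; case: (up_log 2 k) => [|u] /andP[h _] //=.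
  by move: h; rewrite expn0; lia.
by move: h; rewrite expnS /= mul2n -addnn => h; lia.
Qed.

Lemma dec_width_le C f L k : 0 < k -> k <= f -> 0 < L ->
  dec_width (f + C * L) (2 ^ up_log 2 k) <= (C + 4) * (f + L).
Proof.
move=> k0 kf L0; have := pow_up_log_le k0; move: (2 ^ _) => k2 h.
rewrite /dec_width mulnDl mul1n.
apply: leq_trans (leq_add (leq_trunc_div _ _) (leqnn _)) _.
by rewrite !mulnDl !mulnDr; lia.
Qed.

Section DecTime.
Local Open Scope ring_scope.
Variables (R : realType) (t : R) (Km : R).
Hypothesis t2 : 2 < t.
Hypothesis t3 : t <= 3.
Hypothesis Km0 : 0 <= Km.
(** The clock counts in natural numbers; truncating a real bound loses nothing for an integral
    number of steps. *)
Definition mm_bound (s : nat) : nat := Num.truncn (Km * powR s%:R t).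

Lemma mm_boundE (s : nat) : (mm_bound s)%:R <= Km * powR s%:R t.
Proof. by rewrite truncn_le mulr_ge0 // powR_ge0. Qed.

Let K250 : 0 <= 250 + Km. Proof. by rewrite addr_ge0 // ler0n. Qed.

(** The ratio of the geometric sum over the levels; it exceeds 1 because [t > 2]. *)
Let q : R := powR 2 (t - 2).

Lemma q_gt1 : 1 < q.
Proof.
have e : powR 1 (t - 2) = 1 :> R by rewrite powR1.
rewrite /q -[X in X < _]e.
by apply: gt0_ltr_powR; rewrite ?subr_gt0 // ?nnegrE ?ler01 ?ler0n // ltr1n.
Qed.

Lemma powR_2l (l : nat) : powR (2 ^ l)%:R t = q ^+ l * ((2 ^ l)%:R * (2 ^ l)%:R) :> R.
Proof.
rewrite !natrX -(powR_mulrn l) ?ler0n // -powRrM [l%:R * t]mulrC powRrM powR_mulrn ?powR_ge0 //.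
have -> : powR 2 t = q * (2 * 2) :> R.
  rewrite -{1}(subrK 2 t) powRD; last by rewrite pnatr_eq0 implybT.
  by rewrite -/q powR_mulrn ?ler0n // expr2.
by rewrite powR_mulrn ?ler0n // exprMn exprMn.
Qed.

(** [q / (q - 1)] bounds the quotient of the geometric sum by its last term. *)
Let Kp : R := (250 + Km) * (q / (q - 1)).

(** Level [l] runs [2 ^ (Lk - l)] eliminations of [W / 2 ^ l] products, each of order
    [4 ^ l * q ^ l]; the powers of two collapse to [2 ^ Lk * W]. *)
Lemma pot_term (W Lk l : nat) : (l <= Lk)%N -> (2 ^ Lk <= W)%N ->
  ((2 ^ Lk %/ 2 ^ l * lcost mm_bound W l)%N)%:R <= (250 + Km) * ((2 ^ Lk)%:R * W%:R) * q ^+ l.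
Proof.
move=> lL LW; rewrite /lcost /ecost.
have s0 : (0 < 2 ^ l)%N by rewrite expn_gt0.
have : (1 <= W %/ 2 ^ l)%N.
  by rewrite divn_gt0 //; apply: leq_trans LW; rewrite leq_exp2l.
have : (W %/ 2 ^ l * 2 ^ l <= W)%N by apply: leq_trunc_div.
have : (2 ^ Lk %/ 2 ^ l * 2 ^ l = 2 ^ Lk)%N.
  by apply: divnK; apply: dvdn_exp2l.
have Hb := mm_boundE (2 ^ l); move: Hb; rewrite powR_2l.
have Q1 : 1 <= q ^+ l by apply: exprn_ege1; apply: ltW q_gt1.
move: (q ^+ l) Q1 => Q Q1.
move: (2 ^ l)%N s0 (mm_bound _) (W %/ _)%N (2 ^ Lk %/ _)%N => S S0 M Y Z HM ZS YS Y1.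
have {}ZS : Z%:R * S%:R = (2 ^ Lk)%:R :> R by rewrite -natrM ZS.
have {}YS : Y%:R * S%:R <= W%:R :> R by rewrite -natrM ler_nat.
have {}Y1 : 1 <= Y%:R :> R by rewrite ler1n.
have {}S0 : 1 <= S%:R :> R by rewrite ler1n.
rewrite -ZS !(natrM, natrD).
move: (Z%:R : R) (Y%:R : R) (S%:R : R) (M%:R : R) (W%:R : R) Y1 S0 YS HM (ler0n R Z) => z y s u w y1 s1 ys hu z0.
have S2 : 1 <= s * s by nra.
have QS : s * s <= Q * (s * s) by rewrite ler_peMl //; nra.
(* The constant 250 is 150 = 90 + 60 for each strip plus 100 = 30 + 30 + 40 for each elimination. *)
have h1 : 90 * (s * s) + u + 60 <= (150 + Km) * (Q * (s * s)) by lra.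
have h2 : 30 * (s * s) + 30 + 40 <= 100 * (y * (Q * (s * s))).
  have : Q * (s * s) <= y * (Q * (s * s)) by rewrite ler_peMl //; lra.
  lra.
have h3 : 30 * (s * s) + 30 + y * (90 * (s * s) + u + 60) + 40 <= (250 + Km) * (y * (Q * (s * s))).
  have : y * (90 * (s * s) + u + 60) <= y * ((150 + Km) * (Q * (s * s))) by rewrite ler_wpM2l //; lra.
  lra.
apply: le_trans (_ : z * ((250 + Km) * (y * (Q * (s * s)))) <= _); first by rewrite ler_wpM2l.
have -> : z * ((250 + Km) * (y * (Q * (s * s)))) = ((250 + Km) * (z * s) * Q) * (y * s) by ring.
have -> : (250 + Km) * (z * s * w) * Q = ((250 + Km) * (z * s) * Q) * w by ring.
have Q0 : 0 <= Q by lra.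
have s0 : 0 <= s by lra.
have K0 := K250.
have c0 : 0 <= (250 + Km) * (z * s) * Q by rewrite !mulr_ge0.
exact: ler_wpM2l.
Qed.

Lemma pot_le (W Lk : nat) : (2 ^ Lk <= W)%N ->
  (pot mm_bound W Lk.+1 (2 ^ Lk))%:R <= Kp * W%:R * powR (2 ^ Lk)%:R (t - 1).
Proof.
move=> LW; rewrite /pot natr_sum.
have q1 := q_gt1.
apply: le_trans (ler_sum _ (fun (l : 'I_Lk.+1) _ => pot_term _ LW)) _ => [l _|].
  by rewrite -ltnS.
rewrite -mulr_sumr.
have -> : powR (2 ^ Lk)%:R (t - 1) = (2 ^ Lk)%:R * q ^+ Lk.
  have k0 : (2 ^ Lk)%:R != 0 :> R by rewrite pnatr_eq0 -lt0n expn_gt0.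
  apply: (mulIf k0); rewrite mulrAC -mulrA [_ * q ^+ _]mulrC mulrA.
  rewrite -{2}(powRr1 (ler0n R (2 ^ Lk))) -powRD; last by rewrite k0 implybT.
  rewrite subrK powR_2l; ring.
have geo : \sum_(i < Lk.+1) q ^+ i <= q / (q - 1) * q ^+ Lk.
  have q10 : 0 < q - 1 by lra.
  rewrite mulrAC ler_pdivlMr // mulrC -subrX1 exprS; lra.
have -> : Kp * W%:R * ((2 ^ Lk)%:R * q ^+ Lk) =
  (250 + Km) * ((2 ^ Lk)%:R * W%:R) * (q / (q - 1) * q ^+ Lk) by rewrite /Kp; ring.
by rewrite ler_wpM2l // !mulr_ge0 // ler0n.
Qed.

Lemma Kp_ge0 : 0 <= Kp.
Proof.
have q1 := q_gt1.
by rewrite mulr_ge0 // divr_ge0 // ?subr_ge0; apply: ltW => //; lra.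
Qed.

Variable C : nat.
Let D := (C + 4)%N.

Lemma dec_time_le : exists K : R, 0 <= K /\ forall (f L k : nat),
  (0 < k)%N -> (k <= f)%N -> (0 < L)%N ->
  (dec_time mm_bound L k (f + C * L))%:R <= K * ((f + L)%:R * powR f%:R (t - 1)).
Proof.
(* The first summand pays for all work of order [(f + L) * f], the second for the eliminations. The
   factor 4 comes from [k2 <= 2 * f] and [t - 1 <= 2], the factor [D] from the width. *)
exists (2000 * D%:R + 4 * Kp * D%:R); split=> [|f L k k0 kf L0].
  have Kp0 := Kp_ge0.
  by apply: addr_ge0; [apply: mulr_ge0|apply: mulr_ge0 => //; apply: mulr_ge0].
have Wl := dec_width_le C k0 kf L0.
have k2l := pow_up_log_le k0.
rewrite /dec_time; set k2 := (2 ^ _)%N in Wl k2l *; set W := dec_width _ _ in Wl *.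
set X := (f + L)%N in Wl *.
have kW : (k2 <= W)%N by rewrite /W /dec_width mulnDl mul1n leq_addl.
have P := pot_le kW.
have f1 : (0 < f)%N by apply: leq_trans kf.
set np := (pot _ _ _ _) in P *.
set tot := (X in X%:R <= _).
have totE : (tot <= 2000 * (D * (X * f)) + np)%N.
  have b1 : (k * (f + C * L) <= D * (X * f))%N.
    by rewrite [(X * f)%N]mulnC mulnCA leq_mul // /D /X; clear; nia.
  have b2 : ((k2 + k2) * W <= 4 * (D * (X * f)))%N.
    have -> : (4 * (D * (X * f)) = (f + f + (f + f)) * (D * X))%N by clear; ring.
    by apply: leq_mul => //; clear - k2l kf; lia.
  have X1 : (0 < X)%N by rewrite addn_gt0 f1.
  have Df : (X * f <= D * (X * f))%N by rewrite leq_pmull // /D; clear; lia.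
  have b3 : (k * L <= D * (X * f))%N.
    by apply: leq_trans Df; rewrite mulnC leq_mul // leq_addl.
  have b4 : (k <= D * (X * f))%N by apply: leq_trans Df; apply: leq_trans kf _; rewrite leq_pmull.
  have b5 : (W * k2 <= 4 * (D * (X * f)))%N.
    by apply: leq_trans b2; rewrite mulnC leq_mul // leq_addr.
  have b6 : (W <= D * (X * f))%N by apply: leq_trans Wl _; rewrite leq_mul // leq_pmulr.
  have b7 : (0 < D * (X * f))%N by apply: leq_trans Df; rewrite muln_gt0 X1.
  move: b1 b2 b3 b4 b5 b6 b7 k2l; rewrite /tot -/np; clear.
  move: (D * (X * f))%N (np) (W) (k2) => Y p w' k2'.
  by lia.
have t2' := t2; have t3' := t3.
have pf : f%:R <= powR f%:R (t - 1) :> R.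
  rewrite -{1}(powRr1 (ler0n R f)); apply: ler_powR; rewrite ?ler1n //; lra.
have pk : powR k2%:R (t - 1) <= 4 * powR f%:R (t - 1) :> R.
  apply: (@le_trans _ _ (powR (2 * f%:R) (t - 1))).
    apply: ge0_ler_powR; rewrite ?nnegrE ?mulr_ge0 ?ler0n //; first by lra.
    by rewrite -natrM ler_nat mul2n -addnn; apply: leq_trans k2l _; rewrite leq_add.
  rewrite powRM ?ler0n // ler_wpM2r ?powR_ge0 //.
  have -> : 4 = powR 2 2 :> R by rewrite powR_mulrn ?ler0n // expr2; lra.
  by apply: ler_powR; lra.
move: totE; rewrite -(ler_nat R) => h; apply: le_trans h _.
rewrite natrD !natrM [X in _ <= X]mulrDl; apply: lerD.
  rewrite mulrA ler_wpM2l ?mulr_ge0 ?ler0n // ler_wpM2l //.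
apply: le_trans P _.
have -> : 4 * Kp * D%:R * (X%:R * powR f%:R (t - 1)) = (Kp * (D * X)%:R) * (4 * powR f%:R (t - 1)).
  by rewrite natrM; ring.
have Kp0 := Kp_ge0.
by apply: ler_pM => //; [exact: mulr_ge0|exact: powR_ge0|rewrite ler_wpM2l // ler_nat].
Qed.
End DecTime.

(** Both bounds follow from [(f + L) * f ^ (t - 1)]: replace the power by [f ^ 2] using [t <= 3], or
    by [(f + L) ^ (t - 1)] and then raise the exponent to [tau]. *)
Lemma dec_total_le (R : realType) (t tau Km : R) (C : nat) :
  (2 < t)%R -> (t <= 3)%R -> (0 <= Km)%R -> (t <= tau)%R ->
  exists K : nat, forall f L k, k <= f -> 0 < f -> 0 < L ->
    let T := 400 + 200 * L + (if k == 0 then 0 else dec_time (mm_bound t Km) L k (f + C * L)) in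
    T <= K * ((f + L) * f ^ 2) /\ (T%:R <= K%:R * powR (f + L)%:R tau)%R.
Proof.
move=> t2 t3 Km0 tt.
have [K [K0 HK]] := dec_time_le t2 t3 Km0 C.
(* [400 + 200 * L <= 600 * (f + L)] covers the reading of the vertex labels. *)
pose K1 := Num.bound (600 + K)%R.
have K1P : (600 + K <= K1%:R)%R by apply/ltW/archi_boundP; rewrite addr_ge0.
exists K1 => f L k kf f0 L0 T.
set X := f + L in HK *; pose F : R := powR f%:R (t - 1).
have f1 : (1 <= f%:R :> R)%R by rewrite ler1n.
have F1 : (1 <= F)%R.
  rewrite -(powRr0 f%:R); apply: ler_powR => //; lra.
have XF : (X%:R <= X%:R * F)%R by rewrite ler_peMr.
have TF : (T%:R <= K1%:R * (X%:R * F))%R.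
  apply: (@le_trans _ _ ((600 + K) * (X%:R * F))%R); last first.
    by rewrite ler_wpM2r // mulr_ge0 // powR_ge0.
  rewrite mulrDl /T natrD; apply: lerD.
    apply: (@le_trans _ _ (600 * X%:R)%R); last by rewrite ler_wpM2l.
    by rewrite -natrM ler_nat /X; clear -f0 L0; lia.
  case: posnP => k0; first by rewrite !mulr_ge0 // powR_ge0.
  exact: HK.
split.
  rewrite -(ler_nat R); apply: le_trans TF _; rewrite 2!natrM ler_wpM2l // ler_wpM2l // natrX.
  rewrite -powR_mulrn //; apply: ler_powR => //; lra.
apply: le_trans TF _; rewrite ler_wpM2l //.
have X1 : (1 <= X%:R :> R)%R by rewrite ler1n addn_gt0 f0.
apply: (@le_trans _ _ (powR X%:R t)); last exact: ler_powR.
have -> : powR X%:R t = (X%:R * powR X%:R (t - 1))%R.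
  rewrite -{2}(powRr1 (ler0n R X)) -powRD; first by congr powR; lra.
  by rewrite implybE (gt_eqF (lt_le_trans ltr01 X1)) orbT.
rewrite ler_wpM2l //; apply: ge0_ler_powR; rewrite ?nnegrE //; first by lra.
by rewrite ler_nat leq_addr.
Qed.

(** * Word size *)

Lemma lg_le n : 0 < n -> lg n <= n.
Proof. by move=> n0; apply: leq_trans (ltn_expl _ (isT : 1 < 2)) (trunc_logP _ n0). Qed.

Lemma lg_mono n n' : n <= n' -> lg n <= lg n'.
Proof. by move=> h; rewrite /lg ltnS leq_trunc_log. Qed.

Section Words.
Variables (n m f C K0 K w : nat).
Let L := lg n.
Let b := f + C * L.
Let N := n + f.
Hypothesis n0 : 0 < n.
Hypothesis f0 : 0 < f.
Hypothesis mn : m <= n * n.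
Hypothesis KC : C + 11 + 2 * K0 <= K.
Hypothesis Kw : K * lg N <= w.

(** The input parameters are below [M], so every intermediate number is below a fixed power of [M],
    and words hold [M ^ (C + 11)]. *)
Let M := 2 ^ lg N.
Let NM : N < M. Proof. by case: (@lg_bounds N _) => //; rewrite addn_gt0 n0. Qed.
Let M4 : 4 <= M.
Proof.
rewrite /M (_ : 4 = 2 ^ 2) // leq_exp2l //; apply: leq_trans (lg_mono (n := 2) _) => //.
by rewrite /N; lia.
Qed.

Lemma lim_ge i : i <= C + 11 -> M ^ i <= lim w.
Proof.
move=> h; rewrite /M /lim -expnM leq_exp2l //; apply: leq_trans Kw.
by rewrite mulnC leq_mul2r; apply/orP; right; apply: leq_trans KC; apply: leq_trans h _; apply: leq_addr.
Qed.

(** Constant factors that involve [C] are themselves absorbed into a power of [M]. *)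
Let CM i : C + i < M ^ (C + i).
Proof. by apply: leq_trans (ltn_expl _ (isT : 1 < 2)) _; case: (C + i) => // j; rewrite leq_exp2r //; apply: leq_trans M4. Qed.

Let MM i j : M ^ i * M ^ j = M ^ (i + j). Proof. by rewrite expnD. Qed.
Let L0 : 0 < L. Proof. by []. Qed.
Let Ln : L <= n. Proof. exact: lg_le. Qed.

Lemma lim7 : 7 < lim w.
Proof. by apply: leq_trans (lim_ge (i := 2) _); [rewrite -mulnn; nia|lia]. Qed.

Lemma limC : C < lim w.
Proof. by have := CM 0; rewrite addn0 => h; apply: leq_trans h (lim_ge _); lia. Qed.

Lemma lim_w0 : 0 < w.
Proof. by have := lim7; rewrite /lim; case: (w). Qed.

Lemma lim_Lg : 2 ^ L <= lim w.
Proof.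
have [_ h] := lg_bounds n0; apply: leq_trans h _; apply: leq_trans (lim_ge (i := 2) _); last by lia.
by have := NM; have := M4; rewrite -mulnn /N; move: (M) => x; nia.
Qed.

Lemma lim_big : (m + n + 2) * (L + L + b + 4) < lim w.
Proof.
(* Both factors are at most [M ^ 2] up to the constant [C + 7], which costs [M ^ (C + 7)]; this is
   where the exponent [C + 11] comes from. *)
apply: leq_trans (lim_ge (i := 2 + 1 + 1 + (C + 7)) _); last by lia.
have h1 : m + n + 2 <= M ^ 2 * 1.
  rewrite muln1 -mulnn; have := NM; rewrite /N; move: (M) => x h.
  apply: leq_trans (_ : n * n + n + 2 <= _); first by rewrite !leq_add2r.
  have : (n + 2) * (n + 2) <= x * x by apply: leq_mul; lia.
  by nia.
have h2 : L + L + b + 4 <= M ^ 2 * (C + 7).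
  have := NM; have := M4; rewrite /N /b -mulnn; move: (M) (L) Ln => x l ln h4 h.
  have : C * l <= x * x * C by rewrite mulnC leq_mul //; nia.
  have : l + l + f + 4 <= x * x * 7 by nia.
  by rewrite mulnDr; lia.
have := leq_mul h1 h2 => h; apply: leq_ltn_trans h _.
rewrite muln1 mulnA (MM 2 2) -[X in _ < X](MM 4) ltn_pmul2l; first exact: CM.
by rewrite expn_gt0 (leq_trans _ M4).
Qed.

Variable k : nat.
Hypothesis kf : k <= f.

Lemma lim_RW : 0 < k -> (2 ^ up_log 2 k + 2 ^ up_log 2 k) * dec_width b (2 ^ up_log 2 k) < lim w.
Proof.
move=> k0; have := dec_width_le C k0 kf L0; have := pow_up_log_le k0.
rewrite -/b; move: (2 ^ _) (dec_width _ _) => k2 W k2k WX.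
apply: leq_trans (lim_ge (i := 2 + 2 + (C + 4)) _); last by lia.
have h1 : k2 + k2 <= M ^ 2.
  have := NM; have := M4; rewrite /N -mulnn; move: (M) => x h4 h; nia.
have h2 : f + L <= M ^ 2.
  have := NM; have := M4; rewrite /N -mulnn; move: (M) (L) Ln => x l ln h4 h; nia.
apply: leq_ltn_trans (leq_mul h1 (leq_trans WX (leq_mul (leqnn _) h2))) _.
rewrite [(C + 4) * _]mulnC mulnA (MM 2 2) -[X in _ < X](MM 4) ltn_pmul2l; first exact: CM.
by rewrite expn_gt0 (leq_trans _ M4).
Qed.

(** Rounding up to a power of two costs at most one more bit, and [lg N + 1 <= 2 * lg N]; hence the
    factor 2 in front of [K0]. *)
Lemma lim_K0 : K0 * lg (2 ^ up_log 2 k) <= w.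
Proof.
apply: leq_trans Kw; apply: leq_trans (leq_mul KC (leqnn _)).
rewrite mulnDl -[X in X <= _]add0n leq_add // [2 * K0]mulnC -mulnA leq_mul2l; apply/orP; right.
case: (posnP k) => k0; first by rewrite k0.
apply: (@leq_trans (lg (N.*2))).
  by apply: lg_mono; apply: leq_trans (pow_up_log_le k0) _; rewrite /N; lia.
have N0 : 0 < N by rewrite addn_gt0 n0.
by rewrite /lg trunc_log2_double // mul2n -addnn addSn !ltnS leq_addl.
Qed.
End Words.

Lemma card_edges n m (E : {set {set 'I_n}}) es : #|E| = m -> perm_eq (edges_of es) (enum E) ->
  m <= n * n.
Proof.
move=> Em esE; rewrite -Em; have <- : #|{: 'I_n * 'I_n}| = n * n by rewrite card_prod !card_ord.
apply: leq_trans (leq_imset_card (fun p : 'I_n * 'I_n => [set p.1; p.2]) _).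
apply: subset_leq_card; apply/fintype.subsetP => e eE.
have [x [y [-> _ _]]] := eidx_ends Em esE eE.
by apply/imsetP; exists (x, y).
Qed.

Lemma mm_spec_bound (R : realType) (t : R) P (K w : nat) :
  (forall (N w : nat) (A B : 'M['F_2]_N) (st : state),
    0 < N -> K * lg N <= w -> loaded w [:: [:: N]; mx_seq A; mx_seq B] st ->
    runs w P (set_coins st [::]) (fun t' st' =>
      (t'%:R <= K%:R * powR N%:R t :> R)%R /\ read_array st' 0 (N * N) = mx_seq (A *m B)%R)) ->
  mm_spec w K (mm_bound t K%:R%R) P.
Proof.
move=> H n MA MB st n0 Kn ld; apply: runs_mono (H _ _ MA MB st n0 Kn ld) => t' st' [T A].
by split=> //; rewrite /mm_bound truncn_ge_nat // mulr_ge0 // powR_ge0.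
Qed.

Theorem theorem3p6 (R : realType) (c tau : R)
  (hc : (0 < c)%R)
  (htau : (omega R < tau)%R \/
          [/\ tau = omega R, mm_in_time tau & (2 < tau)%R]) :
  exists (Enc Dec : cmd) (K p : nat),
  forall (n m f w : nat) (E : {set {set 'I_n}}) (es : seq ('I_n * 'I_n))
         (st : state),
    0 < n -> 1 <= f -> simple_graph E -> #|E| = m ->
    perm_eq (edges_of es) (enum E) ->
    K * lg (n + f) <= w -> loaded w (graph_input es f) st ->
    let T := K * ((m + n) * f * lg n ^ p) in
    (forall r : T.-tuple bool,
      runs w Enc (set_coins st r) (fun time st' =>
        [/\ time <= T,
            forall v : 'I_n, size (vlabel st' v) <= K * lg n,
            forall e : {set 'I_n}, e \in E ->
              size (elabel es st' e) <= K * (f + lg n)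
          & forall (s t : 'I_n) (F : {set {set 'I_n}}) (fs : seq {set 'I_n})
                   (d : state),
              fault_query f E F fs -> loaded w (query_input es st' s t fs) d ->
              runs w Dec (set_coins d [::]) (fun time' _ =>
                time' <= K * ((f + lg n) * f ^ 2) /\
                (time'%:R <= K%:R * powR (f + lg n)%:R tau :> R)%R)]))
    /\
    (forall (s t : 'I_n) (F : {set {set 'I_n}}) (fs : seq {set 'I_n}),
      fault_query f E F fs ->
      (1 - (powR n%:R c)^-1 <=
       coin_prob R T (fun r =>
         runs w Enc (set_coins st r) (fun _ st' =>
           forall d : state, loaded w (query_input es st' s t fs) d ->
           runs w Dec (set_coins d [::]) (fun _ d' =>
             answer d' = connected_in (E :\: F) s t))))%R).
Proof.
have [t [t2 t3 tt [P [K0 MM]]]] := mm_good_exponent htau.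
pose C := Num.bound c.
have cC : (c <= C%:R)%R by apply/ltW/archi_boundP/ltW.
have [Kd HKd] := dec_total_le C t2 t3 (ler0n R K0) tt.
(* The summands serve the encoding time and the edge labels, the word size, and the decoding
   time. *)
pose K := 2000 * (C + 2) + (C + 11 + 2 * K0) + Kd.
exists (cp Skip (enc_prog C)), (cp (mm_call P) dec_prog), K, 1.
move=> n m f w E es st n0 f0 _ Em esE Kw ld T.
have mn := card_edges Em esE.
have KC : C + 11 + 2 * K0 <= K by apply: leq_trans (leq_addr _ _); apply: leq_addl.
have Kd' : Kd <= K by apply: leq_addl.
have C2 : 2000 * (C + 2) <= K by apply: leq_trans (leq_addr _ _); apply: leq_addr.
have K2 : 2 <= K by apply: leq_trans KC; clear; lia.
set L := lg n; have L0 : 0 < L by [].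
have big : (m + n + 2) * (L + L + (f + C * L) + 4) < lim w := lim_big n0 f0 mn KC Kw.
have Cl : C < lim w := limC n0 f0 mn KC Kw.
have w0 : 0 < w := lim_w0 n0 f0 mn KC Kw.
have w7 : 7 < lim w := lim7 n0 f0 mn KC Kw.
have Ll : 2 ^ L <= lim w := lim_Lg n0 f0 mn KC Kw.
have MMw : mm_spec w K0 (mm_bound t K0%:R%R) P by apply: mm_spec_bound.
(* [f] and [L] are at least 1, so each is at most their product; this turns the sum [f + log n] into
   the form [f * lg n ^ 1]. *)
have Lf : L + (f + C * L) <= (C + 2) * (f * L).
  have h1 : L <= f * L by rewrite leq_pmull.
  have h2 : f <= f * L by rewrite leq_pmulr.
  have h3 : C * L <= C * (f * L) by rewrite leq_mul2l h1 orbT.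
  by rewrite mulnDl; lia.
have TE : 2000 * ((m + n) * ((C + 2) * (f * L))) <= T.
  apply: leq_trans (leq_mul C2 (leqnn _)); rewrite expn1 -/L.
  by apply/eq_leq; clear; ring.
have tT : 2000 * ((m + n) * (L + (f + C * L))) <= T.
  by apply: leq_trans TE; rewrite leq_mul2l leq_mul2l Lf !orbT.
(* [T] also counts the available coins, and the encoder draws one for each edge in each of its [b]
   rounds. *)
have bT : (f + C * L) * m <= T.
  apply: leq_trans tT; apply: leq_trans (_ : 1 * ((m + n) * (L + (f + C * L))) <= _).
    by rewrite mul1n mulnC leq_mul // ?leq_addr ?leq_addl.
  by rewrite leq_mul2r orbT.
have dec st' r s t0 F fs d : fault_query f E F fs -> labels_ok m f C E es r st' ->
  loaded w (query_input es st' s t0 fs) d ->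
  runs w (cp (mm_call P) dec_prog) (set_coins d [::]) (fun time d' =>
    time <= 400 + 200 * L + (if size fs == 0 then 0 else
       dec_time (mm_bound t K0%:R%R) L (size fs) (f + C * L)) /\
    (detecting n m L (end1 es) (end2 es) (size fs) (fun q => eidx es (nth finset.set0 fs q)) (f + C * L) r ->
      answer d' = connected_in (E :\: F) s t0)).
  move=> FQ LB Ld.
  have kf := fs_size FQ.
  apply: (dec_runs n0 Em esE w0 MMw w7 Ll FQ _ _ LB Ld).
  - exact: (lim_RW n0 f0 mn KC Kw kf).
  - exact: (lim_K0 n0 f0 mn KC Kw kf).
have enc (r : T.-tuple bool) := enc_runs n0 f0 Em esE ld w0 big Cl (r := r).
split=> [r|s t0 F fs FQ].
  apply: runs_mono (enc r _) => [time st' [T1 LB]|]; last by rewrite size_tuple.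
  have [LV LE] := LB; split.
  - exact: leq_trans T1 tT.
  - by move=> v; rewrite LV size_vlab addnn -mul2n leq_mul2r K2 orbT.
  - move=> e eE; rewrite LE // size_elab.
    apply: leq_trans (leq_mul C2 (leqnn _)); rewrite -/L; clear; nia.
  - move=> s t0 F fs d FQ Ld; apply: runs_mono (dec _ _ _ _ _ _ _ FQ LB Ld) => time' d' [T2 _].
    have [h1 h2] := HKd f L (size fs) (fs_size FQ) f0 L0; split.
      by apply: leq_trans T2 _; apply: leq_trans h1 _; rewrite leq_mul2r Kd' orbT.
    apply: (@le_trans _ _ ((Kd%:R * powR (f + L)%:R tau)%R)).
      by apply: le_trans h2; rewrite ler_nat.
    by rewrite ler_wpM2r ?powR_ge0 // ler_nat.
apply: (@coin_prob_ge R T (size fs) (f + C * L) n c C _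
  (detecting n m L (end1 es) (end2 es) (size fs) (fun q => eidx es (nth finset.set0 fs q)) (f + C * L))) => //.
- by rewrite leq_add2r; apply: fs_size FQ.
- move=> r G; apply: runs_mono (enc r _) => [time st' [_ LB] d Ld|]; last by rewrite size_tuple.
  by apply: runs_mono (dec _ _ _ _ _ _ _ FQ LB Ld) => time' d' [_ A]; apply: A.
- exact: bad_card.
Qed.
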